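(* Let $q$ be a prime power and let $d\ge 3$ be the degree of a plane $\mathbf F_{q^2}$-maximal curve. Then either $d=q+1$ or $$d\le d_2(q):=\begin{cases}\lfloor (q+2)/2\rfloor & \text{if } q\ge 4 \text{ and } q\ne 5,\\ 3 & \text{if } q=3,\\ 4 & \text{if } q=5.\end{cases}$$ (For $q=2$, where $d_2(q)$ is not defined, the assertion is that $d=q+1$.) In particular, for $q\ne 3,5$, an $\mathbf F_{q^2}$-maximal curve has no non-singular plane model (over $\mathbf F_{q^2}$) if its genus belongs to the interval $\left(q(q-2)/8,\ q(q-2)/4\right]$ when $q$ is even, or to the interval $\left((q-1)(q-3)/8,\ (q-1)^2/4\right]$ when $q$ is odd.
   Context: An $\mathbf F_{q^2}$-maximal curve of genus $g$ is a projective, geometrically irreducible, non-singular algebraic curve defined over $\mathbf F_{q^2}$ whose number of $\mathbf F_{q^2}$-rational points equals $1+q^2+2qg$. A plane $\mathbf F_{q^2}$-maximal curve of degree $d$ is an $\mathbf F_{q^2}$-maximal curve that is a non-singular curve of degree $d$ in $\mathbf P^2$ defined over $\mathbf F_{q^2}$ (so $g=(d-1)(d-2)/2$). *)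

(* Defs.v *)
From HB Require Import structures.
From mathcomp Require Import all_boot all_order all_algebra.
From mathcomp Require Import mpoly.

Set Implicit Arguments.
Unset Strict Implicit.
Unset Printing Implicit Defensive.

Import GRing.Theory.
Local Open Scope ring_scope.

(* A point of P^n(F) is represented by its unique coordinate vector whose     *)
(* first nonzero entry is 1, so that equality of points is Leibniz equality   *)
(* and P^n(F) is a finType when F is finite.                                  *)
Definition normalized (F : fieldType) n (x : 'rV[F]_n.+1) : bool :=
  [exists i, (x 0 i == 1) && [forall j : 'I_n.+1, (j < i)%N ==> (x 0 j == 0)]].

Definition point (F : fieldType) n := {x : 'rV[F]_n.+1 | normalized x}.

(* The value of a form at a point depends on the chosen representative, its   *)
(* vanishing does not.                                                        *)
Definition coords (F : fieldType) n (P : point F n) : 'I_n.+1 -> F :=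
  fun i => val P 0 i.

Definition evalp (F : fieldType) n (p : {mpoly F[n.+1]}) (P : point F n) : F :=
  p.@[coords P].

Definition homogeneous (F : fieldType) n (p : {mpoly F[n.+1]}) : Prop :=
  exists d, p \is d.-homog.

Section Zariski.
Variables (L : closedFieldType) (n : nat).
Implicit Types Z : point L n -> Prop.

Definition closed_set Z : Prop :=
  exists S : {mpoly L[n.+1]} -> Prop,
    (forall p, S p -> homogeneous p) /\
    (forall P, Z P <-> forall p, S p -> evalp p P = 0).

Definition irreducible_closed Z : Prop :=
  [/\ closed_set Z, exists P, Z P &
      forall Z1 Z2, closed_set Z1 -> closed_set Z2 ->
        (forall P, Z P -> Z1 P \/ Z2 P) ->
        (forall P, Z P -> Z1 P) \/ (forall P, Z P -> Z2 P)].

Definition has_chain Z (r : nat) : Prop :=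
  exists C : nat -> point L n -> Prop,
    (forall i, (i <= r)%N -> irreducible_closed (C i) /\ forall P, C i P -> Z P)
    /\ (forall i, (i < r)%N ->
          (forall P, C i P -> C i.+1 P) /\ exists P, C i.+1 P /\ ~ C i P).

(* Krull dimension of the Zariski topology *)
Definition has_dim Z (r : nat) : Prop := has_chain Z r /\ ~ has_chain Z r.+1.

End Zariski.

Section FunctionField.
Variables (L : closedFieldType) (n : nat) (X : point L n -> Prop).

(* The function field L(X) of an irreducible X in P^n, given by a generic     *)
(* point: the forms vanishing at ff_gen are those vanishing on X, and the     *)
(* elements are the quotients of forms of equal degree.  This determines      *)
(* ff_sort up to a unique isomorphism compatible with these quotients.        *)
Record function_field := FunctionField {
  ff_sort :> fieldType;
  ff_emb : {rmorphism L -> ff_sort};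
  ff_gen : 'I_n.+1 -> ff_sort;
  ff_genP : forall p : {mpoly L[n.+1]}, homogeneous p ->
    ((map_mpoly ff_emb p).@[ff_gen] = 0 <-> forall P, X P -> evalp p P = 0);
  ff_fracP : forall f : ff_sort,
    exists (e : nat) (G H : {mpoly L[n.+1]}),
      [/\ G \is e.-homog, H \is e.-homog,
          (map_mpoly ff_emb H).@[ff_gen] != 0 &
          f = (map_mpoly ff_emb G).@[ff_gen] / (map_mpoly ff_emb H).@[ff_gen]]
}.

Definition regular_at (K : function_field) (P : point L n) (f : K) : Prop :=
  exists (e : nat) (G H : {mpoly L[n.+1]}),
    [/\ G \is e.-homog, H \is e.-homog, evalp H P != 0 &
        f = (map_mpoly (@ff_emb K) G).@[@ff_gen K]
              / (map_mpoly (@ff_emb K) H).@[@ff_gen K]].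

(* Repartitions (pre-adeles) of X; only the values on X are relevant. *)
Definition repartition (K : function_field) (r : point L n -> K) : Prop :=
  exists s : seq (point L n), forall P, X P -> P \notin s -> regular_at P (r P).

(* r lies in R(0) + L(X), where R(0) is the set of everywhere regular         *)
(* repartitions and L(X) is embedded diagonally.                              *)
Definition negligible (K : function_field) (r : point L n -> K) : Prop :=
  exists f : K, forall P, X P -> regular_at P (r P - f).

(* For a non-singular projective curve X over L, the genus is dim H^1(X, O_X) *)
(* with H^1(X, O_X) = R / (R(0) + L(X)), R being the space of repartitions    *)
(* (Weil; Serre, Groupes algebriques et corps de classes, II.5).  The family  *)
(* b below is a basis of this quotient.                                       *)
Definition has_genus (g : nat) : Prop :=
  exists (K : function_field) (b : 'I_g -> point L n -> K),
    [/\ forall i, repartition (b i),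
        forall r, repartition r -> exists c : 'I_g -> L,
          negligible (fun P => r P - \sum_i @ff_emb K (c i) * b i P) &
        forall c : 'I_g -> L,
          negligible (fun P => \sum_i @ff_emb K (c i) * b i P) ->
          forall i, c i = 0].

End FunctionField.

Section CurvesOverFiniteField.
Variables (k : finFieldType) (L : closedFieldType) (iota : {rmorphism k -> L}).

(* Equations gens over k stand for the closed subscheme of P^n that they      *)
(* define; zeros gens is its set of geometric points.                         *)
Definition zeros n (gens : seq {mpoly k[n.+1]}) (P : point L n) : Prop :=
  forall p, p \in gens -> evalp (map_mpoly iota p) P = 0.

Definition jacobian n (gens : seq {mpoly k[n.+1]}) (P : point L n)
    : 'M[L]_(size gens, n.+1) :=
  \matrix_(j, i) evalp (mderiv i (map_mpoly iota gens`_j)) P.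

(* Projective, geometrically irreducible, non-singular curve over k.  In      *)
(* homogeneous coordinates the Jacobian criterion asks for rank n - 1 at      *)
(* every geometric point.                                                     *)
Definition projective_curve n (gens : seq {mpoly k[n.+1]}) : Prop :=
  [/\ forall p, p \in gens -> homogeneous p,
      irreducible_closed (zeros gens),
      has_dim (zeros gens) 1 &
      forall P, zeros gens P -> (\rank (jacobian gens P)).+1 = n].

Definition rational_points n (gens : seq {mpoly k[n.+1]}) : {set point k n} :=
  [set P | all (fun p => evalp p P == 0) gens].

(* To be used with #|k| = q ^ 2. *)
Definition maximal_curve q n (gens : seq {mpoly k[n.+1]}) (g : nat) : Prop :=
  [/\ projective_curve gens, has_genus (zeros gens) g &
      #|rational_points gens| = (1 + q ^ 2 + 2 * q * g)%N].

Definition plane_maximal_curve q d (F : {mpoly k[3]}) : Prop :=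
  F \is d.-homog /\ exists g, maximal_curve q [:: F] g.

(* Morphism over k: around every geometric point it is given by forms of the  *)
(* same degree with coefficients in k and without common zero there.          *)
Definition morphism_over n m (gX : seq {mpoly k[n.+1]})
    (gY : seq {mpoly k[m.+1]}) (phi : point L n -> point L m) : Prop :=
  (forall P, zeros gX P -> zeros gY (phi P)) /\
  (forall P, zeros gX P ->
    exists (e : nat) (G : 'I_m.+1 -> {mpoly k[n.+1]}),
      [/\ forall i, G i \is e.-homog,
          exists i, evalp (map_mpoly iota (G i)) P != 0 &
          forall Q, zeros gX Q ->
            (exists i, evalp (map_mpoly iota (G i)) Q != 0) ->
            exists c : L, forall i,
              evalp (map_mpoly iota (G i)) Q = c * coords (phi Q) i]).

Definition isomorphic_over n m (gX : seq {mpoly k[n.+1]})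
    (gY : seq {mpoly k[m.+1]}) : Prop :=
  exists (phi : point L n -> point L m) (psi : point L m -> point L n),
    [/\ morphism_over gX gY phi, morphism_over gY gX psi,
        forall P, zeros gX P -> psi (phi P) = P &
        forall Q, zeros gY Q -> phi (psi Q) = Q].

Definition has_nonsingular_plane_model n (gens : seq {mpoly k[n.+1]}) : Prop :=
  exists (d : nat) (F : {mpoly k[3]}),
    [/\ F \is d.-homog, projective_curve [:: F] & isomorphic_over gens [:: F]].

End CurvesOverFiniteField.

Definition prime_power (q : nat) : Prop :=
  exists p e : nat, [/\ prime p, (0 < e)%N & q = (p ^ e)%N].

(* Only meaningful for q >= 3. *)
Definition d2 (q : nat) : nat :=
  if q == 3 then 3 else if q == 5 then 4 else ((q + 2) %/ 2)%N.

Definition in_genus_gap (q g : nat) : Prop :=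
  let Q : rat := q%:R in let G : rat := g%:R in
  if odd q then (Q - 1) * (Q - 3) / 8 < G <= (Q - 1) ^+ 2 / 4
  else Q * (Q - 2) / 8 < G <= Q * (Q - 2) / 4.

(* Main.v *)
(* Write Q = q^2, let F be the form of degree d defining the smooth plane
   curve X, and N the number of its Q-rational points.

   Genus.  Project X from a point outside X; then X is covered by two affine
   charts finite over the affine line, with coordinate rings free of rank d.
   Partial fractions show that every repartition is regular on a chart up to a
   function, so H^1(X, O_X) is the cokernel of O(U) + O(V) -> O(U /\ V), which
   has the basis u^-i w^j (0 < i < j < d); hence 2g = (d-1)(d-2), and
   maximality reads N = 1 + q^2 + q(d-1)(d-2).

   Degree.  Counting points on the lines through a rational point gives
   N <= 1 + (Q+1)(d-1), hence d <= q+1.  Let H = sum_i x_i^Q F_i.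
   - If H does not vanish on X, then F and H meet with multiplicity at least 2
     at each rational point, so 2N <= d(d-1+Q), i.e. d <= (q+1)^2/(2q-1).
   - If H vanishes on X, then P x Fr(P) and the gradient of F are proportional
     on X, with ratio a section of degree Q+2-d; comparing dimensions of spaces
     of forms gives N >= d(Q+2-d), which forces d >= q+1.
   The intersection numbers are replaced by dimension counts in the spaces of
   forms of a large degree. *)
From HB Require Import structures.
Require Import Defs.
From mathcomp Require Import all_boot all_order all_algebra.
From mathcomp Require Import mpoly.
From mathcomp Require Import finfield.
From mathcomp Require Import ring lra zify.

Set Implicit Arguments.
Unset Strict Implicit.
Unset Printing Implicit Defensive.

Import GRing.Theory Num.Theory.
Local Open Scope ring_scope.

(** * Affine charts of a plane curve *)

(** The genus is given only as the dimension of a quotient of repartitions. It becomes computable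
    because both charts project from the same point b off X: each chart equation is then monic of
    degree d in w, every polynomial function on a chart has a unique representative of w-degree
    below d, and a class in H^1 is read off from coefficients.

    The form H comes from Frobenius: H(P) = 0 says that Fr(P) lies on the tangent at P. At a
    rational point this holds by Euler's relation, and the derivative of H along the tangent
    vanishes too because x^Q has derivative zero; these two conditions per point are the factor 2 in
    2N. If H vanishes on X, then P and Fr(P) are both orthogonal to the gradient, which is therefore
    parallel to P x Fr(P). The gradient has no zero on X, so the ratio vanishes exactly at the
    rational points. That each of them costs only one condition is an algebraic fact: in large
    degrees the coordinates of P x Fr(P) generate all forms vanishing on P^2(F_Q). *)

Section Bivariate.
Variable L : closedFieldType.

(** Bivariate polynomials are elements of L[u][w], with w outside: chart equations are monic in w,
    so division with remainder takes place in the outer variable. *)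
Definition eval_at (p : {poly {poly L}}) (u0 w0 : L) : L := p.[w0%:P].[u0].

Lemma ptM p q u0 w0 : eval_at (p * q) u0 w0 = eval_at p u0 w0 * eval_at q u0 w0.
Proof. by rewrite /eval_at !hornerM. Qed.
Lemma ptC c u0 w0 : eval_at c%:P u0 w0 = c.[u0].
Proof. by rewrite /eval_at hornerC. Qed.

Definition specialize (u0 : L) : {poly {poly L}} -> {poly L} := map_poly (horner_eval u0).
HB.instance Definition _ u0 := GRing.RMorphism.on (specialize u0).

Lemma ptE p u0 w0 : eval_at p u0 w0 = (specialize u0 p).[w0].
Proof. by rewrite -[LHS]/(horner_eval u0 _) -horner_map /= horner_evalE hornerC. Qed.

Lemma specZ x c p : specialize x (c *: p) = c.[x] *: specialize x p.
Proof. exact: map_polyZ. Qed.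

Lemma specM x p q : specialize x (p * q) = specialize x p * specialize x q.
Proof. exact: rmorphM. Qed.

Lemma spec_eq0 u0 p : specialize u0 p = 0 -> exists q, p = ('X - u0%:P) *: q /\ size q = size p.
Proof.
move=> h.
have h' i : root p`_i u0 by rewrite rootE -[_.[_]]/(horner_eval u0 _) -coef_map -/(specialize u0
  p) h coef0.
pose q := \poly_(i < size p) (p`_i %/ ('X - u0%:P)).
have e : p = ('X - u0%:P) *: q.
  apply/polyP => i; rewrite coefZ coef_poly; case: ltnP => hi;
    last by rewrite mulr0 nth_default.
  by rewrite mulrC divpK // dvdp_XsubCl.
by exists q; split=> //; rewrite [in RHS]e size_scale // polyXsubC_eq0.
Qed.


Lemma closed_root (p : {poly L}) : (1 < size p)%N -> exists x, root p x.
Proof. by move=> hp; apply/closed_rootP; rewrite gtn_eqF. Qed.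

(* Gauss's lemma over L[x]: the roots of l are removed one at a time. *)
Lemma factor_peel (l : {poly L}) (phi r s : {poly {poly L}}) : l != 0 -> l *: phi = r * s ->
  exists r' s', [/\ phi = r' * s', size r' = size r & size s' = size s].
Proof.
have [n] := ubnP (size l); elim: n l r s => // n IH l r s ln lnz e.
have [l1|l1] := leqP (size l) 1.
  have [c cnz el] : exists2 c, c != 0 & l = c%:P by apply/size_poly1P;
    rewrite eqn_leq l1 size_poly_gt0.
  have hc : c^-1%:P * c%:P = 1 :> {poly L} by rewrite -polyCM mulVf.
  exists (c^-1%:P *: r), s; split=> //; last by rewrite size_scale // polyC_eq0 invr_eq0.
  by rewrite -scalerAl -e el scalerA hc scale1r.
have [x /factor_theorem [l' el]] := closed_root l1.
have l'nz : l' != 0 by apply: contraNneq lnz => z; rewrite el z mul0r.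
have sl : (size l' < n)%N.
  by have := l'nz; move: ln; rewrite el size_mul ?polyXsubC_eq0 // size_XsubC addn2.
have injX (a b : {poly {poly L}}) : ('X - x%:P) *: a = ('X - x%:P) *: b -> a = b.
  by rewrite -!mul_polyC; apply: mulfI; rewrite polyC_eq0 polyXsubC_eq0.
have e2 : specialize x r * specialize x s = 0.
  by rewrite -specM -e specZ el hornerM hornerXsubC subrr mulr0 scale0r.
have /orP [/eqP z|/eqP z] : (specialize x r == 0) || (specialize x s == 0) by rewrite -mulf_eq0
  e2.
  have [q [er sr]] := spec_eq0 z.
  have [|r' [s' [H1 H2 H3]]] := IH l' q s sl l'nz; last by exists r', s'; split=> //;
    rewrite H2 sr.
  by apply: injX; rewrite scalerA mulrC -el e er -scalerAl.
have [q [er sr]] := spec_eq0 z.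
have [|r' [s' [H1 H2 H3]]] := IH l' r q sl l'nz; last by exists r', s'; split=> //;
  rewrite H3 sr.
by apply: injX; rewrite scalerA mulrC -el e er -scalerAr.
Qed.
End Bivariate.

Section BivariateEval.
Variables (L : nzRingType) (K : comNzRingType) (emb : {rmorphism L -> K}) (u w : K).

(** The target ring stays arbitrary because points are taken in L, in L[t] (tangent directions), in
    the function field and in the fraction field of the ring of forms. *)
Definition unieval : {poly L} -> K := horner_eval u \o map_poly emb.
HB.instance Definition _ := GRing.RMorphism.on unieval.
Definition bieval : {poly {poly L}} -> K := horner_eval w \o map_poly unieval.
HB.instance Definition _ := GRing.RMorphism.on bieval.

Lemma evC c : bieval c%:P = unieval c.
Proof. by rewrite /bieval /= map_polyC horner_evalE hornerC. Qed.
Lemma evuC c : unieval c%:P = emb c.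
Proof. by rewrite /unieval /= map_polyC horner_evalE hornerC. Qed.
Lemma evX : bieval 'X = w.
Proof. by rewrite /bieval /= map_polyX horner_evalE hornerX. Qed.
Lemma evuX : unieval 'X = u.
Proof. by rewrite /unieval /= map_polyX horner_evalE hornerX. Qed.
Lemma evZ c p : bieval (c *: p) = unieval c * bieval p.
Proof. by rewrite -mul_polyC rmorphM /= evC. Qed.

Lemma evM p q : bieval (p * q) = bieval p * bieval q. Proof. exact: rmorphM. Qed.
Lemma evD p q : bieval (p + q) = bieval p + bieval q. Proof. exact: rmorphD. Qed.
Lemma evB p q : bieval (p - q) = bieval p - bieval q. Proof. exact: rmorphB. Qed.
Lemma ev0 : bieval 0 = 0. Proof. exact: rmorph0. Qed.
Lemma ev1 : bieval 1 = 1. Proof. exact: rmorph1. Qed.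
Lemma evXn p n : bieval (p ^+ n) = bieval p ^+ n. Proof. exact: rmorphXn. Qed.
Lemma evuM p q : unieval (p * q) = unieval p * unieval q. Proof. exact: rmorphM. Qed.
Lemma evuD p q : unieval (p + q) = unieval p + unieval q. Proof. exact: rmorphD. Qed.
Lemma evu0 : unieval 0 = 0. Proof. exact: rmorph0. Qed.
End BivariateEval.

Section Chart.
Variables (L : closedFieldType) (K : fieldType) (emb : {rmorphism L -> K}) (u w : K).

Local Notation ev := (bieval emb u w).
Local Notation evu := (unieval emb u).

Definition regular_in_chart (u0 w0 : L) (f : K) : Prop :=
  exists g h, eval_at h u0 w0 != 0 /\ f = ev g / ev h.

Variables (phi : {poly {poly L}}) (d : nat).

(* The affine curve phi = 0 with generic point (u, w) over L.  A factorization
   of phi meeting itself at a point is all that non-singularity has to exclude. *)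
Record chart : Prop := Chart {
  chart_monic : phi \is monic;
  chart_size : size phi = d.+1;
  chart_pos : (0 < d)%N;
  chart_ev0 : ev phi = 0;
  chart_vanish : forall p, ev p = 0 -> forall u0 w0, eval_at phi u0 w0 = 0 ->
    eval_at p u0 w0 = 0;
  chart_smooth : forall p s u0 w0, phi = p * s -> eval_at p u0 w0 = 0 -> eval_at s u0 w0 = 0 ->
    False;
  chart_frac : forall f : K, exists g h, ev h != 0 /\ f = ev g / ev h
}.

Hypothesis C : chart.

Lemma spec_size (p : {poly {poly L}}) u0 : (lead_coef p).[u0] != 0 ->
  size (specialize u0 p) = size p.
Proof. by move=> h; rewrite /specialize size_map_poly_id0. Qed.

Lemma spec_phi_size u0 : size (specialize u0 phi) = d.+1.
Proof. by rewrite spec_size ?(chart_size C) // (monicP (chart_monic C)) hornerC oner_eq0. Qed.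

Lemma chart_point u0 : exists w0, eval_at phi u0 w0 = 0.
Proof.
have [|w0 /rootP h] := @closed_root L (specialize u0 phi);
  first by rewrite spec_phi_size ltnS (chart_pos C).
by exists w0; rewrite ptE.
Qed.

Lemma closed_nonroot (c : {poly L}) : c != 0 -> exists x, c.[x] != 0.
Proof. by move=> /closed_nonrootP [x]; exists x. Qed.

(** The coordinate u is transcendental over L: the curve has a point above every u0, so a polynomial
    in u that vanishes at the generic point has every u0 as a root. *)
Lemma evu_inj0 c : (evu c == 0) = (c == 0).
Proof.
apply/eqP/eqP => [h|->]; last by rewrite evu0.
apply/eqP/negPn/negP => /closed_nonroot [u0 /eqP hu]; apply: hu.
have [w0 hw] := chart_point u0.
by have := @chart_vanish C c%:P _ _ _ hw; rewrite ptC; apply; rewrite evC.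
Qed.

(* If phi = r * s, the factor vanishing at the generic point vanishes at every
   zero of the other factor, and such a zero is singular. *)
Lemma no_factor (l : {poly L}) (r s : {poly {poly L}}) : l != 0 -> l *: phi = r * s ->
  (size r <= 1)%N \/ (size s <= 1)%N.
Proof.
move=> lnz e; have [r' [s' [e' <- <-]]] := factor_peel lnz e.
case: leqP => hr; [by left | case: leqP => hs; [by right|exfalso]].
have main : forall a b, phi = a * b -> (1 < size b)%N -> ev a = 0 -> False.
  move=> a b eab hb ea.
  have hl : lead_coef a * lead_coef b = 1 by rewrite -lead_coefM -eab (monicP (chart_monic C)).
  have hb0 : (lead_coef b).[0] != 0.
    apply/eqP => z; have := congr1 (horner^~ 0) hl; rewrite /= hornerM z mulr0 hornerC.
    by move/esym/eqP; rewrite oner_eq0.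
  have [|w0 /rootP hw0] := @closed_root L (specialize 0 b); first by rewrite spec_size.
  have pb : eval_at b 0 w0 = 0 by rewrite ptE.
  have pphi : eval_at phi 0 w0 = 0 by rewrite eab ptM pb mulr0.
  exact: (chart_smooth C eab (chart_vanish C ea pphi) pb).
have /eqP : ev r' * ev s' = 0 by rewrite -evM -e' (chart_ev0 C).
rewrite mulf_eq0 => /orP [] /eqP z; first exact: (main r' s').
by apply: (main s' r') => //; rewrite mulrC.
Qed.

(** By [no_factor] and the bound on the degree of [r], the gcd of [phi] and [r] over L(u) is
    constant in w. Bezout's relation, cleared of denominators, then has a right-hand side in
    L[u]. *)
Lemma bezout_chart (r : {poly {poly L}}) : r != 0 -> (size r <= d)%N ->
  exists a b c, c != 0 /\ a * phi + b * r = c%:P.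
Proof.
move=> rnz sr.
have mphi := chart_monic C.
have pnz : phi != 0 by exact: monic_neq0.
have Dphi := dvdp_gcdl phi r; have Dr := dvdp_gcdr phi r.
have sD : (size (gcdp phi r) <= d)%N by apply: leq_trans (dvdp_leq rnz Dr) sr.
have s1 : (size (gcdp phi r) <= 1)%N.
  have [[l q] /= lnz e] := Pdiv.WeakIdomain.dvdpP _ _ Dphi.
  have [hq|//] := no_factor lnz e.
  have : size (l *: phi) = d.+1 by rewrite size_scale // (chart_size C).
  move: (size_polyMleq q (gcdp phi r)); rewrite -e => + h.
  by rewrite h; move: hq sD; set a := size q; set b := size (gcdp _ _); clearbody a b; lia.
have [[a b] /= /eqpP [[c1 c2] /andP [/= c1nz c2nz] e]] := Bezoutp phi r.
have gnz : gcdp phi r != 0 by rewrite gcdp_eq0 negb_and pnz.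
have [c cnz ec] : exists2 c, c != 0 & gcdp phi r = c%:P.
  by apply/size_poly1P; rewrite eqn_leq s1 size_poly_gt0.
exists (c1 *: a), (c1 *: b), (c2 * c); split; first by rewrite mulf_neq0.
by rewrite -!scalerAl -scalerDr e ec -mul_polyC -polyCM.
Qed.

Lemma chart_divide p : exists q r : {poly {poly L}}, p = phi * q + r /\ (size r <= d)%N.
Proof.
exists (Pdiv.CommonRing.rdivp p phi), (Pdiv.CommonRing.rmodp p phi).
rewrite {1}(Pdiv.RingMonic.rdivp_eq (chart_monic C) p) mulrC; split=> //.
by rewrite -ltnS -(chart_size C) Pdiv.CommonRing.ltn_rmodp monic_neq0 ?(chart_monic C).
Qed.

(** For a nonzero [r] the relation of [bezout_chart] would turn [ev r = 0] into a nonzero polynomial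
    relation on u. Hence representatives of w-degree below d are unique. *)
Lemma ev_small (r : {poly {poly L}}) : (size r <= d)%N -> ev r = 0 -> r = 0.
Proof.
move=> sr er; apply/eqP/negPn/negP => rnz.
have [a [b [c [cnz e]]]] := bezout_chart rnz sr.
have := congr1 ev e; rewrite evD !evM er (chart_ev0 C) !mulr0 addr0 evC => /esym/eqP.
by rewrite evu_inj0 (negbTE cnz).
Qed.

Lemma ev_ker p : ev p = 0 -> exists q, p = phi * q.
Proof.
have [q [r [-> sr]]] := chart_divide p; rewrite evD evM (chart_ev0 C) mul0r add0r.
by move=> /(ev_small sr) ->; exists q; rewrite addr0.
Qed.

Lemma ev_reduce p : exists r : {poly {poly L}}, (size r <= d)%N /\ ev p = ev r.
Proof.
have [q [r [-> sr]]] := chart_divide p; exists r; split=> //.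
by rewrite evD evM (chart_ev0 C) mul0r add0r.
Qed.

(** Modulo [phi] the denominator divides a nonzero polynomial in u, so a denominator in u alone
    suffices. *)
Lemma chart_denom (f : K) : exists (a : {poly {poly L}}) c, [/\ c != 0, (size a <= d)%N & f = ev
  a / evu c].
Proof.
have [g [h [hnz ->]]] := chart_frac C f.
have [r [sr er]] := ev_reduce h.
have rnz : r != 0 by apply: contraNneq hnz => z; rewrite er z ev0.
have [a [b [c [cnz e]]]] := bezout_chart rnz sr.
have [a' [sa' ea']] := ev_reduce (g * b).
exists a', c; split=> //; rewrite -ea' er evM.
have ec : ev b * ev r = evu c.
  by rewrite -(@evC _ _ emb u w) -e evD !evM (chart_ev0 C) mulr0 add0r.
have rn : ev r != 0 by rewrite -er.
have cn : evu c != 0 by rewrite evu_inj0.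
have bn : ev b != 0 by move: cn; rewrite -ec mulf_eq0 negb_or => /andP[].
by rewrite -ec; field; rewrite rn bn.
Qed.

End Chart.

Section ChartRegular.
Variables (L : closedFieldType) (K : fieldType) (emb : {rmorphism L -> K}) (u w : K).
Variables (phi : {poly {poly L}}) (d : nat).
Hypothesis C : chart emb u w phi d.

Local Notation ev := (bieval emb u w).
Local Notation evu := (unieval emb u).
Local Notation regular_in_chart := (regular_in_chart emb u w).

Lemma ev_neq0 h u0 w0 : eval_at phi u0 w0 = 0 -> eval_at h u0 w0 != 0 -> ev h != 0.
Proof. by move=> hp; apply: contraNneq => /(chart_vanish C)/(_ _ _ hp) ->. Qed.

Lemma regD u0 w0 f g : eval_at phi u0 w0 = 0 -> regular_in_chart u0 w0 f ->
  regular_in_chart u0 w0 g -> regular_in_chart u0 w0 (f + g).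
Proof.
move=> hp [a [b [hb ->]]] [c [e [he ->]]].
exists (a * e + c * b), (b * e); split; first by rewrite ptM mulf_neq0.
by rewrite evD !evM; field; rewrite !(ev_neq0 hp).
Qed.

Lemma regN u0 w0 f : regular_in_chart u0 w0 f -> regular_in_chart u0 w0 (- f).
Proof. by move=> [a [b [hb ->]]]; exists (- a), b; split=> //; rewrite -mulNr /ev rmorphN. Qed.

Lemma regB u0 w0 f g : eval_at phi u0 w0 = 0 -> regular_in_chart u0 w0 f ->
  regular_in_chart u0 w0 g -> regular_in_chart u0 w0 (f - g).
Proof. by move=> hp rf rg; apply: regD => //; apply: regN. Qed.

Lemma reg0 u0 w0 : regular_in_chart u0 w0 0.
Proof. by exists 0, 1; rewrite ev0 mul0r /eval_at !hornerC oner_eq0. Qed.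

Lemma reg_ev u0 w0 a : regular_in_chart u0 w0 (ev a).
Proof. by exists a, 1; rewrite ev1 divr1 /eval_at !hornerC oner_eq0. Qed.

Definition poly_in_Y (p : {poly L}) : {poly {poly L}} := map_poly polyC p.

Lemma polyYM p q : poly_in_Y (p * q) = poly_in_Y p * poly_in_Y q. Proof. exact: rmorphM. Qed.
Lemma polyYD p q : poly_in_Y (p + q) = poly_in_Y p + poly_in_Y q. Proof. exact: rmorphD. Qed.
Lemma polyY1 : poly_in_Y 1 = 1. Proof. exact: rmorph1. Qed.
Lemma polyYXn p n : poly_in_Y (p ^+ n) = poly_in_Y p ^+ n. Proof. exact: rmorphXn. Qed.

Lemma spec_polyY x p : specialize x (poly_in_Y p) = p.
Proof.
by apply/polyP => i; rewrite /specialize /poly_in_Y !coef_map /= horner_evalE hornerC.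
Qed.

Lemma pt_polyY p u0 w0 : eval_at (poly_in_Y p) u0 w0 = p.[w0].
Proof. by rewrite ptE spec_polyY. Qed.

(** A root of p / gcd(p, a) would also have to be a root of the local multiplier h. *)
Lemma dvdp_locally (p a : {poly L}) : p != 0 ->
  (forall w0, root p w0 -> exists h, ~~ root h w0 /\ p %| a * h) -> p %| a.
Proof.
move=> pnz H; have := dvdp_gcdl p a; have := dvdp_gcdr p a.
set D := gcdp p a; move=> /dvdpP [A eA] /dvdpP [G eG].
have Dnz : D != 0 by rewrite gcdp_eq0 negb_and pnz.
have Gnz : G != 0 by apply: contraNneq pnz => z; rewrite eG z mul0r.
have cop : coprimep G A.
  have := coprimep_div_gcd (p := p) (q := a); rewrite -/D pnz => /(_ isT).
  by rewrite eG mulpK // eA mulpK.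
have [sG|sG] := leqP (size G) 1.
  have [c cnz eGc] : exists2 c, c != 0 & G = c%:P by apply/size_poly1P;
    rewrite eqn_leq sG size_poly_gt0.
  by rewrite eG eGc mul_polyC dvdpZl // eA dvdp_mull.
have [x rx] := closed_root sG.
have [|h [hx]] := H x; first by rewrite eG rootM rx.
rewrite eG eA mulrAC dvdp_mul2r // Gauss_dvdpr // => /dvdpP [q eh].
by case/negP: hx; rewrite eh rootM rx orbT.
Qed.

(** A root x of the denominator outside [B] cancels. Regularity at all points above x makes [phi]
    divide the numerator modulo u - x; the numerator has smaller w-degree, so it vanishes modulo u -
    x and is itself divisible by u - x. *)
Lemma regular_denom (B : pred L) f :
  (forall u0 w0, eval_at phi u0 w0 = 0 -> ~~ B u0 -> regular_in_chart u0 w0 f) ->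
  exists (a : {poly {poly L}}) c,
   [/\ c != 0, (size a <= d)%N, f = ev a / evu c & forall x, root c x -> B x].
Proof.
move=> hreg; have [a [c [cnz sa ef]]] := chart_denom C f.
have [n] := ubnP (size c); elim: n a c cnz sa ef => // n IH a c cnz sa ef sc.
have [r er] := closed_field_poly_normal c.
have [|noB] := boolP (has (predC B) r); last first.
  exists a, c; split=> // x; rewrite er rootZ ?lead_coef_eq0 // root_prod_XsubC => xr.
  by move/hasPn: noB => /(_ x xr); rewrite negbK.
move=> /hasP [x xr /= xB].
have rcx : root c x by rewrite er rootZ ?lead_coef_eq0 // root_prod_XsubC.
have [c' ec] := factor_theorem _ _ rcx.
have c'nz : c' != 0 by apply: contraNneq cnz => z; rewrite ec z mul0r.
have evcn : evu c != 0 by rewrite (evu_inj0 C).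
have sx := spec_phi_size C x.
have dv : specialize x phi %| specialize x a.
  apply: dvdp_locally; first by rewrite -size_poly_gt0 sx.
  move=> w0 /rootP rw; have hp : eval_at phi x w0 = 0 by rewrite ptE.
  have [g [h [hh eh]]] := hreg x w0 hp xB.
  exists (specialize x h); rewrite rootE -ptE hh; split=> //.
  have hn := ev_neq0 hp hh.
  have /(ev_ker C) [q eq] : ev (a * h - c *: g) = 0.
    rewrite evB evM evZ; apply/eqP; rewrite subr_eq0; apply/eqP.
    have : ev a = f * evu c by rewrite ef divfK.
    by move=> ->; rewrite eh; field.
  have := congr1 (specialize x) eq; rewrite specM raddfB /= specM specZ (rootP rcx) scale0r
    subr0 => ->.
  by rewrite dvdp_mulr.
have az : specialize x a = 0.
  apply/eqP; apply: contraTT dv => az; apply: contraL sa => /(dvdp_leq az).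
  rewrite sx -ltnNge => /leq_trans; apply; exact: size_poly.
have [a' [ea sa']] := spec_eq0 az.
have evc' : evu c' != 0 by rewrite (evu_inj0 C).
have dX : evu ('X - x%:P) != 0 by rewrite (evu_inj0 C) polyXsubC_eq0.
apply: (IH a' c') => //; first by rewrite sa'.
  rewrite ef ea ec evZ evuM; set A := ev a'; set D := evu ('X - _) in dX *;
    set E := evu c' in evc' *.
  by clearbody A D E; field; rewrite dX evc'.
have := c'nz; move: sc; rewrite ec size_mul ?polyXsubC_eq0 // size_XsubC addn2 //.
Qed.

(* Partial fractions in u isolate the fibre of u0; multiplying by a polynomial in
   w that is 1 to high order at w0 and 0 at the rest of the fibre isolates the
   point. *)
Lemma split_pole u0 w0 f : eval_at phi u0 w0 = 0 ->
  exists f', regular_in_chart u0 w0 (f - f') /\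
    forall u1 w1, eval_at phi u1 w1 = 0 -> (u1, w1) != (u0, w0) -> regular_in_chart u1 w1 f'.
Proof.
move=> hp; have [a [c [cnz sa ef]]] := chart_denom C f.
have [m [c1]] := multiplicity_XsubC c u0; rewrite cnz /= => r1 ec.
have [pnz sx] : specialize u0 phi != 0 /\ size (specialize u0 phi) = d.+1.
  by rewrite -size_poly_gt0 (spec_phi_size C).
have [r [h]] := multiplicity_XsubC (specialize u0 phi) w0; rewrite pnz /= => hw eh.
have cop1 : coprimep c1 (('X - u0%:P) ^+ m) by rewrite coprimep_expr // coprimep_XsubC.
have cop2 : coprimep (h ^+ m) (('X - w0%:P) ^+ (r * m)).
  by rewrite coprimep_expl // coprimep_expr // coprimep_XsubC.
have /Bezout_eq1_coprimepP [[al be] /= e1] := cop1.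
have /Bezout_eq1_coprimepP [[t s] /= e2] := cop2.
(* Modulo u - u0 the equation [phi] is its own fibre h (w - w0)^r. On the curve this product is
   therefore - (u - u0) q, which trades powers of w - w0 for powers of u - u0. *)
have /spec_eq0 [q [eq _]] : specialize u0 (phi - poly_in_Y (specialize u0 phi)) = 0.
  by rewrite raddfB /= spec_polyY subrr.
set del := evu ('X - u0%:P).
have delnz : del != 0 by rewrite (evu_inj0 C) polyXsubC_eq0.
have eW : ev (poly_in_Y h) * ev (poly_in_Y ('X - w0%:P)) ^+ r = - (del * ev q).
  rewrite -evXn -evM -polyYXn -polyYM -eh -evZ -eq evB.
  by rewrite (chart_ev0 C) sub0r opprK.
have eU : ev (poly_in_Y t) * ev (poly_in_Y h) ^+ m + ev (poly_in_Y s) * ev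
  (poly_in_Y ('X - w0%:P)) ^+ (r * m) = 1.
  rewrite -!evXn -!evM -evD -!polyYXn -!polyYM -polyYD e2 polyY1.
  exact: ev1.
have eab : evu al * evu c1 + evu be * del ^+ m = 1.
  by rewrite -[del ^+ m](rmorphXn evu) -!evuM -evuD e1; apply: rmorph1.
have ecK : evu c = evu c1 * del ^+ m.
  by rewrite ec evuM; congr (_ * _); apply: rmorphXn.
have c1nz : evu c1 != 0 by rewrite (evu_inj0 C); apply: contraNneq cnz => z; rewrite ec z mul0r.
(* Since a / (c1 del^m) = a al / del^m + a be / c1, the first term carries the poles above u0. The
   factor t h^m keeps the one at w0, where 1 - t h^m = s (w - w0)^(r m) is divisible by del^m, and
   removes the others, where h^m is. *)
exists (ev a * evu al * ev (poly_in_Y t) * ev (poly_in_Y h) ^+ m / del ^+ m); split.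
  have hnz : eval_at (poly_in_Y h) u0 w0 != 0 by rewrite pt_polyY -rootE.
  have hK := ev_neq0 hp hnz.
  exists (a * be%:P * poly_in_Y h ^+ m + a * al%:P * poly_in_Y s * (- q) ^+ m * c1%:P),
    (c1%:P * poly_in_Y h ^+ m).
  split.
    rewrite ptM ptC; apply: mulf_neq0; first by rewrite -rootE.
    by rewrite -polyYXn pt_polyY horner_exp expf_neq0 // -rootE.
  have eq' : ev (- q) ^+ m * del ^+ m = ev (poly_in_Y h) ^+ m * ev (poly_in_Y ('X - w0%:P)) ^+
    (r * m).
    rewrite exprM -!exprMn eW; congr (_ ^+ _).
    by rewrite {1}/ev rmorphN /= -/(ev q); ring.
  rewrite evD !evM !evXn !evC ef ecK.
  apply: (mulIf (expf_neq0 m delnz)); apply: (mulIf c1nz); apply: (mulIf (expf_neq0 m hK)).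
  set H := ev (poly_in_Y h) ^+ m in eU eq' *; set D := del ^+ m in eq' eab *.
  set W := ev (poly_in_Y _) ^+ (r * m) in eU eq' *; set Q := ev (- q) ^+ m in eq' *.
  have Hn : H != 0 by rewrite expf_neq0.
  have Dn : D != 0 by rewrite expf_neq0.
  have -> : (ev a / (evu c1 * D) - ev a * evu al * ev (poly_in_Y t) * H / D) * D * evu c1 * H =
     (ev a - ev a * evu al * ev (poly_in_Y t) * H * evu c1) * H by field; rewrite c1nz Dn.
  have -> : (ev a * evu be * H + ev a * evu al * ev (poly_in_Y s) * Q * evu c1) / (evu c1 * H) *
    D * evu c1 * H
    = ev a * evu be * H * D + ev a * evu al * ev (poly_in_Y s) * evu c1 * (Q * D) by field;
      rewrite c1nz Hn.
  rewrite eq'.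
  have eP : evu be * D = 1 - evu al * evu c1 by rewrite -eab addrC addKr.
  have -> : ev a * evu be * H * D = ev a * H * (evu be * D) by ring.
  have -> : ev a * evu al * ev (poly_in_Y s) * evu c1 * (H * W) =
     ev a * evu al * evu c1 * H * (ev (poly_in_Y s) * W) by ring.
  have -> : ev (poly_in_Y s) * W = 1 - ev (poly_in_Y t) * H by rewrite -eU addrC addKr.
  by rewrite eP; ring.
move=> u1 w1 hp1; rewrite xpair_eqE negb_and.
have [eu /= nw|nu _] := eqVneq u1 u0; last first.
  exists (a * al%:P * poly_in_Y t * poly_in_Y h ^+ m), (('X - u0%:P) ^+ m)%:P.
  split; first by rewrite ptC horner_exp hornerXsubC expf_neq0 // subr_eq0.
  by rewrite !evM !evXn !evC -[evu (_ ^+ m)]/(evu _) (rmorphXn evu).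
have wnz : eval_at (poly_in_Y ('X - w0%:P)) u1 w1 != 0 by rewrite pt_polyY hornerXsubC subr_eq0.
have wK := ev_neq0 hp1 wnz.
exists (a * al%:P * poly_in_Y t * (- q) ^+ m), (poly_in_Y ('X - w0%:P) ^+ (r * m)); split.
  by rewrite -polyYXn pt_polyY horner_exp hornerXsubC expf_neq0 // subr_eq0.
have eq' : ev (- q) ^+ m * del ^+ m = ev (poly_in_Y h) ^+ m * ev (poly_in_Y ('X - w0%:P)) ^+
  (r * m).
  rewrite exprM -!exprMn eW; congr (_ ^+ _).
  by rewrite {1}/ev rmorphN /= -/(ev q); ring.
rewrite !evM !evXn !evC.
apply: (mulIf (expf_neq0 m delnz)); apply: (mulIf (expf_neq0 (r * m) wK)).
rewrite divfK ?expf_neq0 // [RHS]mulrAC divfK ?expf_neq0 //.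
by rewrite -!mulrA eq'.
Qed.

Lemma approx (T : eqType) (chart_coords : T -> L * L) (s : seq T) (r : T -> K) :
  (forall t, t \in s -> eval_at phi (chart_coords t).1 (chart_coords t).2 = 0) ->
    uniq (map chart_coords s) ->
  exists f, (forall t, t \in s -> regular_in_chart (chart_coords t).1 (chart_coords t).2
    (r t - f)) /\
    forall p, eval_at phi p.1 p.2 = 0 -> p \notin map chart_coords s ->
      regular_in_chart p.1 p.2 f.
Proof.
elim: s => [|t s IH] hs /=.
  by exists 0; split=> // *; apply: reg0.
move=> /andP [ts us].
have [|f [Hf1 Hf2]] := IH _ us; first by move=> x xs; apply: hs; rewrite inE xs orbT.
have ht : eval_at phi (chart_coords t).1 (chart_coords t).2 = 0 by apply: hs; rewrite mem_head.
have [g [Hg1 Hg2]] := split_pole (r t) ht.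
exists (f + g); split.
  move=> x; rewrite inE => /orP [/eqP ->|xs].
    by rewrite opprD addrCA addrC; apply: regB => //; apply: Hf2.
  rewrite opprD addrA; apply: regB; [by apply: hs; rewrite inE xs orbT|exact: Hf1|].
  apply: Hg2; first by apply: hs; rewrite inE xs orbT.
  rewrite -!surjective_pairing; apply: contraNneq ts => <-; exact: map_f.
move=> p hp; rewrite inE negb_or => /andP [npt nps].
by apply: regD => //; [apply: Hf2|apply: Hg2 => //; rewrite -!surjective_pairing].
Qed.
End ChartRegular.

(** * The genus from two charts *)

Section Points.
Variables (L : closedFieldType) (K : fieldType) (emb : {rmorphism L -> K}) (u w : K).
Variables (phi : {poly {poly L}}) (d : nat) (T : eqType) (X chart_domain : pred T) (chart_coords
  : T -> L * L).

Record chart_points : Prop := ChartPoints {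
  points_chart : chart emb u w phi d;
  points_zero : forall t, X t -> chart_domain t -> eval_at phi (chart_coords t).1 (chart_coords
    t).2 = 0;
  points_inj : forall t t', X t -> chart_domain t -> X t' -> chart_domain t' ->
    chart_coords t = chart_coords t' -> t = t';
  points_surj : forall p, eval_at phi p.1 p.2 = 0 ->
    exists t, [/\ X t, chart_domain t & chart_coords t = p]
}.

Hypothesis C : chart_points.
Let CC := points_chart C.

(** This is the vanishing of H^1 on an affine chart: finitely many prescribed polar parts are those
    of a single function. *)
Lemma local_approx (s : seq T) (r : T -> K) :
  (forall t, X t -> chart_domain t -> t \notin s -> regular_in_chart emb u w (chart_coords t).1
    (chart_coords t).2 (r t)) ->
  exists f, forall t, X t -> chart_domain t -> regular_in_chart emb u w (chart_coords t).1
    (chart_coords t).2 (r t - f).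
Proof.
move=> hr; pose s' := [seq t <- undup s | X t && chart_domain t].
have hs' t : t \in s' -> X t /\ chart_domain t by rewrite mem_filter => /andP [/andP[]].
have [||f [H1 H2]] := @approx _ _ _ _ _ _ _ CC T chart_coords s' r.
- by move=> t /hs' [? ?]; apply: (points_zero C).
- rewrite map_inj_in_uniq ?filter_uniq ?undup_uniq // => t t' /hs' [? ?] /hs' [? ?].
  exact: (points_inj C).
exists f => t Xt dt; have [/H1 //|ts] := boolP (t \in s').
apply: (regB CC); first exact: (points_zero C).
  by apply: hr => //; apply: contra ts => ts; rewrite mem_filter Xt dt mem_undup.
apply: H2; first exact: (points_zero C).
apply: contra ts => /mapP [t' t's' e]; have [? ?] := hs' _ t's'.
by rewrite (@points_inj C t t').
Qed.

(** Finiteness of the fibre above u = 0 is what makes the test functions of [kapr_delta]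
    repartitions. *)
Lemma fiber_list u0 : exists s : seq T, forall t, X t -> chart_domain t ->
  (chart_coords t).1 = u0 -> t \in s.
Proof.
have [rs ers] := closed_field_poly_normal (specialize u0 phi).
have H (l : seq L) : exists s : seq T, forall t, X t -> chart_domain t ->
  (chart_coords t).1 = u0 -> (chart_coords t).2 \in l -> t \in s.
  elim: l => [|x l [s IH]]; first by exists [::].
  have [hx|hx] := eqVneq (eval_at phi u0 x) 0; last first.
    exists s => t Xt dt e; rewrite inE => /orP [/eqP ex|]; last exact: IH.
    by case/eqP: hx; rewrite -e -ex (points_zero C).
  have [t0 [X0 d0 e0]] := @points_surj C (u0, x) hx.
  exists (t0 :: s) => t Xt dt e; rewrite !inE => /orP [/eqP ex|xl];
    last by rewrite (IH t) // orbT.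
  by rewrite (@points_inj C t t0) ?eqxx // e0 -e -ex -surjective_pairing.
have [s hs] := H rs; exists s => t Xt dt e; apply: hs => //.
have := points_zero C Xt dt; rewrite e ptE ers => /eqP.
rewrite -rootE rootZ ?root_prod_XsubC // lead_coef_eq0 -size_poly_gt0.
by rewrite (spec_phi_size CC).
Qed.

End Points.

Section TwoCharts.
Variables (L : closedFieldType) (K : fieldType) (emb : {rmorphism L -> K}) (u w : K).
Variables (phi phi' : {poly {poly L}}) (d : nat) (T : eqType) (X domU domV : pred T).
Variables (posU posV : T -> L * L) (regT : T -> K -> Prop).
Hypothesis unz : u != 0.
Hypothesis CU : chart_points emb u w phi d X domU posU.
Hypothesis CV : chart_points emb u^-1 (w / u) phi' d X domV posV.
Hypothesis cover : forall t, X t -> domU t || domV t.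
Hypothesis overlap : forall t, X t -> domU t -> domV t = ((posU t).1 != 0).
Hypothesis regU : forall t f, X t -> domU t ->
  (regT t f <-> regular_in_chart emb u w (posU t).1 (posU t).2 f).
Hypothesis regV : forall t f, X t -> domV t ->
  (regT t f <-> regular_in_chart emb u^-1 (w / u) (posV t).1 (posV t).2 f).

Let CCU := points_chart CU.
Let CCV := points_chart CV.
Local Notation ev := (bieval emb u w).
Local Notation evu := (unieval emb u).
Local Notation ev' := (bieval emb u^-1 (w / u)).

Lemma regTD t f g : X t -> regT t f -> regT t g -> regT t (f + g).
Proof.
move=> Xt; have /orP [dt|dt] := cover Xt.
  by rewrite !regU //; apply: (regD CCU); apply: (points_zero CU).
by rewrite !regV //; apply: (regD CCV); apply: (points_zero CV).
Qed.

Lemma regTN t f : X t -> regT t f -> regT t (- f).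
Proof.
move=> Xt; have /orP [dt|dt] := cover Xt.
  by rewrite !regU //; apply: regN.
by rewrite !regV //; apply: regN.
Qed.

Lemma regTB t f g : X t -> regT t f -> regT t g -> regT t (f - g).
Proof. by move=> Xt rf rg; apply: regTD => //; apply: regTN. Qed.

Lemma regT0 t : X t -> regT t 0.
Proof.
move=> Xt; have /orP [dt|dt] := cover Xt.
  by rewrite !regU //; apply: reg0.
by rewrite !regV //; apply: reg0.
Qed.

Lemma regTZ t c f : X t -> regT t f -> regT t (emb c * f).
Proof.
have gen x y u0 w0 g : regular_in_chart emb x y u0 w0 g -> regular_in_chart emb x y u0 w0
  (emb c * g).
  move=> [a [b [hb ->]]]; exists (c%:P%:P * a), b; split=> //.
  by rewrite evM evC evuC mulrA.
move=> Xt; have /orP [dt|dt] := cover Xt.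
  by rewrite !regU //; apply: gen.
by rewrite !regV //; apply: gen.
Qed.

Definition chart_repartition (r : T -> K) := exists s : seq T, forall t, X t -> t \notin s ->
  regT t (r t).
Definition chart_negligible (r : T -> K) := exists f : K, forall t, X t -> regT t (r t - f).

(* The pair (j, i) stands for the function u^-(i+1) w^(j+1). *)
Definition cech_index := {j : 'I_d.-1 & 'I_j}.
HB.instance Definition _ := Finite.on cech_index.
(* The coefficient of u^-(i+1) w^(j+1) in (ev a) / u^m; shifting by 'X^(i+1)
   avoids the truncated subtraction m - (i+1). *)
Definition cech_coef (a : {poly {poly L}}) m (t : cech_index) : L :=
  ('X ^+ (tagged t).+1 * a`_(tag t).+1)`_m.

(** A function on the overlap of the charts is a / u^m with a of w-degree below d. The vector [v]
    collects the coefficients of the monomials u^-i w^j with 0 < i < j < d, those that are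
    polynomial on neither chart. *)
Definition cech_class (h : K) (v : cech_index -> L) :=
  exists (a : {poly {poly L}}) m, [/\ (size a <= d)%N, h * u ^+ m = ev a & forall t,
    v t = cech_coef a m t].

Lemma evuXn m : evu 'X^m = u ^+ m.
Proof. by rewrite (rmorphXn evu) /= -/(evu _) evuX. Qed.

Lemma clsZX a m n t : cech_coef ('X^n *: a) (m + n) t = cech_coef a m t.
Proof.
by rewrite /cech_coef coefZ mulrCA [LHS]coefXnM addnK ltnNge leq_addl.
Qed.

Lemma kapD h h' v v' : cech_class h v -> cech_class h' v' ->
  cech_class (h + h') (fun t => v t + v' t).
Proof.
move=> [a [m [sa ea va]]] [a' [m' [sa' ea' va']]].
exists ('X^m' *: a + 'X^m *: a'), (m + m')%N; split.
- apply: leq_trans (size_polyD _ _) _; rewrite geq_max.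
  by rewrite (leq_trans (size_scale_leq _ _)) // (leq_trans (size_scale_leq _ _)).
- by rewrite evD !evZ -ea -ea' !evuXn exprD; ring.
move=> t; rewrite va va' -(clsZX a m m') -(clsZX a' m' m) [(m' + m)%N]addnC.
by rewrite /cech_coef coefD mulrDr coefD.
Qed.

Lemma kapZ c h v : cech_class h v -> cech_class (emb c * h) (fun t => c * v t).
Proof.
move=> [a [m [sa ea va]]]; exists (c%:P *: a), m; split.
- exact: leq_trans (size_scale_leq _ _) _.
- by rewrite evZ -ea evuC mulrA.
by move=> t; rewrite va /cech_coef coefZ mulrCA mul_polyC coefZ.
Qed.

Lemma kap_ev (a : {poly {poly L}}) : cech_class (ev a) (fun=> 0).
Proof.
have [r [sr ->]] := ev_reduce CCU a; exists r, 0; split=> // [|t]; first by rewrite mulr1.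
by rewrite /cech_coef coefXnM.
Qed.

Lemma bivar_sum (b : {poly {poly L}}) : (size b <= d)%N ->
  b = \sum_(j < d) \sum_(k < size b`_j) (b`_j`_k *: 'X^k) *: 'X^j.
Proof.
move=> sb; transitivity (\poly_(j < d) b`_j).
  by apply/polyP => i; rewrite coef_poly; case: ltnP => // hi;
    rewrite nth_default // (leq_trans sb).
rewrite poly_def; apply: eq_bigr => j _; rewrite -scaler_suml; congr (_ *: _).
by rewrite -poly_def coefK.
Qed.

Lemma kap_sum (I : finType) (F : I -> K) (v : I -> cech_index -> L) :
  (forall i, cech_class (F i) (v i)) -> cech_class (\sum_i F i) (fun t => \sum_i v i t).
Proof.
move=> H.
have H0 : cech_class 0 (fun=> 0) by rewrite -[0](ev0 emb u w); apply: kap_ev.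
suff : forall l : seq I, cech_class (\sum_(i <- l) F i) (fun t => \sum_(i <- l) v i t) by apply.
elim=> [|x l IH].
  have [a [m [sa ea va]]] := H0; exists a, m; split=> // [|t]; rewrite big_nil //; exact: va.
have [a [m [sa ea va]]] := kapD (H x) IH; exists a, m; split=> // [|t]; rewrite big_cons //;
  exact: va.
Qed.

Lemma kap_ext h v v' : v =1 v' -> cech_class h v -> cech_class h v'.
Proof. by move=> e [a [m [sa ea va]]]; exists a, m; split=> // t; rewrite -e. Qed.

(** A monomial of the second chart is u^-(k+j) w^j. Its pole order in u is at least j, so it never
    meets an index i < j. *)
Lemma kap_ev' (a : {poly {poly L}}) : cech_class (ev' a) (fun=> 0).
Proof.
have [b [sb ->]] := ev_reduce CCV a; rewrite (bivar_sum sb) raddf_sum.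
apply: (@kap_ext _ (fun t => \sum_(j < d) 0)) => [t|]; first by rewrite big1.
apply: kap_sum => j; rewrite raddf_sum.
apply: (@kap_ext _ (fun t => \sum_(k < size b`_j) 0)) => [t|]; first by rewrite big1.
apply: kap_sum => k; rewrite /= -/(ev' _) evZ -mul_polyC evuM evuC evXn evX.
rewrite -mulrA; apply: (@kap_ext _ (fun t => b`_j`_k * 0)) => [t|]; first by rewrite mulr0.
apply: kapZ; exists 'X^j, (k + j)%N; split.
- by rewrite size_polyXn.
- rewrite [unieval _ _ _](rmorphXn (unieval emb u^-1)) /= -/(unieval _ _ _) evuX evXn evX exprD.
  rewrite exprVn expr_div_n; field; rewrite !expf_neq0 //.
case=> j' i' /=; rewrite /cech_coef /= coefXn; case: eqP => [e|_]; last by rewrite mulr0 coef0.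
rewrite mulr1 coefXn; case: eqP => // e'; have := ltn_ord i'; lia.
Qed.

Lemma kap_uniq h v v' : cech_class h v -> cech_class h v' -> v =1 v'.
Proof.
move=> [a [m [sa ea va]]] [a' [m' [sa' ea' va']]] t.
rewrite va va' -(clsZX a m m') -(clsZX a' m' m) [(m' + m)%N]addnC; congr cech_coef.
apply/eqP; rewrite -subr_eq0; apply/eqP; apply: (ev_small CCU).
  apply: leq_trans (size_polyD _ _) _; rewrite size_polyN geq_max.
  by rewrite (leq_trans (size_scale_leq _ _)) // (leq_trans (size_scale_leq _ _)).
by rewrite evB !evZ -ea -ea' !evuXn; ring.
Qed.

(** A monomial u^(k-m) w^j is polynomial on the first chart if k >= m and on the second if m - k >=
    j; the coefficients of all others are entries of the class. *)
Lemma kap0_split h : cech_class h (fun=> 0) -> exists a b, h = ev a + ev' b.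
Proof.
move=> [a [m [sa ea va]]].
suff [x [y e]] : exists x y, ev a = u ^+ m * (ev x + ev' y).
  exists x, y; apply: (mulIf (expf_neq0 m unz)); rewrite ea e; exact: mulrC.
rewrite (bivar_sum sa).
have sumP (I : finType) (F : I -> {poly {poly L}}) :
   (forall i, exists x y, ev (F i) = u ^+ m * (ev x + ev' y)) ->
   exists x y, ev (\sum_i F i) = u ^+ m * (ev x + ev' y).
  move=> H; apply: (big_ind (fun p => exists x y, ev p = u ^+ m * (ev x + ev' y))).
    by exists 0, 0; rewrite !ev0 addr0 mulr0.
    move=> p q [x [y e]] [x' [y' e']]; exists (x + x'), (y + y').
    by rewrite !evD e e'; ring.
  by move=> i _; apply: H.
apply: (sumP) => j; apply: (sumP) => k.
have [mk|km] := leqP m k.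
  exists ((a`_j`_k *: 'X^(k - m)) *: 'X^j), 0; rewrite ev0 addr0 !evZ -!mul_polyC !evuM !evuXn.
  have -> : u ^+ k = u ^+ m * u ^+ (k - m) by rewrite -exprD subnKC.
  by ring.
have [kj|kj] := leqP (k + j) m.
  exists 0, ((a`_j`_k *: 'X^(m - k - j)) *: 'X^j);
    rewrite ev0 add0r !evZ -!mul_polyC !evuM !evuXn.
  rewrite [unieval _ _ 'X^_](rmorphXn (unieval emb u^-1)) /= -/(unieval _ _ _) evuX !evXn !evX
    !evuC.
  have -> : u ^+ m = u ^+ (m - k - j) * u ^+ k * u ^+ j by rewrite -!exprD; congr (_ ^+ _); lia.
  rewrite exprVn expr_div_n; field; rewrite !expf_neq0 //.
suff -> : a`_j`_k = 0 by exists 0, 0; rewrite !ev0 !scale0r ev0 addr0 mulr0.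
case: j k km kj => [[|j] hj] //= k km kj; first by lia.
have hj' : (j < d.-1)%N by lia.
have hi : ((m - k).-1 < j)%N by lia.
have := va (Tagged (fun j : 'I_d.-1 => 'I_j) (Ordinal hi : 'I_(Ordinal hj'))).
rewrite /cech_coef /= coefXnM; case: ltnP => [|_]; first by lia.
by have -> : (m - (m - k).-1.+1 = k)%N by lia.
Qed.

(** The map from repartitions to Cech cohomology, kept as a relation: [fU] and [fV] approximate [r]
    on the two charts, and the class is that of their difference on the overlap. *)
Definition adelic_class (r : T -> K) (v : cech_index -> L) := exists fU fV,
  [/\ forall t, X t -> domU t -> regT t (r t - fU),
      forall t, X t -> domV t -> regT t (r t - fV) & cech_class (fU - fV) v].

Lemma kapr_exists r : chart_repartition r -> exists v, adelic_class r v.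
Proof.
move=> [s hs].
have [|fU HU] := local_approx CU (s := s) (r := r).
  by move=> t Xt dt ts; apply/regU => //; apply: hs.
have [|fV HV] := local_approx CV (s := s) (r := r).
  by move=> t Xt dt ts; apply/regV => //; apply: hs.
have HU' t : X t -> domU t -> regT t (r t - fU) by move=> Xt dt; apply/regU => //; apply: HU.
have HV' t : X t -> domV t -> regT t (r t - fV) by move=> Xt dt; apply/regV => //; apply: HV.
(* On the overlap, where u is nonzero, [fU - fV] is regular, so its denominator has no root except 0
   and is a constant times a power of u. *)
have [|a [c [cnz sa ef hc]]] := @regular_denom _ _ _ _ _ _ _ CCU (pred1 0) (fU - fV).
  move=> u0 w0 hp u0nz; have [t [Xt dt et]] := @points_surj _ _ _ _ _ _ _ _ _ _ _ CU (u0, w0)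
    hp.
  have dt' : domV t by rewrite overlap // et.
  have -> : fU - fV = (r t - fV) - (r t - fU) by ring.
  have := regTB Xt (HV' _ Xt dt') (HU' _ Xt dt); rewrite (regU _ Xt dt) et; exact.
have [rs ers] := closed_field_poly_normal c.
have l0 : lead_coef c != 0 by rewrite lead_coef_eq0.
have {ers} ec : c = (lead_coef c)%:P * 'X^(size rs).
  have h : all (pred1 0) rs.
    by apply/allP => z zr /=; apply: hc; rewrite ers rootZ // root_prod_XsubC.
  rewrite {1}ers mul_polyC; congr (_ *: _); elim: rs h {ers} => [|z rs IH] /=;
    first by rewrite big_nil.
  by move=> /andP[/eqP -> /IH e]; rewrite big_cons e subr0 exprS.
exists (cech_coef ((lead_coef c)^-1%:P *: a) (size rs)), fU, fV; split=> //.
exists ((lead_coef c)^-1%:P *: a), (size rs); split=> //.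
  exact: leq_trans (size_scale_leq _ _) _.
rewrite ef evZ ec evuM evuXn !evuC lead_coefM lead_coefC lead_coefXn mulr1 fmorphV.
by field; rewrite fmorph_eq0 l0 expf_neq0.
Qed.

Lemma kapr_comb (I : finType) (b : I -> T -> K) (v : I -> cech_index -> L) (c : I -> L) :
  (forall i, adelic_class (b i) (v i)) ->
  adelic_class (fun t => \sum_i emb (c i) * b i t) (fun t => \sum_i c i * v i t).
Proof.
move=> H.
suff : forall l : seq I, adelic_class (fun t => \sum_(i <- l) emb (c i) * b i t)
  (fun t => \sum_(i <- l) c i * v i t) by apply.
elim=> [|i l [fU [fV [HU HV HK]]]].
  exists 0, 0; split=> [t Xt dt|t Xt dt|]; rewrite ?big_nil ?subr0; try exact: regT0.
  by apply: (@kap_ext _ (fun=> 0)) => [t|]; [rewrite big_nil|rewrite -[0](ev0 emb u w);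
    apply: kap_ev].
have [gU [gV [HU' HV' HK']]] := H i.
exists (emb (c i) * gU + fU), (emb (c i) * gV + fV); split=> [t Xt dt|t Xt dt|].
- rewrite big_cons opprD addrACA -mulrBr; apply: regTD => //; last exact: HU.
  by apply: regTZ => //; apply: HU'.
- rewrite big_cons opprD addrACA -mulrBr; apply: regTD => //; last exact: HV.
  by apply: regTZ => //; apply: HV'.
have -> : emb (c i) * gU + fU - (emb (c i) * gV + fV) = emb (c i) * (gU - gV) + (fU - fV)
  by ring.
by apply: kap_ext (kapD (kapZ (c i) HK') HK) => t; rewrite big_cons.
Qed.

Lemma kapr_sub r r' v v' : adelic_class r v -> adelic_class r' v' ->
  adelic_class (fun t => r t - r' t) (fun t => v t - v' t).
Proof.
move=> H H'; pose b (x : bool) := if x then r else r'; pose y (x : bool) := if x then v else v'.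
have Hb x : adelic_class (b x) (y x) by case: x.
have [fU [fV [HU HV HK]]] := kapr_comb (fun x : bool => if x then 1 else -1) Hb.
have e t : \sum_(x : bool) emb (if x then 1 else -1) * b x t = r t - r' t.
  by rewrite big_bool /= rmorphN rmorph1 mul1r mulN1r.
exists fU, fV; split=> [t Xt dt|t Xt dt|]; rewrite -?e; [exact: HU|exact: HV|].
by apply: kap_ext HK => t; rewrite big_bool /= mul1r mulN1r.
Qed.

(** With an empty set of allowed roots, the denominator of [regular_denom] is constant over the
    algebraically closed L. *)
Lemma ev_of_reg f : (forall t, X t -> domU t -> regT t f) -> exists a, f = ev a.
Proof.
move=> H; have [|a [c [cnz sa ef hc]]] := @regular_denom _ _ _ _ _ _ _ CCU pred0 f.
  move=> u0 w0 hp _; have [t [Xt dt et]] := @points_surj _ _ _ _ _ _ _ _ _ _ _ CU (u0, w0) hp.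
  by have := H _ Xt dt; rewrite (regU _ Xt dt) et.
have [sc|sc] := leqP (size c) 1; last by have [x /hc] := closed_root sc.
have [k knz ek] : exists2 k, k != 0 & c = k%:P by apply/size_poly1P;
  rewrite eqn_leq sc size_poly_gt0.
by exists (k^-1%:P *: a); rewrite evZ ef ek !evuC fmorphV mulrC.
Qed.

Lemma ev_of_reg' f : (forall t, X t -> domV t -> regT t f) -> exists a, f = ev' a.
Proof.
move=> H; have [|a [c [cnz sa ef hc]]] := @regular_denom _ _ _ _ _ _ _ CCV pred0 f.
  move=> u0 w0 hp _; have [t [Xt dt et]] := @points_surj _ _ _ _ _ _ _ _ _ _ _ CV (u0, w0) hp.
  by have := H _ Xt dt; rewrite (regV _ Xt dt) et.
have [sc|sc] := leqP (size c) 1; last by have [x /hc] := closed_root sc.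
have [k knz ek] : exists2 k, k != 0 & c = k%:P by apply/size_poly1P;
  rewrite eqn_leq sc size_poly_gt0.
by exists (k^-1%:P *: a); rewrite evZ ef ek !evuC fmorphV mulrC.
Qed.

Lemma kapr_neglig r v : chart_negligible r -> adelic_class r v -> v =1 fun=> 0.
Proof.
move=> [f Hf] [fU [fV [HU HV HK]]].
have [t Xt dt|a ea] := @ev_of_reg (fU - f).
  have -> : fU - f = (r t - f) - (r t - fU) by ring.
  by apply: regTB => //; [apply: Hf|apply: HU].
have [t Xt dt|b eb] := @ev_of_reg' (f - fV).
  have -> : f - fV = (r t - fV) - (r t - f) by ring.
  by apply: regTB => //; [apply: HV|apply: Hf].
have e : fU - fV = ev a + ev' b by rewrite -ea -eb; ring.
have := kapD (kap_ev a) (kap_ev' b); rewrite -e => /(kap_uniq HK) h t.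
by rewrite h addr0.
Qed.

Lemma kapr0_neglig r v : adelic_class r v -> v =1 (fun=> 0) -> chart_negligible r.
Proof.
move=> [fU [fV [HU HV HK]]] v0.
have [a [b e]] := kap0_split (kap_ext v0 HK).
(* Corrected by functions regular on their own charts, the two approximations agree; their common
   value is the global function sought. *)
have e' : fU - ev a = fV + ev' b.
  have -> : fU = fU - fV + fV by rewrite subrK.
  by rewrite e; ring.
exists (fU - ev a) => t Xt; have /orP [dt|dt] := cover Xt.
  rewrite opprB addrCA addrC; apply: regTD => //; first exact: HU.
  by apply/regU => //; apply: reg_ev.
rewrite e' opprD addrA; apply: regTB => //; first exact: HV.
by apply/regV => //; apply: reg_ev.
Qed.

(* r is u^-i w^j over u = 0 and 0 elsewhere, so that it is split by (u^-i w^j, 0). *)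
Lemma kapr_delta (t0 : cech_index) : exists r, chart_repartition r /\ adelic_class r
  (fun t => (t == t0)%:R).
Proof.
pose i := (tagged t0).+1; pose j := (tag t0).+1.
have [s hs] := fiber_list CU 0.
pose fU := w ^+ j / u ^+ i.
pose r t := if domU t && ((posU t).1 == 0) then fU else 0.
exists r; split.
  exists s => t Xt ts; rewrite /r; case: ifP => [/andP[dt /eqP e]|_]; last exact: regT0.
  by rewrite (hs t) in ts.
exists fU, 0; split=> [t Xt dt|t Xt dt|].
- rewrite /r dt /=; case: eqVneq => [_|h]; first by rewrite subrr; apply: regT0.
  rewrite sub0r; apply: regTN => //; apply/regU => //.
  exists 'X^j, ('X^i)%:P; rewrite ptC hornerXn expf_neq0 //; split=> //.
  by rewrite evXn evX evC evuXn.
- rewrite /r; case: ifP => [/andP[dt' e]|_]; last by rewrite subr0; apply: regT0.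
  by move: dt; rewrite overlap // e.
exists 'X^j, i; rewrite subr0; split.
- by rewrite size_polyXn; have := ltn_ord (tag t0); rewrite /j; lia.
- by rewrite evXn evX /fU divfK // expf_neq0.
case=> j' i'; rewrite /cech_coef /= coefXn; case: (eqVneq j'.+1 j) => [[e]|ne]; last first.
  rewrite mulr0 coef0; case: eqP => // e; case/eqP: ne; by rewrite /j -e.
rewrite mulr1 coefXn; congr (nat_of_bool _)%:R; rewrite /i /j in e *.
case: t0 e {i j fU r} => j0 i0 /= /val_inj e; subst j0.
by rewrite eqSS eq_Tagged eq_sym.
Qed.

Lemma card_J : #|{: cech_index}| = 'C(d.-1, 2).
Proof.
rewrite card_tagged sumnE big_map big_enum /= -triangular_sum big_mkord.
by apply: eq_bigr => i _; rewrite card_ord.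
Qed.

(** The classes of the [b i] form a matrix that is row free because the [b i] are independent modulo
    negligible repartitions, and row full because they span the repartitions of [kapr_delta]. It is
    therefore square. *)
Lemma two_charts_genus g (b : 'I_g -> T -> K) :
  (forall i, chart_repartition (b i)) ->
  (forall r, chart_repartition r -> exists c : 'I_g ->
    L, chart_negligible (fun t => r t - \sum_i emb (c i) * b i t)) ->
  (forall c : 'I_g -> L, chart_negligible (fun t => \sum_i emb (c i) * b i t) ->
    forall i, c i = 0) ->
  g = 'C(d.-1, 2).
Proof.
move=> Hb Hspan Hfree.
have /fin_all_exists [v Hv] : forall i, exists v, adelic_class (b i) v by move=> i;
  apply: kapr_exists.
pose M : 'M[L]_(g, #|{: cech_index}|) := \matrix_(i, t) v i (enum_val t).
have rf : row_free M.
  rewrite -kermx_eq0; apply/eqP/row_matrixP => k; rewrite row0.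
  have hk : row k (kermx M) *m M = 0 by apply/sub_kermxP; apply: row_sub.
  have := kapr_comb (fun i => row k (kermx M) 0 i) Hv => hc.
  apply/rowP => i; rewrite [RHS]mxE; apply: Hfree.
  apply: (kapr0_neglig hc) => t.
  have : (row k (kermx M) *m M) 0 (enum_rank t) = 0 by rewrite hk mxE.
  rewrite [LHS]mxE => e; rewrite -[RHS]e.
  by apply: eq_bigr => i' _; rewrite !mxE enum_rankK.
have rfull : row_full M.
  have H (k : 'I_#|{: cech_index}|) : exists c : 'I_g -> L, forall t, \sum_i c i * M i t =
    (t == k)%:R.
    have [r [hr kr]] := kapr_delta (enum_val k).
    have [c hc] := Hspan r hr.
    have := kapr_neglig hc (kapr_sub kr (kapr_comb c Hv)) => h.
    exists c => t; have /eqP := h (enum_val t); rewrite subr_eq0 => /eqP.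
    rewrite (inj_eq enum_val_inj) => ->.
    by apply: eq_bigr => i' _; rewrite !mxE.
  have /fin_all_exists [c hc] := H.
  apply/row_fullP; exists (\matrix_(k, i) c k i); apply/matrixP => k t.
  rewrite !mxE eq_sym -hc; apply: eq_bigr => i _; by rewrite mxE.
by move: rf rfull; rewrite /row_free /row_full => /eqP -> /eqP; rewrite card_J.
Qed.

End TwoCharts.

(** * Forms and their derivatives along lines *)

Section MmapTheory.
Variables (n : nat).

Lemma mmapMul (L : nzRingType) (R : comNzRingType) (f : {rmorphism L -> R}) (h : 'I_n ->
  R) p q :
  mmap f h (p * q) = mmap f h p * mmap f h q.
Proof. exact: rmorphM. Qed.

Lemma mmap_sum (L R : nzRingType) (f : {rmorphism L -> R}) (h : 'I_n -> R) (I : Type) (r :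
  seq I) P (F : I -> {mpoly L[n]}) :
  mmap f h (\sum_(i <- r | P i) F i) = \sum_(i <- r | P i) mmap f h (F i).
Proof. exact: raddf_sum. Qed.

Lemma mmap_ext (L R : nzRingType) (f g : L -> R) (h h' : 'I_n -> R) p :
  f =1 g -> h =1 h' -> mmap f h p = mmap g h' p.
Proof.
move=> ef eh; apply: eq_bigr => m _; rewrite ef; congr (_ * _).
by apply: eq_bigr => i _; rewrite eh.
Qed.

Lemma mmap_comp (L R S : nzRingType) (f : L -> R) (g : {rmorphism R -> S}) (h : 'I_n -> R) p :
  g (mmap f h p) = mmap (g \o f) (g \o h) p.
Proof.
rewrite /mmap raddf_sum; apply: eq_bigr => m _ /=; rewrite rmorphM; congr (_ * _).
by rewrite /mmap1 rmorph_prod; apply: eq_bigr => i _; rewrite rmorphXn.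
Qed.

Lemma mmap_meval (L : nzRingType) (R : comNzRingType) (f : {rmorphism L -> R}) (v : 'I_n ->
  R) p :
  (map_mpoly f p).@[v] = mmap f v p.
Proof.
rewrite /map_mpoly -[LHS]/(meval v _) mmap_comp; apply: mmap_ext => i /=; first exact: mevalC.
exact: mevalXU.
Qed.

Lemma mmap1_scale (R : comNzRingType) (c : R) (v : 'I_n -> R) m :
  mmap1 (fun i => c * v i) m = c ^+ mdeg m * mmap1 v m.
Proof.
rewrite /mmap1 mdegE -prodrXr -big_split /=; apply: eq_bigr => i _.
exact: exprMn.
Qed.

Lemma mmap_scale (L : nzRingType) (R : comNzRingType) (f : {rmorphism L -> R}) (v : 'I_n ->
  R) (c : R) d p :
  p \is d.-homog -> mmap f (fun i => c * v i) p = c ^+ d * mmap f v p.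
Proof.
move=> /dhomogP hp; rewrite /mmap big_distrr /= !big_seq; apply: eq_bigr => m /hp <-.
by rewrite mmap1_scale mulrCA.
Qed.

Lemma meval_scale (R : comNzRingType) (v : 'I_n -> R) (c : R) d (p : {mpoly R[n]}) :
  p \is d.-homog -> p.@[fun i => c * v i] = c ^+ d * p.@[v].
Proof. exact: (@mmap_scale _ _ idfun). Qed.

Lemma map_mpoly_homog (R S : nzRingType) (f : {rmorphism R -> S}) d (p : {mpoly R[n]}) :
  p \is d.-homog -> map_mpoly f p \is d.-homog.
Proof.
move=> /dhomogP hp; apply/dhomogP => m; rewrite mcoeff_msupp mcoeff_map_mpoly => h.
by apply: hp; rewrite mcoeff_msupp; apply: contraNneq h => ->; rewrite /= rmorph0.
Qed.

End MmapTheory.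

Section TopDegree.
Variable R : comNzRingType.
Implicit Types p q : {poly R}.

(** The coefficient may be zero: only then is the notion closed under products without any condition
    on leading terms. *)
Definition has_top_coef k p c := (size p <= k.+1)%N /\ p`_k = c.

Lemma topM k l p q a b : has_top_coef k p a -> has_top_coef l q b ->
  has_top_coef (k + l) (p * q) (a * b).
Proof.
move=> [sp ep] [sq eq]; split.
  by apply: leq_trans (size_polyMleq _ _) _; lia.
have hk : (k < (k + l).+1)%N by rewrite ltnS leq_addr.
rewrite coefM (bigD1 (Ordinal hk)) //= addKn ep eq big1 ?addr0 // => i ni.
have [ik|ik|e] := ltngtP i k; last by case/eqP: ni; apply: val_inj.
  rewrite [q`__]nth_default ?mulr0 //; apply: leq_trans sq _; lia.
by rewrite nth_default ?mul0r //; apply: leq_trans sp _.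
Qed.

Lemma topXn k p a m : has_top_coef k p a -> has_top_coef (k * m) (p ^+ m) (a ^+ m).
Proof.
move=> H; elim: m => [|m IH]; first by rewrite muln0 !expr0 /has_top_coef size_poly1 coef1.
by rewrite mulnS !exprS; apply: topM.
Qed.

Lemma top_prod (I : Type) (r : seq I) (k : I -> nat) (p : I -> {poly R}) (a : I -> R) :
  (forall i, has_top_coef (k i) (p i) (a i)) ->
  has_top_coef (\sum_(i <- r) k i) (\prod_(i <- r) p i) (\prod_(i <- r) a i).
Proof.
move=> H; elim: r => [|i r IH]; first by rewrite !big_nil /has_top_coef size_poly1 coef1.
by rewrite !big_cons; apply: topM.
Qed.

(** Only the terms in [b] contribute to degree d. This yields both the monicity of chart equations
    and the value of a form at the point at infinity of a parametrized line. *)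
Lemma top_mmap n (L : nzRingType) (f : {rmorphism L -> R}) (a b : 'I_n ->
  R) d (p : {mpoly L[n]}) :
  p \is d.-homog ->
  has_top_coef d (mmap (polyC \o f) (fun i => (a i)%:P + b i *: 'X) p) (mmap f b p).
Proof.
move=> /dhomogP hp; rewrite /mmap !big_seq.
have H m : m \in msupp p -> has_top_coef d ((polyC \o f) p@_m * mmap1 (fun i => (a i)%:P + b i
  *: 'X) m) (f p@_m * mmap1 b m).
  move=> /hp <-; rewrite -[X in has_top_coef X _ _]add0n; apply: topM.
    by split; [exact: size_polyC_leq1|rewrite coefC].
  rewrite /= mdegE /mmap1; apply: top_prod => i; rewrite -[X in has_top_coef X _ _]mul1n;
    apply: topXn; split.
    apply: leq_trans (size_polyD _ _) _; rewrite geq_max.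
    rewrite (leq_trans (size_polyC_leq1 _)) // (leq_trans (size_scale_leq _ _)) // size_polyX
      //.
  by rewrite coefD coefC coefZ coefX mulr1 add0r.
split.
  by apply: leq_trans (size_sum _ _ _) _; apply/bigmax_leqP_seq => m mp _; have [] := H m mp.
by rewrite coef_sum; apply: eq_bigr => m mp; have [] := H m mp.
Qed.
End TopDegree.

Section Line.
Variables (n : nat) (L : comNzRingType).

Definition line_poly (p : {mpoly L[n]}) (v e : 'I_n -> L) : {poly L} :=
  mmap polyC (fun i => (v i)%:P + e i *: 'X) p.

Lemma linp_horner p v e t : (line_poly p v e).[t] = p.@[fun i => v i + t * e i].
Proof.
rewrite /line_poly -[LHS]/(horner_eval t _) mmap_comp; apply: mmap_ext => i /=.
  by rewrite horner_evalE hornerC.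
by rewrite horner_evalE hornerD hornerC hornerZ hornerX mulrC.
Qed.

Lemma linp_deriv p v e : (line_poly p v e)^`() = \sum_i (e i)%:P * line_poly (mderiv i p) v e.
Proof.
pose l i : {poly L} := (v i)%:P + e i *: 'X.
have dl i : (l i)^`() = (e i)%:P.
  by rewrite derivD derivC derivZ derivX add0r alg_polyC.
pose Q (p : {mpoly L[n]}) := (mmap polyC l p)^`() = \sum_i (e i)%:P * mmap polyC l (mderiv i p).
have Q1 : Q 1.
  by rewrite /Q rmorph1 derivC big1 // => i _; rewrite -mpolyC1 mderivC raddf0 mulr0.
have QM a b : Q a -> Q b -> Q (a * b).
  rewrite /Q => Ha Hb; rewrite mmapMul derivM Ha Hb mulr_suml mulr_sumr -big_split /=.
  by apply: eq_bigr => i _; rewrite mderivM raddfD /= !mmapMul; ring.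
have QX i : Q 'X_i.
  rewrite /Q mmapX mmap1U dl (bigD1 i) //= mderivX big1 => [|j ji].
    rewrite mnm1E eqxx scale1r -[(U_(i) - U_(i))%MM]/_ .
    have -> : (U_(i) - U_(i) = 0 :> 'X_{1.. n})%MM by apply/mnmP => k;
      rewrite mnmBE subnn mnm0E.
    by rewrite mpolyX0 rmorph1 mulr1 addr0.
  by rewrite mderivX mnm1E eq_sym (negbTE ji) scale0r raddf0 mulr0.
have QXn i k : Q ('X_i ^+ k) by elim: k => [|k IH]; rewrite ?expr0 // exprS; apply: QM.
have Qm m : Q 'X_[m].
  rewrite mpolyXE_id; apply: (big_ind Q) => //.
suff : Q p by [].
elim/mpolyind: p => [|c m p _ _ IH].
  by rewrite /Q !raddf0 big1 // => i _; rewrite !raddf0 mulr0.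
rewrite /Q.
have -> : mmap polyC l (c *: 'X_[m] + p) = c%:P * mmap polyC l 'X_[m] + mmap polyC l p.
  by rewrite raddfD /= mmapZ.
rewrite derivD derivM derivC mul0r add0r (Qm m) IH mulr_sumr -big_split /=.
apply: eq_bigr => i _; rewrite mderivD mderivZ raddfD /= mmapZ; ring.
Qed.

Lemma linp_coef0 p v e : (line_poly p v e)`_0 = p.@[v].
Proof.
rewrite -horner_coef0 linp_horner; apply: mmap_ext => // i; by rewrite mul0r addr0.
Qed.

Lemma linp_coef1 p v e : (line_poly p v e)`_1 = \sum_i e i * (mderiv i p).@[v].
Proof.
have := congr1 (fun q : {poly L} => q`_0) (linp_deriv p v e); rewrite coef_deriv mulr1n => ->.
by rewrite coef_sum; apply: eq_bigr => i _; rewrite coefCM linp_coef0.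
Qed.

(** On the line v + t v a form of degree d is (1 + t)^d p(v); the two sides are its coefficient of
    t. *)
Lemma euler (p : {mpoly L[n]}) d (v : 'I_n -> L) : p \is d.-homog ->
  \sum_i v i * (mderiv i p).@[v] = d%:R * p.@[v].
Proof.
move=> hp; rewrite -linp_coef1.
have -> : line_poly p v v = (1 + 'X) ^+ d * (p.@[v])%:P.
  rewrite -[p.@[v]]/(mmap idfun v p) (mmap_comp idfun polyC).
  rewrite -(@mmap_scale n L {poly L} polyC _ _ _ _ hp); apply: mmap_ext => // i /=.
  by rewrite mulrDl mul1r -mul_polyC mulrC.
rewrite coefMC; congr (_ * _).
elim: d {hp} => [|d IH]; first by rewrite expr0 coefC.
have c0 : ((1 + 'X) ^+ d : {poly L})`_0 = 1 by rewrite -horner_coef0 horner_exp !hornerE expr1n.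
by rewrite exprS mulrDl mul1r coefD IH coefXM c0 -natr1.
Qed.

End Line.

(** * Projective coordinates and homogenization *)

Section Coords.
Variables (F : fieldType) (n : nat).

Lemma coords_lead (P : point F n) :
  exists i, coords P i = 1 /\ forall j : 'I_n.+1, (j < i)%N -> coords P j = 0.
Proof.
case/existsP: (valP P) => i /andP [/eqP h /forallP H]; exists i; split=> // j ji.
by apply/eqP; have := H j; rewrite ji.
Qed.

Lemma coords_neq0 (P : point F n) : exists i, coords P i != 0.
Proof. by have [i [h _]] := coords_lead P; exists i; rewrite h oner_eq0. Qed.

Lemma coords_ext (P Q : point F n) : (forall i, coords P i = coords Q i) -> P = Q.
Proof. by move=> h; apply: val_inj; apply/rowP => i; apply: h. Qed.

Lemma coords_inj (P Q : point F n) s : (forall i, coords P i = s * coords Q i) -> P = Q.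
Proof.
move=> h; have [i [i1 iz]] := coords_lead P; have [j [j1 jz]] := coords_lead Q.
have [ij|ji|/val_inj e] := ltngtP i j.
- by have := h i; rewrite i1 jz // mulr0 => /eqP; rewrite oner_eq0.
- have := h j; rewrite iz // j1 mulr1 => s0; have := h i; rewrite i1 -s0 mul0r => /eqP.
  by rewrite oner_eq0.
have s1 : s = 1 by have := h i; rewrite i1 e j1 mulr1.
by apply: coords_ext => k; rewrite h s1 mul1r.
Qed.

Lemma point_of (v : 'I_n.+1 -> F) : (exists i, v i != 0) ->
  exists (P : point F n) s, s != 0 /\ forall i, v i = s * coords P i.
Proof.
move=> /existsP h; have [i0 /existsP [i /andP [iv /eqP e]]] : exists i0 : nat, [exists i :
  'I_n.+1, (v i != 0) && (i == i0 :> nat)].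
  by case/existsP: h => i hi; exists i; apply/existsP; exists i; rewrite hi /=.
have ex : exists i0 : nat, [exists i : 'I_n.+1, (v i != 0) && (i == i0 :> nat)].
  by exists i; apply/existsP; exists i; rewrite iv /=.
have [k /existsP [j /andP [jv /eqP ej]] kmin] := ex_minnP ex.
pose x : 'rV[F]_n.+1 := \row_l (v l / v j).
have nx : normalized x.
  apply/existsP; exists j; rewrite mxE divff //= eqxx /=; apply/forallP => l;
    apply/implyP => lj.
  rewrite mxE mulf_eq0; apply/orP; left; apply: contraTT lj => lv.
  by rewrite -leqNgt ej; apply: kmin; apply/existsP; exists l; rewrite lv /=.
exists (exist _ x nx), (v j); split=> // l.
by rewrite /coords /= mxE mulrC divfK.
Qed.

End Coords.

Section Frame.
Variables (L : closedFieldType) (a b c al be ga : 'I_3 -> L).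

Definition pairing (x v : 'I_3 -> L) := \sum_i x i * v i.

(** Dual bases of L^3: the two fields say that the matrices of vectors and of linear forms are
    inverse on either side. The vector [b] is going to be the centre of projection. *)
Record frame : Prop := IsFrame {
  frame_sum : forall i j, a i * al j + b i * be j + c i * ga j = (i == j)%:R;
  frame_dual : [/\ [/\ pairing al a = 1, pairing al b = 0 & pairing al c = 0],
      [/\ pairing be a = 0, pairing be b = 1 & pairing be c = 0] &
      [/\ pairing ga a = 0, pairing ga b = 0 & pairing ga c = 1]]
}.

Definition linform (x : 'I_3 -> L) : {mpoly L[3]} := \sum_i x i *: 'X_i.

Lemma lf_homog x : linform x \is 1.-homog.
Proof.
by apply: rpred_sum => i _; apply: dhomogZ; rewrite dhomogX /= mdeg1.
Qed.

Lemma mmap_lf (R : comNzRingType) (f : {rmorphism L -> R}) v x :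
  mmap f v (linform x) = \sum_i f (x i) * v i.
Proof.
by rewrite mmap_sum; apply: eq_bigr => i _; rewrite mmapZ mmapX mmap1U.
Qed.

Definition combo (R : comNzRingType) (f : L -> R) x y z (i : 'I_3) : R :=
  x * f (a i) + y * f (b i) + z * f (c i).

Hypothesis Fr : frame.

Lemma lf_vec_gen (R : comNzRingType) (f : {rmorphism L -> R}) x y z e :
  mmap f (combo f x y z) (linform e) = x * f (pairing e a) + y * f (pairing e b) + z * f
    (pairing e c).
Proof.
rewrite mmap_lf /pairing !raddf_sum !mulr_sumr -!big_split; apply: eq_bigr => i _ /=.
by rewrite /combo !rmorphM; ring.
Qed.

Lemma lf_vec (R : comNzRingType) (f : {rmorphism L -> R}) x y z :
  [/\ mmap f (combo f x y z) (linform al) = x, mmap f (combo f x y z) (linform be) = y &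
      mmap f (combo f x y z) (linform ga) = z].
Proof.
have [[a1 a2 a3] [b1 b2 b3] [c1 c2 c3]] := frame_dual Fr.
by rewrite !lf_vec_gen a1 a2 a3 b1 b2 b3 c1 c2 c3 !rmorph1 !rmorph0 !mulr1 !mulr0 !addr0 !add0r.
Qed.

Lemma vec_lf (R : comNzRingType) (f : {rmorphism L -> R}) v i :
  v i = combo f (mmap f v (linform al)) (mmap f v (linform be)) (mmap f v (linform ga)) i.
Proof.
rewrite /combo !mmap_lf !mulr_suml -!big_split /=.
transitivity (\sum_j v j * f ((i == j)%:R)).
  rewrite (bigD1 i) //= eqxx rmorph1 mulr1 big1 ?addr0 // => j ji.
  by rewrite eq_sym (negbTE ji) rmorph0 mulr0.
by apply: eq_bigr => j _; rewrite -(frame_sum Fr) !rmorphD !rmorphM; ring.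
Qed.

(** Restriction to the points u a + w b + c, that is, to the chart where the linear form [ga] is
    1. *)
Definition dehomogenize (p : {mpoly L[3]}) : {poly {poly L}} :=
  mmap (polyC \o polyC) (fun i => (a i *: 'X + (c i)%:P)%:P + (b i)%:P *: 'X) p.

Lemma ev_dehom (R : comNzRingType) (f : {rmorphism L -> R}) x y p :
  bieval f x y (dehomogenize p) = mmap f (combo f x y 1) p.
Proof.
rewrite /dehomogenize mmap_comp; apply: mmap_ext => i /=; first by rewrite evC evuC.
by rewrite evD evZ evX evC evuD -!mul_polyC evuM !evuC evuX /combo; ring.
Qed.

Lemma ev_dehom_scale (R : comNzRingType) (f : {rmorphism L -> R}) x y z d p :
  p \is d.-homog -> mmap f (combo f (x * z) (y * z) z) p = z ^+ d * bieval f x y (dehomogenize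
    p).
Proof.
move=> hp; rewrite ev_dehom -(mmap_scale _ _ _ hp); apply: mmap_ext => // i.
by rewrite /combo; ring.
Qed.

Definition fits_degree (p : {poly {poly L}}) N :=
  forall j k, (j < size p)%N -> (k < size (p`_j)%R)%N -> (k + j <= N)%N.

Lemma bound_exists p : exists N0, forall N, (N0 <= N)%N -> fits_degree p N.
Proof.
exists (\max_(j < size p) size (p`_j)%R + size p)%N => N hN j k hj hk.
apply: leq_trans hN; apply: leq_add; last exact: ltnW.
apply: leq_trans (ltnW hk) _;
  exact: (@leq_bigmax_cond _ _ (fun j : 'I_(size p) => size (p`_j)%R) (Ordinal hj)).
Qed.

Definition homogenize N (p : {poly {poly L}}) : {mpoly L[3]} :=
  \sum_(j < size p) \sum_(k < size p`_j)
     p`_j`_k *: (linform al ^+ k * linform be ^+ j * linform ga ^+ (N - (k + j))).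

Lemma hom_homog N p : fits_degree p N -> homogenize N p \is N.-homog.
Proof.
move=> hN; apply: rpred_sum => j _; apply: rpred_sum => k _; apply: dhomogZ.
have e : N = (1 * k + 1 * j + 1 * (N - (k + j)))%N by rewrite !mul1n subnKC //; apply: hN.
rewrite [X in X.-homog]e; apply: dhomogM; [apply: dhomogM|]; apply: dhomogMn; exact: lf_homog.
Qed.

Lemma ev_sum (R : comNzRingType) (f : {rmorphism L -> R}) x y p :
  bieval f x y p = \sum_(j < size p) \sum_(k < size p`_j) f p`_j`_k * x ^+ k * y ^+ j.
Proof.
rewrite {1}(@bivar_sum _ (size p) p) // raddf_sum; apply: eq_bigr => j _.
rewrite raddf_sum; apply: eq_bigr => k _; rewrite /= -/(bieval f x y _) evZ evXn evX;
  congr (_ * _).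
by rewrite -mul_polyC evuM evuC [unieval _ _ _](rmorphXn (unieval f x)) /= -/(unieval f x _)
  evuX.
Qed.

Lemma hom_ev (R : comNzRingType) (f : {rmorphism L -> R}) x y z N p : fits_degree p N ->
  mmap f (combo f (x * z) (y * z) z) (homogenize N p) = z ^+ N * bieval f x y p.
Proof.
move=> hN; rewrite ev_sum mmap_sum big_distrr; apply: eq_bigr => j _ /=.
rewrite mmap_sum big_distrr; apply: eq_bigr => k _ /=.
rewrite mmapZ !mmapMul !rmorphXn /=; have [-> -> ->] := lf_vec f (x * z) (y * z) z.
have -> : z ^+ N = z ^+ k * z ^+ j * z ^+ (N - (k + j)).
  by rewrite -!exprD subnKC //; apply: hN.
by rewrite !exprMn; ring.
Qed.

Lemma pt_ev (p : {poly {poly L}}) x y : eval_at p x y = bieval idfun x y p.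
Proof.
rewrite ptE /bieval /= horner_evalE; congr (_.[_]); apply: eq_map_poly => q.
by rewrite /unieval /= map_poly_id.
Qed.

End Frame.

Lemma ev_horner0 (L : closedFieldType) (x y : {poly L}) p :
  (bieval polyC x y p).[0] = eval_at p x.[0] y.[0].
Proof.
rewrite pt_ev !ev_sum horner_sum; apply: eq_bigr => j _.
rewrite horner_sum; apply: eq_bigr => k _.
by rewrite !hornerM !horner_exp hornerC.
Qed.

Lemma lf_neq0 (L : closedFieldType) (x v : 'I_3 -> L) : (linform x).@[v] != 0 ->
  exists i, v i != 0.
Proof.
have [/existsP //|/existsPn H] := boolP [exists i, v i != 0].
rewrite -[_.@[_]]/(mmap idfun v _) mmap_lf big1 ?eqxx // => i _; have := H i;
  rewrite negbK => /eqP ->; exact: mulr0.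
Qed.

(** * The charts of a smooth plane curve and its genus *)

Section PlaneChart.
Variables (L : closedFieldType) (F : {mpoly L[3]}) (d : nat).
Hypothesis homF : F \is d.-homog.
Hypothesis d_gt0 : (0 < d)%N.

Definition nonsingular := forall v : 'I_3 -> L, F.@[v] = 0 -> (exists i, v i != 0) ->
  exists i, (mderiv i F).@[v] != 0.

Hypothesis smF : nonsingular.
Variable X' : point L 2 -> Prop.
Hypothesis hX : forall P, X' P <-> evalp F P = 0.
Variable K : function_field X'.

Definition on_curve : pred (point L 2) := fun P => evalp F P == 0.
Local Notation emb := (@ff_emb _ _ _ K).
Local Notation gen := (@ff_gen _ _ _ K).

Lemma genP n' (p : {mpoly L[3]}) : p \is n'.-homog ->
  (mmap emb gen p = 0 <-> forall P, on_curve P -> evalp p P = 0).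
Proof.
move=> hp; rewrite -mmap_meval; split=> [h P /eqP /hX XP|h].
  by apply: (iffLR (@ff_genP _ _ _ K p _) h P XP); exists n'.
by apply/(@ff_genP _ _ _ K p); [exists n'|move=> P /hX /eqP; apply: h].
Qed.

Variables a b c al be ga : 'I_3 -> L.
Hypothesis Fr : frame a b c al be ga.
Hypothesis Fb : F.@[b] = 1.

Definition gen_al := mmap emb gen (linform al).
Definition gen_be := mmap emb gen (linform be).
Definition gen_ga := mmap emb gen (linform ga).
Definition phi := dehomogenize a b c F.
Definition chart_domain (P : point L 2) := (linform ga).@[coords P] != 0.
Definition chart_coords (P : point L 2) : L * L :=
  ((linform al).@[coords P] / (linform ga).@[coords P], (linform be).@[coords P] / (linform
    ga).@[coords P]).

Lemma phi_monic_size : phi \is monic /\ size phi = d.+1.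
Proof.
have [sp ep] := @top_mmap {poly L} 3 L polyC (fun i => a i *: 'X + (c i)%:P) (fun i => (b i)%:P)
  d F homF.
have {}ep : phi`_d = 1.
  rewrite [LHS]ep -[mmap _ _ _]/(mmap (polyC \o idfun) (polyC \o b) F) -mmap_comp.
  by rewrite -[mmap _ _ _]/(F.@[b]) Fb.
have sz : size phi = d.+1.
  by apply/eqP; rewrite eqn_leq sp /= ltnNge; apply: contraTN isT => /(nth_default 0);
    rewrite ep => /eqP; rewrite oner_eq0.
by split=> //; rewrite monicE lead_coefE sz /= ep.
Qed.

Lemma coords_vec P : chart_domain P -> forall i, coords P i =
  combo a b c idfun ((chart_coords P).1 * (linform ga).@[coords P]) ((chart_coords P).2 *
    (linform ga).@[coords P]) ((linform ga).@[coords P]) i.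
Proof. by move=> dP i; rewrite /chart_coords /= !divfK // {1}(vec_lf Fr idfun (coords P) i).
  Qed.

Lemma eval_dom P e p : chart_domain P -> p \is e.-homog ->
  evalp p P = (linform ga).@[coords P] ^+ e * eval_at (dehomogenize a b c p) (chart_coords P).1
    (chart_coords P).2.
Proof.
move=> dP hp; rewrite pt_ev /evalp -(ev_dehom_scale a b c idfun _ _ _ hp).
by apply: mmap_ext => // i; rewrite {1}(coords_vec dP).
Qed.

Lemma eval_hom P p N : chart_domain P -> fits_degree p N ->
  evalp (homogenize al be ga N p) P = (linform ga).@[coords P] ^+ N * eval_at p (chart_coords
    P).1 (chart_coords P).2.
Proof.
move=> dP hN; rewrite pt_ev /evalp -(hom_ev Fr idfun _ _ _ hN).
by apply: mmap_ext => // i; rewrite {1}(coords_vec dP).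
Qed.

Lemma points_surjF u0 w0 : eval_at phi u0 w0 = 0 -> exists P, [/\ on_curve P, chart_domain P &
  chart_coords P = (u0, w0)].
Proof.
move=> h; pose v := combo a b c idfun u0 w0 1.
have [la lb lc] := lf_vec Fr idfun u0 w0 1.
have Fv : F.@[v] = 0 by rewrite -h pt_ev ev_dehom.
have vnz : exists i, v i != 0.
  by apply: (@lf_neq0 _ ga); rewrite -[meval _ _]/(mmap idfun v _) lc oner_eq0.
have [P [s [snz hs]]] := point_of vnz.
have scal e (p : {mpoly L[3]}) : p \is e.-homog -> p.@[v] = s ^+ e * p.@[coords P].
  by move=> hp; rewrite -(meval_scale _ _ hp); apply: mmap_ext.
have sl e : (linform e).@[coords P] = (linform e).@[v] / s.
  by rewrite (scal 1%N) ?lf_homog // expr1 mulrC mulKf.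
have [Ea Eb Ec] : [/\ (linform al).@[v] = u0, (linform be).@[v] = w0 & (linform ga).@[v] = 1]
  by [].
exists P; split.
- apply/eqP; have /eqP := Fv; rewrite (scal d) // mulf_eq0 expf_eq0 (negbTE snz) andbF /=.
  by move/eqP.
- by rewrite /chart_domain sl Ec mul1r invr_eq0.
have e x : x / s / (1 / s) = x by rewrite div1r invrK divfK.
by rewrite /chart_coords !sl Ea Eb Ec !e.
Qed.

Lemma pos_inj P Q : chart_domain P -> chart_domain Q -> chart_coords P = chart_coords Q ->
  P = Q.
Proof.
move=> dP dQ e; apply: (@coords_inj _ _ _ _ ((linform ga).@[coords P] / (linform ga).@[coords
  Q])) => i.
by rewrite (coords_vec dP) [in RHS](coords_vec dQ) -e /combo; field.
Qed.

Lemma phi_root u0 : exists w0, eval_at phi u0 w0 = 0.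
Proof.
have [mp sp] := phi_monic_size.
have [|w0 /rootP h] := @closed_root L (specialize u0 phi); last by exists w0; rewrite ptE.
by rewrite spec_size ?sp ?ltnS // (monicP mp) hornerC oner_eq0.
Qed.

Lemma zg_neq0 : gen_ga != 0.
Proof.
apply/eqP => /(genP (lf_homog ga)) H; have [w0 /points_surjF [P [XP /eqP dP _]]] := phi_root 0.
by apply: dP; apply: H.
Qed.

Definition gen_u := gen_al / gen_ga.
Definition gen_w := gen_be / gen_ga.

Lemma gen_vec i : gen i = combo a b c emb (gen_u * gen_ga) (gen_w * gen_ga) gen_ga i.
Proof. by rewrite /gen_u /gen_w !divfK ?zg_neq0 // {1}(vec_lf Fr emb gen i). Qed.

Lemma gen_dehom e p : p \is e.-homog -> mmap emb gen p = gen_ga ^+ e * bieval emb gen_u gen_w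
  (dehomogenize a b c p).
Proof.
move=> hp; rewrite -(ev_dehom_scale a b c emb _ _ _ hp).
by apply: mmap_ext => // i; rewrite {1}gen_vec.
Qed.

Lemma gen_hom N p : fits_degree p N -> mmap emb gen (homogenize al be ga N p) = gen_ga ^+ N *
  bieval emb gen_u gen_w p.
Proof.
move=> hN; rewrite -(hom_ev Fr emb _ _ _ hN).
by apply: mmap_ext => // i; rewrite {1}gen_vec.
Qed.

(** A product of two functions vanishing at a point has no linear term there, so F has zero
    derivative along [a] and [b]. Euler's relation supplies the derivative along the point u0 a + w0
    b + c, hence along [c], and the whole gradient vanishes. *)
Lemma phi_smooth p s u0 w0 : phi = p * s -> eval_at p u0 w0 = 0 -> eval_at s u0 w0 = 0 -> False.
Proof.
move=> e hp hs; pose v := combo a b c idfun u0 w0 1.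
have Fv : F.@[v] = 0.
  by have : eval_at phi u0 w0 = 0; [rewrite e ptM hp mul0r|rewrite pt_ev ev_dehom].
have dir (x y : {poly L}) t : x.[0] = u0 -> y.[0] = w0 -> line_poly F v t = bieval polyC x y phi
  ->
   \sum_i t i * (mderiv i F).@[v] = 0.
  move=> ex ey el; rewrite -linp_coef1 el e evM coefM big_ord_recl big_ord1 /=.
  by rewrite -!horner_coef0 !ev_horner0 ex ey hp hs mul0r mulr0 addr0.
have Da : \sum_i a i * (mderiv i F).@[v] = 0.
  apply: (dir (u0%:P + 'X) (w0%:P)); rewrite ?hornerE //.
  rewrite ev_dehom; apply: mmap_ext => // i;
    rewrite /v /combo /= !polyCD !polyCM polyC1 -mul_polyC. ring.
have Db : \sum_i b i * (mderiv i F).@[v] = 0.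
  apply: (dir (u0%:P) (w0%:P + 'X)); rewrite ?hornerE //.
  rewrite ev_dehom; apply: mmap_ext => // i;
    rewrite /v /combo /= !polyCD !polyCM polyC1 -mul_polyC. ring.
have Dv : \sum_i v i * (mderiv i F).@[v] = 0 by rewrite (euler _ homF) Fv mulr0.
have Dc : \sum_i c i * (mderiv i F).@[v] = 0.
  have : \sum_i v i * (mderiv i F).@[v] = u0 * (\sum_i a i * (mderiv i F).@[v]) +
     w0 * (\sum_i b i * (mderiv i F).@[v]) + \sum_i c i * (mderiv i F).@[v].
    rewrite !mulr_sumr -!big_split /=; apply: eq_bigr => i _; rewrite {1}/v /combo /=; ring.
  by rewrite Dv Da Db !mulr0 !add0r.
have [la lb lc] := lf_vec Fr idfun u0 w0 1.
have vnz : exists i, v i != 0.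
  by apply: (@lf_neq0 _ ga); rewrite -[meval _ _]/(mmap idfun v _) lc oner_eq0.
have [j /eqP] := smF Fv vnz; apply.
transitivity (\sum_i ((i == j)%:R * (mderiv i F).@[v])).
  rewrite (bigD1 j) //= eqxx mul1r big1 ?addr0 // => i ij.
  by rewrite (negbTE ij) mul0r.
transitivity (al j * (\sum_i a i * (mderiv i F).@[v]) + be j * (\sum_i b i * (mderiv i F).@[v])
  +
   ga j * \sum_i c i * (mderiv i F).@[v]); last by rewrite Da Db Dc !mulr0 !addr0.
rewrite !mulr_sumr -!big_split /=; apply: eq_bigr => i _; rewrite -(frame_sum Fr); ring.
Qed.

Lemma plane_chart : chart emb gen_u gen_w phi d.
Proof.
have [mp sp] := phi_monic_size; split=> //.
- have := gen_dehom homF; have /(genP homF) -> : forall P, on_curve P -> evalp F P = 0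
  by move=> P /eqP.
  by move/esym/eqP; rewrite mulf_eq0 expf_eq0 (negbTE zg_neq0) andbF /= => /eqP.
- move=> p hp u0 w0 /points_surjF [P [XP dP eP]].
  have [N /(_ N (leqnn _)) hN] := bound_exists p.
  have /(genP (hom_homog _ _ _ hN)) /(_ P XP) : mmap emb gen (homogenize al be ga N p) = 0.
    by rewrite gen_hom // hp mulr0.
  move/eqP; rewrite eval_hom // mulf_eq0 expf_eq0 (negbTE dP) andbF orFb => /eqP.
  by rewrite eP.
- exact: phi_smooth.
move=> f; have [e [G [H [hG hH]]]] := @ff_fracP _ _ _ K f; rewrite !mmap_meval.
rewrite (gen_dehom hG) (gen_dehom hH) => Hnz ->.
exists (dehomogenize a b c G), (dehomogenize a b c H).
have zn : gen_ga ^+ e != 0 by rewrite expf_neq0 ?zg_neq0.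
by move: Hnz; rewrite mulf_eq0 negb_or => /andP [_ Hnz]; split=> //;
  rewrite -mulf_div divff // mul1r.
Qed.

Lemma plane_chart_points : chart_points emb gen_u gen_w phi d on_curve chart_domain
  chart_coords.
Proof.
split.
- exact: plane_chart.
- move=> P /eqP XP dP; move/eqP: XP; rewrite (eval_dom dP homF) mulf_eq0 expf_eq0 (negbTE dP)
  andbF orFb.
  by move/eqP.
- by move=> P Q _ dP _ dQ; apply: pos_inj.
by case=> u0 w0 /points_surjF.
Qed.

Lemma regular_chart P f : on_curve P -> chart_domain P ->
  (regular_at P f <-> regular_in_chart emb gen_u gen_w (chart_coords P).1 (chart_coords P).2 f).
Proof.
move=> XP dP; have zn e : gen_ga ^+ e != 0 by rewrite expf_neq0 ?zg_neq0.
have ln e : (linform ga).@[coords P] ^+ e != 0 by rewrite expf_neq0.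
split=> [[e [G [H [hG hH HP]]]]|[g [h [hP ->]]]].
  rewrite !mmap_meval (gen_dehom hG) (gen_dehom hH) => ->.
  exists (dehomogenize a b c G), (dehomogenize a b c H).
  have := HP; rewrite (eval_dom dP hH) mulf_eq0 negb_or => /andP [_ hn]; split=> //.
  have hK : bieval emb gen_u gen_w (dehomogenize a b c H) != 0.
    by apply: ev_neq0 hn; [exact: plane_chart|apply: (points_zero plane_chart_points)].
  by rewrite -mulf_div divff // mul1r.
have [N1 hN1] := bound_exists g; have [N2 hN2] := bound_exists h.
have bg : fits_degree g (N1 + N2)%N by apply: hN1; rewrite leq_addr.
have bh : fits_degree h (N1 + N2)%N by apply: hN2; rewrite leq_addl.
exists (N1 + N2)%N, (homogenize al be ga (N1 + N2) g), (homogenize al be ga (N1 + N2) h); split.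
- exact: hom_homog.
- exact: hom_homog.
- by rewrite eval_hom // mulf_neq0.
rewrite !mmap_meval !gen_hom //.
have hK : bieval emb gen_u gen_w h != 0.
  by apply: ev_neq0 hP; [exact: plane_chart|apply: (points_zero plane_chart_points)].
by rewrite -mulf_div divff // mul1r.
Qed.

End PlaneChart.

Section PlaneGenus.
Variable L : closedFieldType.

(** Exchanging [a] and [c] replaces (u, w) by (1/u, w/u), so both charts are instances of one
    construction. *)
Lemma frame_swap (a b c al be ga : 'I_3 -> L) : frame a b c al be ga -> frame c b a ga be al.
Proof.
move=> [h [[a1 a2 a3] [b1 b2 b3] [c1 c2 c3]]]; split=> // i j.
by rewrite -h; ring.
Qed.

Lemma frame_unitmx (A : 'M[L]_3) : A \in unitmx ->
  frame (A 1) (A 0) (A 2%:R) ((invmx A)^T 1) ((invmx A)^T 0) ((invmx A)^T 2%:R).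
Proof.
move=> uA; split.
  move=> i j; have := congr1 (fun M : 'M_3 => M j i) (mulVmx uA); rewrite !mxE eq_sym => <-.
  rewrite !big_ord_recl big_ord0 /= addr0.
  have -> : lift ord0 (ord0 : 'I_2) = 1 :> 'I_3 by apply: val_inj.
  have -> : lift ord0 (lift ord0 (ord0 : 'I_1)) = 2%:R :> 'I_3 by apply: val_inj.
  by ring.
have D k l : pairing ((invmx A)^T k) (A l) = (l == k)%:R.
  have := congr1 (fun M : 'M_3 => M l k) (mulmxV uA); rewrite !mxE => <-.
  by apply: eq_bigr => i _; rewrite mxE mulrC.
by split; split; rewrite D.
Qed.

(** Through a zero of F there is a line along which the derivative of F is nonzero. *)
Lemma nonsingular_nonvanishing (F : {mpoly L[3]}) : nonsingular F -> exists v, F.@[v] != 0.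
Proof.
move=> smF; pose v (i : 'I_3) : L := (i == 0)%:R.
have [Fv|Fv] := eqVneq (F.@[v]) 0; last by exists v.
have [|i hi] := smF v Fv; first by exists 0; rewrite /v eqxx oner_eq0.
pose e (j : 'I_3) : L := (j == i)%:R.
have pnz : line_poly F v e != 0.
  apply: contraNneq hi => z; have := linp_coef1 F v e; rewrite z coef0 => h.
  apply/eqP; rewrite [RHS]h (bigD1 i) //= /e eqxx mul1r big1 ?addr0 // => j ji.
  by rewrite (negbTE ji) mul0r.
have [t ht] := closed_nonroot pnz.
by exists (fun j => v j + t * e j); rewrite -linp_horner.
Qed.

Lemma exists_frame (F : {mpoly L[3]}) d : F \is d.-homog -> nonsingular F ->
  exists a b c al be ga, frame a b c al be ga /\ F.@[b] != 0.
Proof.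
move=> hF smF; have [v hv] := nonsingular_nonvanishing smF.
(* Row 0 of the invertible matrix [row_ebase bv] spans the line of v; this row becomes [b], whence
   the order 1, 0, 2. *)
pose bv : 'rV[L]_3 := \row_i v i; pose A := row_ebase bv.
exists (A 1), (A 0), (A 2%:R), ((invmx A)^T 1), ((invmx A)^T 0), ((invmx A)^T 2%:R).
split; first by apply: frame_unitmx; apply: row_ebase_unit.
pose M := col_ebase bv *m pid_mx (\rank bv) : 'rV_3.
have eM : M *m A = bv by exact: mulmx_ebase.
have bieval i : v i = M 0 0 * A 0 i.
  have := congr1 (fun N : 'rV_3 => N 0 i) eM; rewrite [LHS]mxE [RHS]mxE => <-.
  rewrite (bigD1 0) //= big1 ?addr0 // => k kn.
  rewrite [M 0 k]mxE big_ord1 [pid_mx _ _ _]mxE.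
  have -> : ((0 : 'I_1) == k :> nat) = false by apply: contraNF kn => /eqP e; apply/eqP/val_inj.
  by rewrite mulr0 mul0r.
apply: contraNneq hv => z; rewrite -[F.@[v]]/(mmap idfun v F).
by rewrite (@mmap_ext _ _ _ idfun idfun v (fun i => M 0 0 * A 0 i)) // (mmap_scale _ _ _ hF)
  [mmap _ _ _]z mulr0.
Qed.

Lemma plane_genus1 (F : {mpoly L[3]}) d (X : point L 2 -> Prop) g a b c al be ga :
  F \is d.-homog -> (0 < d)%N -> nonsingular F -> frame a b c al be ga -> F.@[b] = 1 ->
  (forall P, X P <-> evalp F P = 0) -> has_genus X g -> g = 'C(d.-1, 2).
Proof.
move=> hF d0 smF Fr Fb hX [K [bs [Hb Hspan Hfree]]].
have Fr' := frame_swap Fr.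
have zK := zg_neq0 hF d0 hX K Fr Fb; have xK := zg_neq0 hF d0 hX K Fr' Fb.
have unz : gen_u K al ga != 0 by rewrite mulf_neq0 ?invr_eq0.
have CU := plane_chart_points hF d0 smF hX K Fr Fb.
have CV := plane_chart_points hF d0 smF hX K Fr' Fb.
have eu : gen_u K ga al = (gen_u K al ga)^-1 by rewrite /gen_u invf_div.
have ew : gen_w K be al = gen_w K be ga / gen_u K al ga.
  rewrite /gen_w /gen_u; have : gen_al K al != 0 by []. 
  by move=> xK'; rewrite invf_div mulrA divfK.
have regV := @regular_chart _ _ _ hF d0 smF _ hX K _ _ _ _ _ _ Fr' Fb.
rewrite eu ew in CV regV.
(* A point outside both charts is proportional to [b], where F is nonzero. *)
have lin_scale P : on_curve F P -> chart_domain ga P || chart_domain al P.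
  rewrite /chart_domain /on_curve /evalp => FP; apply: contraLR FP;
    rewrite negb_or !negbK => /andP [/eqP g0 /eqP a0].
  rewrite -[F.@[_]]/(mmap idfun (coords P) F).
  rewrite (@mmap_ext _ _ _ idfun idfun _ (fun i => (linform be).@[coords P] * b i)) // => [|i].
    rewrite (mmap_scale _ _ _ hF) [mmap _ _ _]Fb mulr1 expf_neq0 //.
    have [i] := coords_neq0 P; apply: contraNneq => b0; rewrite (vec_lf Fr idfun (coords P) i).
    by rewrite /combo [mmap _ _ (linform al)]a0 [mmap _ _ (linform be)]b0
      [mmap _ _ (linform ga)]g0 !mul0r !addr0.
  rewrite {1}(vec_lf Fr idfun (coords P) i) /combo [mmap _ _ (linform al)]a0
    [mmap _ _ (linform ga)]g0.
  by rewrite !mul0r add0r addr0.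
apply: (@two_charts_genus L K (ff_emb K) (gen_u K al ga) (gen_w K be ga) (phi F a b c)
  (phi F c b a) d
  _ (on_curve F) (chart_domain ga) (chart_domain al) (chart_coords al be ga) (chart_coords ga be
    al) (fun P f => regular_at P f) unz CU CV lin_scale _ _ _ g bs).
- by move=> P _ dP; rewrite /chart_coords /= mulf_eq0 invr_eq0 negb_or (dP : _ != 0) andbT.
- exact: (@regular_chart _ _ _ hF d0 smF _ hX K _ _ _ _ _ _ Fr Fb).
- exact: regV.
- by move=> i; have [s hs] := Hb i; exists s => P /eqP FP; apply: hs; apply/hX.
- move=> r [s hs]; have [|c' [f hf]] := Hspan r.
    by exists s => P XP; apply: hs; apply/eqP/hX.
  by exists c', f => P /eqP FP; apply: hf; apply/hX.
move=> c' [f hf]; apply: Hfree; exists f => P XP; apply: hf; exact/eqP/hX.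
Qed.

Theorem plane_genus (F : {mpoly L[3]}) d (X : point L 2 -> Prop) g :
  F \is d.-homog -> (0 < d)%N -> nonsingular F ->
  (forall P, X P <-> evalp F P = 0) -> has_genus X g -> g = 'C(d.-1, 2).
Proof.
move=> hF d0 smF hX; have [a [b [c [al [be [ga [Fr Fb]]]]]]] := exists_frame hF smF.
pose s := (F.@[b])^-1; have snz : s != 0 by rewrite invr_eq0.
apply: (@plane_genus1 (s *: F)) Fr _ _ => //.
- exact: dhomogZ.
- move=> v; rewrite mevalZ => /eqP; rewrite mulf_eq0 (negbTE snz) => /eqP Fv /(smF _ Fv) [i hi].
  by exists i; rewrite mderivZ mevalZ mulf_neq0.
- by rewrite mevalZ mulVf.
move=> P; rewrite hX /evalp mevalZ; split=> [->|/eqP]; first by rewrite mulr0.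
by rewrite mulf_eq0 (negbTE snz) => /eqP.
Qed.
End PlaneGenus.

(** * Forms vanishing on the curve are multiples of its equation *)

Section Filtration.
Variable L : fieldType.
Implicit Types p q : {poly {poly L}}.

(** The truncated subtraction also forces the coefficients of w^j with j > m to vanish. *)
Definition tot_deg_le m p := forall j, (size (p`_j)%R <= m.+1 - j)%N.

Lemma filtD m p q : tot_deg_le m p -> tot_deg_le m q -> tot_deg_le m (p + q).
Proof.
by move=> hp hq j; rewrite coefD (leq_trans (size_polyD _ _)) // geq_max hp hq.
Qed.

Lemma filt_sum m (I : Type) (r : seq I) (P : pred I) (G : I -> {poly {poly L}}) :
  (forall i, P i -> tot_deg_le m (G i)) -> tot_deg_le m (\sum_(i <- r | P i) G i).
Proof.
move=> H; apply: (big_ind (tot_deg_le m)) => //; last exact: filtD.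
by move=> j; rewrite coef0 size_poly0.
Qed.

Lemma filtM m n p q : tot_deg_le m p -> tot_deg_le n q -> tot_deg_le (m + n) (p * q).
Proof.
move=> hp hq j; rewrite coefM; apply: leq_trans (size_sum _ _ _) _.
apply/bigmax_leqP => i _.
have [->|pn] := eqVneq p`_i 0; first by rewrite mul0r size_poly0.
have [->|qn] := eqVneq q`_(j - i) 0; first by rewrite mulr0 size_poly0.
apply: leq_trans (size_polyMleq _ _) _.
have := hp i; have := hq (j - i)%N; have := ltn_ord i.
move: pn qn; rewrite -!size_poly_gt0.
by set x := size _; set y := size _; clearbody x y; lia.
Qed.

Lemma filtXn m p n : tot_deg_le m p -> tot_deg_le (m * n) (p ^+ n).
Proof.
move=> hp; elim: n => [|n IH]; last by rewrite exprS mulnS; apply: filtM.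
rewrite expr0 => j; rewrite coef1; case: j => [|j]; first by rewrite size_poly1 muln0.
by rewrite size_poly0.
Qed.

Lemma filt_prod (I : Type) (r : seq I) (k : I -> nat) (G : I -> {poly {poly L}}) :
  (forall i, tot_deg_le (k i) (G i)) -> tot_deg_le (\sum_(i <- r) k i) (\prod_(i <- r) G i).
Proof.
move=> H; elim: r => [|i r IH]; last by rewrite !big_cons; apply: filtM.
rewrite !big_nil => j; rewrite coef1; case: j => [|j]; first by rewrite size_poly1.
by rewrite size_poly0.
Qed.

Lemma filtC m (c : {poly L}) : (size c <= m.+1)%N -> tot_deg_le m c%:P.
Proof. by move=> hc [|j]; rewrite coefC //= size_poly0. Qed.

Lemma filtZXn m (c : {poly L}) n : (size c <= m.+1 - n)%N -> tot_deg_le m (c *: 'X^n).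
Proof.
move=> hc j; rewrite coefZ coefXn; case: eqP => [->|_]; first by rewrite mulr1.
by rewrite mulr0 size_poly0.
Qed.

(** Division by the monic [phi] respects total degree, so the quotient can be homogenized in degree
    m - d. The last clause covers m < d, where this difference truncates to 0. *)
Lemma filt_divide phi d m p : phi \is monic -> size phi = d.+1 -> tot_deg_le d phi ->
  tot_deg_le m p ->
  exists q r : {poly {poly L}}, [/\ p = phi * q + r, (size r <= d)%N, tot_deg_le (m - d) q &
    (m < d)%N -> q = 0].
Proof.
move=> mphi sphi fphi; have [n] := ubnP (size p); elim: n p => // n IH p sp fp.
have [pd|dp] := leqP (size p) d.
  by exists 0, p; split=> //; [rewrite mulr0 add0r|move=> j; rewrite coef0 size_poly0].
have pn : p != 0 by rewrite -size_poly_gt0; apply: leq_ltn_trans dp.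
pose N := (size p).-1; have lN : p`_N != 0 by rewrite -[p`_N]/(lead_coef p) lead_coef_eq0.
have sN : size p = N.+1 by rewrite /N prednK // size_poly_gt0.
have dN : (d <= N)%N by rewrite sN ltnS in dp.
have hN := fp N; have Nm : (N <= m)%N by move: hN lN; rewrite -size_poly_gt0; lia.
pose t : {poly {poly L}} := p`_N *: 'X^(N - d).
have ft : tot_deg_le (m - d) t by apply: filtZXn; apply: leq_trans hN _; lia.
have fpt : tot_deg_le m (phi * t) by rewrite -[m](subnKC (leq_trans dN Nm)); apply: filtM.
have lt : (size (p - phi * t)%R < n)%N.
  apply: leq_trans (_ : N.+1 <= n)%N; last by rewrite -sN.
  rewrite ltnS; apply/leq_sizeP => j hj; rewrite coefB.
  rewrite /t -scalerAr coefZ coefMXn ltnNge (leq_trans (leq_subr _ _) hj) /=.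
  have [e|hj'] := eqVneq j N.
    have pd : phi`_d = 1 by have := monicP mphi; rewrite lead_coefE sphi.
    by rewrite e subKn // pd mulr1 subrr.
  rewrite nth_default; last by rewrite sN; lia.
  by rewrite [phi`__]nth_default ?mulr0 ?subr0 // sphi; lia.
have fpp : tot_deg_le m (p - phi * t).
  apply: filtD => // j; rewrite coefN size_polyN; exact: fpt.
have [q [r [e sr fq mq]]] := IH _ lt fpp.
exists (q + t), r; split=> //; [|exact: filtD|by move=> md; move: (leq_trans dN Nm);
  rewrite leqNgt md].
by rewrite mulrDr addrAC -e subrK.
Qed.

End Filtration.

Section FormDivides.
Variable L : closedFieldType.

Lemma filt_dehom (a b c : 'I_3 -> L) e p : p \is e.-homog ->
  tot_deg_le e (dehomogenize a b c p).
Proof.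
move=> /dhomogP hp; rewrite /dehomogenize /mmap big_seq; apply: filt_sum => m /hp <-.
rewrite -[X in tot_deg_le X _]add0n; apply: filtM; first by apply: filtC;
  rewrite size_polyC_leq1.
rewrite /= mdegE; apply: filt_prod => i; rewrite -[X in tot_deg_le X _]mul1n; apply: filtXn.
apply: filtD.
  apply: filtC; apply: leq_trans (size_polyD _ _) _; rewrite geq_max.
  rewrite (leq_trans (size_scale_leq _ _)) ?size_polyX // (leq_trans (size_polyC_leq1 _)) //.
rewrite -['X]expr1; apply: filtZXn; exact: size_polyC_leq1.
Qed.

Lemma filt_bound m (q : {poly {poly L}}) : tot_deg_le m q -> fits_degree q m.
Proof.
by move=> fq j k hj hk; have := fq j; move: hk; set s := size _; clearbody s; lia.
Qed.

Lemma mmap_id n (R : comNzRingType) (p : {mpoly R[n]}) : mmap (@mpolyC n R) (fun i => 'X_i) p =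
  p.
Proof.
rewrite [RHS]mpolyE /mmap; apply: eq_bigr => m _; rewrite mul_mpolyC; congr (_ *: _).
by rewrite /mmap1 [RHS]mpolyXE_id.
Qed.

Variables (F : {mpoly L[3]}) (d : nat).
Hypothesis homF : F \is d.-homog.
Hypothesis d_gt0 : (0 < d)%N.
Hypothesis smF : nonsingular F.
Variable X : point L 2 -> Prop.
Hypothesis hX : forall P, X P <-> evalp F P = 0.
Variable K : function_field X.
Local Notation emb := (@ff_emb _ _ _ K).
Local Notation gen := (@ff_gen _ _ _ K).

(** This stands in for the Nullstellensatz: the remainder of the dehomogenized form modulo [phi]
    vanishes at the generic point and has w-degree below d, so it is zero by [ev_small]. *)
Lemma form_divides1 (a b c al be ga : 'I_3 -> L) e p : frame a b c al be ga -> F.@[b] = 1 ->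
  p \is e.-homog -> mmap emb gen p = 0 -> exists2 q, q \is (e - d).-homog & p = F * q.
Proof.
move=> Fr Fb hp pg.
have [mphi sphi] := phi_monic_size homF a c Fb.
have C := plane_chart homF d_gt0 smF hX K Fr Fb.
have zn := zg_neq0 homF d_gt0 hX K Fr Fb.
have evp0 : bieval emb (gen_u K al ga) (gen_w K be ga) (dehomogenize a b c p) = 0.
  have := @gen_dehom _ _ _ homF d_gt0 _ hX K _ _ _ _ _ _ Fr Fb _ _ hp; rewrite pg => /esym/eqP.
  by rewrite mulf_eq0 expf_eq0 (negbTE zn) andbF orFb => /eqP.
have [q [r [eq sr fq mq]]] := filt_divide mphi sphi (filt_dehom a b c homF) (filt_dehom a b c
  hp).
have r0 : r = 0.
  apply: (ev_small C sr); move: evp0; rewrite eq evD evM (chart_ev0 C) mul0r add0r //.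
exists (homogenize al be ga (e - d) q); first by apply: hom_homog; apply: filt_bound.
rewrite {}r0 addr0 in eq.
(* The dehomogenization is inverted over the fraction field. *)
pose R := {fraction {mpoly L[3]}}.
pose f : {rmorphism L -> R} := @tofrac {mpoly L[3]} \o @mpolyC 3 L.
pose v i : R := tofrac ('X_i : {mpoly L[3]}).
have tf g : tofrac g = mmap f v g :> R by rewrite -[in LHS](mmap_id g) mmap_comp.
apply/eqP; rewrite -tofrac_eq tofracM; apply/eqP; rewrite !tf.
set x := mmap f v (linform al); set y := mmap f v (linform be); set z := mmap f v (linform ga).
have znz : z != 0.
  rewrite /z -tf tofrac_eq0; apply: contraNneq (oner_neq0 L) => h.
  have [_ [_ _ [_ _ e1]]] := Fr.
  by rewrite -e1 /pairing -[X in X == 0](mmap_lf idfun c ga) h mmap0.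
have ve i : v i = combo a b c f (x / z * z) (y / z * z) z i.
  by rewrite !divfK // {1}(vec_lf Fr f v i).
have mv g : mmap f v g = mmap f (combo a b c f (x / z * z) (y / z * z) z) g by apply: mmap_ext.
rewrite !mv (ev_dehom_scale _ _ _ _ _ _ _ hp) (ev_dehom_scale _ _ _ _ _ _ _ homF).
rewrite (hom_ev Fr) ?eq ?evM; last exact: filt_bound.
have [ed|de] := ltnP e d; first by rewrite mq // ev0 !mulr0.
by rewrite -[in LHS](subnKC de) exprD; ring.
Qed.

End FormDivides.

Lemma form_divides (L : closedFieldType) (F : {mpoly L[3]}) d (X : point L 2 -> Prop)
    (K : function_field X) e p :
  F \is d.-homog -> (0 < d)%N -> nonsingular F -> (forall P, X P <-> evalp F P = 0) ->
  p \is e.-homog -> mmap (ff_emb K) (@ff_gen _ _ _ K) p = 0 ->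
  exists2 q, q \is (e - d).-homog & p = F * q.
Proof.
move=> hF d0 smF hX hp pg; have [a [b [c [al [be [ga [Fr Fb]]]]]]] := exists_frame hF smF.
pose s := (F.@[b])^-1; have snz : s != 0 by rewrite invr_eq0.
have [||||q hq ->] := @form_divides1 L (s *: F) d _ d0 _ X _ K a b c al be ga e p Fr _ hp pg.
- exact: dhomogZ.
- move=> v; rewrite mevalZ => /eqP; rewrite mulf_eq0 (negbTE snz) => /eqP Fv /(smF _ Fv) [i hi].
  by exists i; rewrite mderivZ mevalZ mulf_neq0.
- move=> P; rewrite hX /evalp mevalZ; split=> [->|/eqP]; first by rewrite mulr0.
  by rewrite mulf_eq0 (negbTE snz) => /eqP.
- by rewrite mevalZ mulVf.
exists (s *: q); first exact: dhomogZ.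
by rewrite -scalerAl -scalerAr.
Qed.

(** * Dimension counts in spaces of forms *)

Section LinearAlgebra.
Variable L : fieldType.

(** By hypothesis the image of g modulo W2 is a quotient of the image of f modulo W1, hence of
    dimension at most that of V1 / W1. Passing to a quotient is realized by the endomorphism
    [\1 - projv W], whose kernel is W. *)
Lemma dim_image_quotient (U V1 V2 : vectType L) (f : 'Hom(U, V1)) (g : 'Hom(U, V2))
    (W1 : {vspace V1}) (W2 : {vspace V2}) :
  (forall a, f a \in W1 -> g a \in W2) ->
  (\dim (limg g + W2) + \dim W1 <= dim V1 + \dim W2)%N.
Proof.
move=> H; pose p1 : 'End(V1) := (\1 - projv W1)%VF; pose p2 : 'End(V2) := (\1 - projv W2)%VF.
have kp (V : vectType L) (W : {vspace V}) x : ((\1 - projv W)%VF x == 0) = (x \in W).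
  rewrite add_lfunE opp_lfunE id_lfunE subr_eq0; apply/eqP/idP => [->|xW];
    first exact: memv_proj.
  by rewrite projv_id.
have kp' (V : vectType L) (W : {vspace V}) : lker (\1 - projv W)%VF = W.
  by apply/vspaceP => x; rewrite memv_ker kp.
have sub : (lker (p1 \o f) <= lker (p2 \o g))%VS.
  by apply/subvP => a; rewrite !memv_ker !comp_lfunE !kp; apply: H.
have d1 := limg_ker_dim (p1 \o f) fullv; have d2 := limg_ker_dim (p2 \o g) fullv.
rewrite !capfv in d1 d2.
have le_img : (\dim (limg (p2 \o g)) <= \dim (limg (p1 \o f)))%N.
  by have := dimvS sub; lia.
have i1 : (\dim (limg (p1 \o f)) <= \dim (limg p1))%N.
  by apply: dimvS; rewrite limg_comp; apply: limgS; apply: subvf.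
have e1 := limg_ker_dim p1 fullv; rewrite capfv kp' dimvf in e1.
have e2 := limg_ker_dim p2 (limg g + W2)%VS; rewrite kp' in e2.
have c2 : ((limg g + W2) :&: W2)%VS = W2 by apply/capv_idPr; apply: addvSr.
rewrite c2 in e2.
have i2 : (\dim (p2 @: (limg g + W2)) <= \dim (limg (p2 \o g)))%N.
  apply: dimvS; rewrite limgD limg_comp subv_add subvv /=;
    apply/subvP => y /memv_imgP [x xW ->].
  have /eqP -> : p2 x == 0 by rewrite kp.
  exact: mem0v.
lia.
Qed.

End LinearAlgebra.

Section Forms.
Variable L : fieldType.
Notation S m := (dhomog 3 L m).

(** Projecting onto the part of degree m gives a total linear map, so multiplication maps between
    spaces of forms carry no degree proof in their type. *)
Definition to_form m (p : {mpoly L[3]}) : S m := DHomog (pihomogP mdeg m p).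

Lemma inS_linear m : linear (to_form m).
Proof. by move=> a p q; apply: val_inj; rewrite /= linearP. Qed.
HB.instance Definition _ m := GRing.isLinear.Build L {mpoly L[3]} (S m) _ (to_form m)
  (inS_linear m).

Lemma val_inS m p : p \is m.-homog -> val (to_form m p) = p.
Proof. exact: pihomog_dE. Qed.

Lemma inS_val m (p : S m) : to_form m (val p) = p.
Proof. by apply: val_inj; rewrite val_inS //; apply: dhomog_is_dhomog. Qed.

Definition nforms m := ((m.+1 * m.+2) %/ 2)%N.

Lemma nforms2 m : (2 * nforms m = m.+1 * m.+2)%N.
Proof.
have h : (2 %| m.+1 * m.+2)%N by rewrite dvdn2 oddM /=; case: (odd m).
by rewrite /nforms [LHS]mulnC divnK.
Qed.

Lemma dim_S m : dim (S m) = nforms m.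
Proof.
have -> : dim (S m) = 'C(m + 2, m) by [].
by rewrite -bin_sub ?leq_addr // addKn bin2 /nforms addn2 /= divn2 mulnC.
Qed.

(** The second difference of the Hilbert function of the plane is the Bezout number d h. *)
Lemma nforms_second_diff n d h : (nforms (n + d + h) + nforms n = nforms (n + h) + nforms
  (n + d) + d * h)%N.
Proof.
have := nforms2 (n + d + h); have := nforms2 n; have := nforms2 (n + h);
  have := nforms2 (n + d).
nia.
Qed.

Definition mul_form_fun m e (F : {mpoly L[3]}) (A : S e) : S m := to_form m (F * val A).

Lemma mulS_fun_linear m e F : linear (@mul_form_fun m e F).
Proof. by move=> a x y; rewrite /mul_form_fun linearP /= mulrDr -scalerAr linearP. Qed.
HB.instance Definition _ m e F := GRing.isLinear.Build L (S e) (S m) _ (@mul_form_fun m e F)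
  (@mulS_fun_linear m e F).

Definition mul_form m e (F : {mpoly L[3]}) : 'Hom(S e, S m) := linfun (@mul_form_fun m e F).

Lemma mulSE m e d F (A : S e) : F \is d.-homog -> (d + e = m)%N ->
  val (mul_form m e F A) = F * val A.
Proof.
by move=> hF <-; rewrite lfunE; apply: pihomog_dE; apply: dhomogM => //;
  apply: dhomog_is_dhomog.
Qed.

Lemma mulS_ker m e d F : F != 0 -> F \is d.-homog -> (d + e = m)%N ->
  lker (mul_form m e F) = 0%VS.
Proof.
move=> Fnz hF em; apply/eqP; rewrite -subv0; apply/subvP => A; rewrite memv_ker memv0 => /eqP h.
have := mulSE A hF em; rewrite h /= => /esym/eqP; rewrite mulf_eq0 (negbTE Fnz) /= => /eqP e0.
by apply/eqP/val_inj.
Qed.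

Lemma dim_mulS m e d F : F != 0 -> F \is d.-homog -> (d + e = m)%N ->
  \dim (limg (mul_form m e F)) = nforms e.
Proof.
move=> Fnz hF em; have := limg_ker_dim (mul_form m e F) fullv.
by rewrite capfv (mulS_ker Fnz hF em) dimv0 add0n dimvf dim_S.
Qed.

Lemma memv_mulS m e d F (p : S m) q : F \is d.-homog -> (d + e = m)%N -> q \is e.-homog ->
  val p = F * q -> p \in limg (mul_form m e F).
Proof.
move=> hF em hq ep; have -> : p = mul_form m e F (to_form e q).
  by apply: val_inj; rewrite (mulSE _ hF em) val_inS.
exact: memv_img (memvf _).
Qed.

Section TwoForms.
Variables (F H : {mpoly L[3]}) (d h n : nat).
Hypotheses (hF : F \is d.-homog) (hH : H \is h.-homog) (Fnz : F != 0) (Hnz : H != 0).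
Hypothesis coprime : forall A B : {mpoly L[3]}, A \is (n + h).-homog -> B \is (n + d).-homog ->
  F * A + H * B = 0 -> exists2 C, C \is n.-homog & B = F * C.
Let m := (n + d + h)%N.

(** By [coprime], a common multiple of F and H in degree m is a multiple of F H. Inclusion-exclusion
    then gives the ideal (F, H) codimension at most d h in degree m, which bounds any image of the
    forms in which the ideal dies. *)
Lemma dim_quotient_two (W : vectType L) (phi : 'Hom(S m, W)) :
  (forall A, phi (mul_form m (n + h) F A) = 0) ->
  (forall B, phi (mul_form m (n + d) H B) = 0) ->
  limg phi = fullv -> (dim W <= d * h)%N.
Proof.
move=> phiF phiH sphi.
have emF : (d + (n + h) = m)%N by rewrite /m; lia.
have emH : (h + (n + d) = m)%N by rewrite /m; lia.
set IF := limg (mul_form m (n + h) F); set IH := limg (mul_form m (n + d) H).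
have dF : \dim IF = nforms (n + h) := dim_mulS Fnz hF emF.
have dH : \dim IH = nforms (n + d) := dim_mulS Hnz hH emH.
have sub : (IF + IH <= lker phi)%VS.
  rewrite subv_add; apply/andP; split; apply/subvP => x /memv_imgP [A _ ->].
    by rewrite memv_ker phiF.
  by rewrite memv_ker phiH.
have dk := limg_ker_dim phi fullv; rewrite capfv sphi !dimvf dim_S in dk.
have cap : (IF :&: IH <= mul_form m (n + d) H @: limg (mul_form (n + d) n F))%VS.
  apply/subvP => x; rewrite memv_cap => /andP [/memv_imgP [A _ ->] /memv_imgP [B _ e]].
  rewrite e; apply: memv_img.
  have e0 : F * val A + H * - val B = 0.
    by rewrite mulrN -(mulSE A hF emF) -(mulSE B hH emH) e subrr.
  have hB : - val B \is (n + d).-homog by rewrite rpredN; apply: dhomog_is_dhomog.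
  have [C hC eB] := coprime (dhomog_is_dhomog A) hB e0.
  apply: (memv_mulS (d := d) (q := - C)) => //; [exact: addnC|by rewrite rpredN|].
  by rewrite mulrN -eB opprK.
have := dimv_sum_cap IF IH; have := dimvS cap; have := dimvS sub.
have := limg_ker_dim (mul_form m (n + d) H) (limg (mul_form (n + d) n F)).
have := nforms_second_diff n d h.
rewrite dF dH (dim_mulS Fnz hF (addnC d n)) -/m; move: dk; clear.
lia.
Qed.
End TwoForms.
End Forms.

(** * First-order jets at finitely many points *)

Section Jets.
Variable L : fieldType.

Definition independent (v w : 'I_3 -> L) := exists i j, v i * w j != v j * w i.

Definition dir_deriv (p : {mpoly L[3]}) (v t : 'I_3 -> L) : L := \sum_i t i * (mderiv i p).@[v].

Lemma dirderM p q v t : dir_deriv (p * q) v t = dir_deriv p v t * q.@[v] + p.@[v] * dir_deriv q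
  v t.
Proof.
rewrite /dir_deriv mulr_suml mulr_sumr -big_split; apply: eq_bigr => i _ /=.
by rewrite mderivM mevalD !mevalM; ring.
Qed.

Lemma dirderD p q v t : dir_deriv (p + q) v t = dir_deriv p v t + dir_deriv q v t.
Proof.
rewrite /dir_deriv -big_split; apply: eq_bigr => i _ /=.
by rewrite mderivD mevalD mulrDr.
Qed.

Lemma dirderZ a p v t : dir_deriv (a *: p) v t = a * dir_deriv p v t.
Proof.
by rewrite /dir_deriv mulr_sumr; apply: eq_bigr => i _; rewrite mderivZ mevalZ mulrCA.
Qed.

Lemma dirder0 v t : dir_deriv 0 v t = 0.
Proof. by rewrite -[0](scale0r 0) dirderZ mul0r. Qed.

Lemma dirder_sum (I : Type) (r : seq I) (G : I -> {mpoly L[3]}) v t :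
  dir_deriv (\sum_(i <- r) G i) v t = \sum_(i <- r) dir_deriv (G i) v t.
Proof.
elim: r => [|i r IH]; first by rewrite !big_nil dirder0.
by rewrite !big_cons dirderD IH.
Qed.

Definition minor_form (w : 'I_3 -> L) i j : {mpoly L[3]} := w j *: 'X_i - w i *: 'X_j.

Lemma minorf_homog w i j : minor_form w i j \is 1.-homog.
Proof. by apply: rpredB; apply: dhomogZ; rewrite dhomogX /= mdeg1. Qed.

Lemma minorf_eval w i j v : (minor_form w i j).@[v] = v i * w j - v j * w i.
Proof. by rewrite mevalB !mevalZ !mevalXU; ring. Qed.

Lemma dirder_minorf w i j v t : dir_deriv (minor_form w i j) v t = t i * w j - t j * w i.
Proof.
have D x : dir_deriv 'X_x v t = t x.
  rewrite /dir_deriv (bigD1 x) //= big1 => [|y yx].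
    rewrite mderivX mnm1E eqxx scale1r.
    have -> : (U_(x) - U_(x) = 0 :> 'X_{1.. 3})%MM by apply/mnmP => l;
      rewrite mnmBE subnn mnm0E.
    by rewrite mpolyX0 meval1 mulr1 addr0.
  by rewrite mderivX mnm1E eq_sym (negbTE yx) scale0r meval0 mulr0.
by rewrite /minor_form -scaleNr dirderD !dirderZ !D; ring.
Qed.

Lemma not_indep v w : (exists i, w i != 0) -> ~ independent v w -> exists s, forall i,
  v i = s * w i.
Proof.
move=> [i wi] h; exists (v i / w i) => j.
have [e|ne] := eqVneq (v i * w j) (v j * w i); last by case: h; exists i, j.
by rewrite mulrAC e mulfK.
Qed.

Variables (T : finType) (pv : T -> 'I_3 -> L).
Hypothesis pv_neq0 : forall P, exists i, pv P i != 0.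
Hypothesis pv_indep : forall P P', P != P' -> independent (pv P) (pv P').

(** Take the product, over the other points, of squares of linear forms through that point and not
    through [P]; the squares kill the first derivatives. A power of a coordinate nonzero at [P]
    adjusts the degree. *)
Lemma separating P m : (2 * #|T| <= m)%N -> exists A : {mpoly L[3]}, [/\ A \is m.-homog,
  A.@[pv P] = 1 &
  forall P', P' != P -> A.@[pv P'] = 0 /\ forall t, dir_deriv A (pv P') t = 0].
Proof.
move=> hm.
have H (l : seq T) : P \notin l -> exists A : {mpoly L[3]}, [/\ A \is (2 * size l).-homog,
  A.@[pv P] != 0 &
  forall P', P' \in l -> A.@[pv P'] = 0 /\ forall t, dir_deriv A (pv P') t = 0].
  elim: l => [|x l IH]; first by exists 1; rewrite muln0 meval1 oner_neq0; split=> //;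
    apply: dhomog1.
  rewrite inE negb_or => /andP [/pv_indep [i [j ij]] /IH [A [hA AP Al]]].
  exists (minor_form (pv x) i j ^+ 2 * A); split.
  - by rewrite /= mulnS; apply: dhomogM => //; apply: (dhomogMn 2 (minorf_homog _ _ _)).
  - by rewrite mevalM mulf_neq0 // rmorphXn /= expf_neq0 // minorf_eval subr_eq0.
  move=> P'; rewrite inE => /orP [/eqP ->|/Al [A0 A1]].
    have z : (minor_form (pv x) i j).@[pv x] = 0 by rewrite minorf_eval mulrC subrr.
    split=> [|t]; first by rewrite !mevalM z !mul0r.
    by rewrite expr2 !dirderM !mevalM z !(mul0r, mulr0, add0r).
  split=> [|t]; first by rewrite mevalM A0 mulr0.
  by rewrite dirderM A0 A1 !mulr0 addr0.
have [|A [hA AP Al]] := H (enum (predC1 P)); first by rewrite mem_enum /= !inE eqxx.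
have [i Pi] := pv_neq0 P; pose r := (m - 2 * size (enum (predC1 P)))%N.
have em : (r + 2 * size (enum (predC1 P)) = m)%N.
  by rewrite subnK // (leq_trans _ hm) // leq_mul2l -cardE max_card.
have hX : 'X_i ^+ r \is [in L[3], r.-homog].
  by rewrite -[X in X.-homog]mul1n; apply: dhomogMn; rewrite dhomogX /= mdeg1.
pose B := 'X_i ^+ r * A; have BP : B.@[pv P] != 0.
  by rewrite mevalM mulf_neq0 // rmorphXn /= mevalXU expf_neq0.
exists ((B.@[pv P])^-1 *: B); split.
- by apply: dhomogZ; rewrite -em; apply: dhomogM.
- by rewrite mevalZ mulVf.
move=> P' P'P; have [|A0 A1] := Al P'; first by rewrite mem_enum.
have B0 t : dir_deriv B (pv P') t = 0 by rewrite dirderM A0 A1 !mulr0 addr0.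
have B0' : B.@[pv P'] = 0 by rewrite mevalM A0 mulr0.
split=> [|t]; first by rewrite mevalZ B0' mulr0.
by rewrite dirderZ B0 mulr0.
Qed.

Variable tv : T -> 'I_3 -> L.
Hypothesis tv_indep : forall P, independent (tv P) (pv P).

Definition jet m (A : dhomog 3 L m) : 'M[L]_(#|T|, 2) :=
  \matrix_(r, s) if s == 0 then (val A).@[pv (enum_val r)] else dir_deriv (val A)
    (pv (enum_val r)) (tv (enum_val r)).

Lemma jet_linear m : linear (@jet m).
Proof.
have e a (x y : dhomog 3 L m) : val (a *: x + y) = a *: val x + val y by exact: linearP.
move=> a x y; apply/matrixP => r s; rewrite !mxE e; case: ifP => _.
  by rewrite mevalD mevalZ.
by rewrite dirderD dirderZ.
Qed.
HB.instance Definition _ m := GRing.isLinear.Build L (dhomog 3 L m) 'M[L]_(#|T|, 2) _ (@jet m)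
  (@jet_linear m).

(** A basis dual to the jet conditions: [C] is a separating form times a linear form that vanishes
    at P but not along [tv P], and [B] is a form of value 1 at P whose derivative is cancelled by a
    multiple of [C]. The extra linear factor makes the degree bound strict. *)
Lemma jet_surj m : (2 * #|T| < m)%N -> limg (linfun (@jet m)) = fullv.
Proof.
move=> hm; case: m hm => [|m] //; rewrite ltnS => hm.
have H P : exists BC : {mpoly L[3]} * {mpoly L[3]}, let: (B, C) := BC in [/\ B \is m.+1.-homog,
  C \is m.+1.-homog,
    forall P', B.@[pv P'] = (P' == P)%:R /\ dir_deriv B (pv P') (tv P') = 0 &
    forall P', C.@[pv P'] = 0 /\ dir_deriv C (pv P') (tv P') = (P' == P)%:R].
  have [A [hA AP Al]] := separating P hm.
  have [i [j ij]] := tv_indep P; have [l Pl] := pv_neq0 P.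
  have hlf (q : {mpoly L[3]}) : q \is 1.-homog -> q * A \is m.+1.-homog.
    by move=> hq; rewrite -[X in X.-homog]add1n; apply: dhomogM.
  pose c := (tv P i * pv P j - tv P j * pv P i)^-1.
  have cnz : tv P i * pv P j - tv P j * pv P i != 0 by rewrite subr_eq0.
  pose C := c *: (minor_form (pv P) i j * A).
  have CP P' : C.@[pv P'] = 0 /\ dir_deriv C (pv P') (tv P') = (P' == P)%:R.
    have [->|ne] := eqVneq P' P.
      rewrite mevalZ mevalM dirderZ dirderM AP dirder_minorf minorf_eval.
      have -> : pv P i * pv P j - pv P j * pv P i = 0 by rewrite mulrC subrr.
      by rewrite !mul0r mulr0 addr0 mulr1 mulVf.
    by have [A0 A1] := Al _ ne; rewrite mevalZ mevalM dirderZ dirderM A0 A1 !mulr0 addr0 mulr0.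
  pose B0 := (pv P l)^-1 *: ('X_l * A).
  have hXl : 'X_l \is [in L[3], 1.-homog] by rewrite dhomogX /= mdeg1.
  have B0P P' : B0.@[pv P'] = (P' == P)%:R.
    rewrite mevalZ mevalM mevalXU; have [->|ne] := eqVneq P' P; first by rewrite AP mulr1 mulVf.
    by have [-> _] := Al _ ne; rewrite !mulr0.
  have B0D P' : P' != P -> dir_deriv B0 (pv P') (tv P') = 0.
    by move=> ne; have [A0 A1] := Al _ ne; rewrite dirderZ dirderM A0 A1 !mulr0 addr0 mulr0.
  exists (- dir_deriv B0 (pv P) (tv P) *: C + B0, C); split=> //.
  - by apply: rpredD; apply: dhomogZ; [apply: dhomogZ|]; apply: hlf => //; apply: minorf_homog.
  - by apply: dhomogZ; apply: hlf; apply: minorf_homog.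
  move=> P'; have [C0 C1] := CP P'; rewrite mevalD mevalZ C0 mulr0 add0r B0P; split=> //.
  rewrite dirderD dirderZ C1.
  have [->|ne] := eqVneq P' P; first by rewrite mulr1 addNr.
  by rewrite (B0D _ ne) mulr0 addr0.
have /fin_all_exists [BC HBC] := H.
apply/eqP; rewrite eqEsubv subvf; apply/subvP => M _.
pose A := \sum_r (M r 0 *: (BC (enum_val r)).1 + M r 1 *: (BC (enum_val r)).2).
have hA : A \is m.+1.-homog.
  apply: rpred_sum => r _; have := HBC (enum_val r); case: (BC _) => B C [hB hC _ _].
  by apply: rpredD; apply: dhomogZ.
have -> : M = linfun (@jet m.+1) (to_form m.+1 A); last exact: memv_img (memvf _).
rewrite lfunE; apply/matrixP => r s; rewrite [RHS]mxE [\val _](val_inS hA).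
have ts : s = 0 \/ s = 1.
  by case: s => [[|[|//]] hs]; [left|right]; apply: val_inj.
have D1 : (1 == 0 :> 'I_2) = false by [].
case: ts => ->; rewrite ?D1 ?eqxx.
  rewrite [LHS](_ : _ = \sum_r' M r' 0 * (r == r')%:R).
    rewrite raddf_sum; apply: eq_bigr => r' _ /=; rewrite mevalD !mevalZ.
    have := HBC (enum_val r'); case: (BC _) => B C [_ _ HB HC].
    by rewrite (HB _).1 (HC _).1 mulr0 addr0 (inj_eq enum_val_inj).
  by rewrite (bigD1 r) //= eqxx mulr1 big1 ?addr0 // => r' /negbTE ne; rewrite eq_sym ne mulr0.
rewrite [LHS](_ : _ = \sum_r' M r' 1 * (r == r')%:R).
  rewrite dirder_sum; apply: eq_bigr => r' _ /=; rewrite dirderD !dirderZ.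
  have := HBC (enum_val r'); case: (BC _) => B C [_ _ HB HC].
  by rewrite (HB _).2 (HC _).2 mulr0 add0r (inj_eq enum_val_inj).
by rewrite (bigD1 r) //= eqxx mulr1 big1 ?addr0 // => r' /negbTE ne; rewrite eq_sym ne mulr0.
Qed.

(** All multiples of F and H have zero jet at every point, while forms of large degree reach all 2
    #|T| jet coordinates; [dim_quotient_two] compares the two. *)
Lemma jet_bound (F H : {mpoly L[3]}) d h :
  F \is d.-homog -> H \is h.-homog -> F != 0 -> H != 0 ->
  (forall n (A B : {mpoly L[3]}), A \is (n + h).-homog -> B \is (n + d).-homog ->
     F * A + H * B = 0 -> exists2 C, C \is n.-homog & B = F * C) ->
  (forall P, F.@[pv P] = 0 /\ dir_deriv F (pv P) (tv P) = 0) ->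
  (forall P, H.@[pv P] = 0 /\ dir_deriv H (pv P) (tv P) = 0) ->
  (2 * #|T| <= d * h)%N.
Proof.
move=> hF hH Fnz Hnz cop F0 H0; pose n := (2 * #|T|).+1.
have Z (G A : {mpoly L[3]}) m (B : dhomog 3 L m) : (forall P, G.@[pv P] = 0 /\ dir_deriv G
  (pv P) (tv P) = 0) ->
    val B = G * A -> linfun (@jet m) B = 0.
  move=> G0 e; rewrite lfunE; apply/matrixP => r s; rewrite !mxE e dirderM mevalM.
  by have [-> ->] := G0 (enum_val r); rewrite !mul0r addr0 if_same.
have := @dim_quotient_two L F H d h n hF hH Fnz Hnz (cop n) _ (linfun (@jet (n + d + h))).
have -> : dim 'M[L]_(#|T|, 2) = (2 * #|T|)%N by rewrite mulnC.
apply; last by apply: jet_surj; rewrite /n; lia.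
- by move=> A; apply: (Z F (val A)) => //; apply: mulSE => //; lia.
- by move=> B; apply: (Z H (val B)) => //; apply: mulSE => //; lia.
Qed.

End Jets.

(** * Forms vanishing at all rational points *)

Section RationalIdeal.
Variable L : fieldType.
Variable Q : nat.
Hypothesis Q_gt1 : (1 < Q)%N.
Notation S m := (dhomog 3 L m).

(* The coordinates of P x Fr(P); they generate the ideal of P^2(F_Q). *)
Definition fermat (i : 'I_3) : {mpoly L[3]} :=
  'X_(i + 1) * 'X_(i + 2%:R) ^+ Q - 'X_(i + 2%:R) * 'X_(i + 1) ^+ Q.

Lemma homogX (i : 'I_3) n : 'X_i ^+ n \is [in L[3], n.-homog].
Proof. by rewrite -[X in X.-homog]mul1n; apply: dhomogMn; rewrite dhomogX /= mdeg1. Qed.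

Lemma homogX1 (i : 'I_3) : 'X_i \is [in L[3], 1.-homog].
Proof. by rewrite dhomogX /= mdeg1. Qed.

Lemma fermat_homog i : fermat i \is Q.+1.-homog.
Proof.
have h (j k : 'I_3) : 'X_j * 'X_k ^+ Q \is [in L[3], (Q.+1).-homog].
  by rewrite -[Q.+1]add1n; apply: dhomogM; [apply: homogX1|apply: homogX].
exact: (rpredB (h _ _) (h _ _)).
Qed.

Definition comb_form_fun m e (g : 'I_3 -> {mpoly L[3]}) (a : {ffun 'I_3 -> S e}) : S m :=
  to_form m (\sum_i g i * val (a i)).

Lemma combS_linear m e g : linear (@comb_form_fun m e g).
Proof.
move=> c x y; rewrite /comb_form_fun -linearP; congr (to_form _ _).
rewrite scaler_sumr -big_split; apply: eq_bigr => i _ /=.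
by rewrite !ffunE /= mulrDr -scalerAr.
Qed.
HB.instance Definition _ m e g := GRing.isLinear.Build L {ffun 'I_3 ->
  S e} (S m) _ (@comb_form_fun m e g) (@combS_linear m e g).

Definition comb_form m e g : 'Hom({ffun 'I_3 -> S e}, S m) := linfun (@comb_form_fun m e g).

Lemma combSE m e d g (a : {ffun 'I_3 -> S e}) : (forall i, g i \is d.-homog) -> (d + e = m)%N ->
  val (comb_form m e g a) = \sum_i g i * val (a i).
Proof.
move=> hg <-; rewrite lfunE; apply: pihomog_dE; apply: rpred_sum => i _.
by apply: dhomogM => //; apply: dhomog_is_dhomog.
Qed.

Section Degree.
Variables (m e : nat).
Hypothesis em : (Q.+1 + e = m)%N.

Definition fermat_space := limg (comb_form m e fermat).

Lemma memJ i p : p \is e.-homog -> to_form m (fermat i * p) \in fermat_space.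
Proof.
move=> hp; pose a : {ffun 'I_3 -> S e} := [ffun j => if j == i then to_form e p else 0].
have -> : to_form m (fermat i * p) = comb_form m e fermat a; last exact: memv_img (memvf _).
rewrite lfunE; congr (to_form _ _); rewrite (bigD1 i) //= ffunE eqxx big1 ?addr0 => [|j /negbTE
  ji].
  by congr (_ * _); apply/esym/val_inS.
by rewrite ffunE ji mulr0.
Qed.

Definition monomial3 a b c : {mpoly L[3]} := 'X_0 ^+ a * 'X_1 ^+ b * 'X_(2%:R) ^+ c.

Lemma mon_homog a b c : monomial3 a b c \is (a + b + c).-homog.
Proof. by do 2![apply: dhomogM; rewrite ?homogX //]. Qed.

(* One normal form for each point of P^2(F_Q). *)
Definition normals : seq (S m) :=
  [seq to_form m (monomial3 (m - p.1 - p.2) p.1 p.2) | p : 'I_Q * 'I_Q] ++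
  [seq to_form m (monomial3 0 (m - c) c) | c : 'I_Q] ++ [:: to_form m (monomial3 0 0 m)].

Lemma size_normals : size normals = (Q ^ 2 + Q + 1)%N.
Proof. by rewrite !size_cat !size_image card_prod !card_ord /= addnA. Qed.

(** Modulo the Fermat forms X_0 X_1^Q may be replaced by X_0^Q X_1, and likewise for the pairs (0,
    2) and (1, 2). The weight b + 2c counts X_2 twice so that it decreases in all three cases; the
    monomials left over are the [normals]. *)
Lemma mon_reduce a b c : (a + b + c = m)%N -> to_form m (monomial3 a b c) \in (fermat_space +
  <<normals>>)%VS.
Proof.
have [k] := ubnP (b + 2 * c)%N; elim: k a b c => // k IH a b c hk habc.
have red i (p : {mpoly L[3]}) a' b' c' : (b' + 2 * c' < b + 2 * c)%N -> (a' + b' + c' = m)%N ->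
    p \is e.-homog -> monomial3 a b c = monomial3 a' b' c' + fermat i * p ->
      to_form m (monomial3 a b c) \in (fermat_space + <<normals>>)%VS.
  move=> lt eq hp ->; rewrite linearD; apply: memvD; first by apply: IH => //; lia.
  by apply: (subvP (addvSl _ _)); apply: memJ.
have i21 : (2%:R + 1 = 0 :> 'I_3) by apply: val_inj.
have i22 : (2%:R + 2%:R = 1 :> 'I_3) by apply: val_inj.
have i11 : (1 + 1 = 2%:R :> 'I_3) by apply: val_inj.
have i12 : (1 + 2%:R = 0 :> 'I_3) by apply: val_inj.
have [a0|a0] := posnP a; last first.
  have [bQ|bQ] := leqP Q b.
    apply: (red 2%:R (monomial3 a.-1 (b - Q) c) (a.-1 + Q)%N (b - Q).+1 c); [lia|lia| |].
      have -> : e = (a.-1 + (b - Q) + c)%N by lia.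
      exact: mon_homog.
    rewrite /fermat i21 i22 /monomial3.
    have -> : 'X_0 ^+ a = 'X_0 * 'X_0 ^+ a.-1 :> {mpoly L[3]} by rewrite -exprS prednK.
    have -> : 'X_1 ^+ b = 'X_1 ^+ (b - Q) * 'X_1 ^+ Q :> {mpoly L[3]} by rewrite -exprD subnK.
    by rewrite exprD exprS; ring.
  have [cQ|cQ] := leqP Q c.
    apply: (red 1 (- monomial3 a.-1 b (c - Q)) (a.-1 + Q)%N b (c - Q).+1); [lia|lia| |].
      have -> : e = (a.-1 + b + (c - Q))%N by lia.
      by rewrite rpredN; exact: mon_homog.
    rewrite /fermat i11 i12 /monomial3.
    have -> : 'X_0 ^+ a = 'X_0 * 'X_0 ^+ a.-1 :> {mpoly L[3]} by rewrite -exprS prednK.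
    have -> : 'X_(2%:R) ^+ c = 'X_(2%:R) ^+ (c - Q) * 'X_(2%:R) ^+ Q :> {mpoly L[3]}
      by rewrite -exprD subnK.
    by rewrite exprD exprS; ring.
  apply: (subvP (addvSr _ _)); apply: memv_span; rewrite mem_cat; apply/orP; left.
  apply/mapP; exists (Ordinal bQ, Ordinal cQ); rewrite ?mem_enum //=.
  by congr (to_form m (monomial3 _ _ _)); lia.
subst a; have [b0|b0] := posnP b.
  subst b; apply: (subvP (addvSr _ _)); apply: memv_span; rewrite !mem_cat inE.
  by have -> : c = m by []; rewrite eqxx !orbT.
have [cQ|cQ] := leqP Q c.
  apply: (red 0 (monomial3 0 b.-1 (c - Q)) 0 (b.-1 + Q)%N (c - Q).+1); [lia|lia| |].
    have -> : e = (0 + b.-1 + (c - Q))%N by lia.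
    exact: mon_homog.
  rewrite /fermat !add0r /monomial3.
  have -> : 'X_1 ^+ b = 'X_1 * 'X_1 ^+ b.-1 :> {mpoly L[3]} by rewrite -exprS prednK.
  have -> : 'X_(2%:R) ^+ c = 'X_(2%:R) ^+ (c - Q) * 'X_(2%:R) ^+ Q :> {mpoly L[3]}
    by rewrite -exprD subnK.
  by rewrite exprD exprS; ring.
apply: (subvP (addvSr _ _)); apply: memv_span; rewrite !mem_cat; apply/orP; right; apply/orP;
  left.
apply/mapP; exists (Ordinal cQ); rewrite ?mem_enum //=.
by congr (to_form m (monomial3 _ _ _)); lia.
Qed.

Lemma mpoly3_mon (mu : 'X_{1.. 3}) : 'X_[mu] = monomial3 (mu 0) (mu 1) (mu 2%:R) :>
  {mpoly L[3]}.
Proof.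
rewrite [LHS]mpolyXE_id !big_ord_recl big_ord0 mulr1 /monomial3 -mulrA.
have -> : lift ord0 (ord0 : 'I_2) = 1 :> 'I_3 by apply: val_inj.
by have -> : lift ord0 (lift ord0 (ord0 : 'I_1)) = 2%:R :> 'I_3 by apply: val_inj.
Qed.

Lemma J_normals_full : (fermat_space + <<normals>>)%VS = fullv.
Proof.
apply/eqP; rewrite eqEsubv subvf; apply/subvP => p _.
rewrite -(inS_val p) [\val p]mpolyE raddf_sum big_seq; apply: rpred_sum => mu hmu.
rewrite /= linearZ; apply: rpredZ; rewrite mpoly3_mon; apply: mon_reduce.
have /dhomogP := dhomog_is_dhomog p => /(_ _ hmu) <-.
rewrite /= mdegE !big_ord_recl big_ord0 addn0 addnA.
by congr (_ + mu _ + mu _)%N; apply: val_inj.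
Qed.

Lemma dim_J_ge : (nforms m <= \dim fermat_space + (Q ^ 2 + Q + 1))%N.
Proof.
rewrite -(dim_S L) -dimvf -J_normals_full.
apply: leq_trans (dimv_add_leqif _ _) _; rewrite leq_add2l -size_normals.
exact: dim_span.
Qed.

End Degree.

Variables (T : finType) (pv : T -> 'I_3 -> L).
Hypothesis pv_neq0 : forall P, exists i, pv P i != 0.
Hypothesis pv_indep : forall P P', P != P' -> independent (pv P) (pv P').
Hypothesis pv_rational : forall P i, pv P i ^+ Q = pv P i.
Hypothesis card_T : (Q ^ 2 + Q + 1 <= #|T|)%N.

Definition eval_forms_fun (Y : {set T}) m (A : S m) : 'rV[L]_#|Y| :=
  \row_r (val A).@[pv (enum_val r)].

Lemma evalS_linear (Y : {set T}) m : linear (@eval_forms_fun Y m).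
Proof.
have e a (x y : S m) : val (a *: x + y) = a *: val x + val y by exact: linearP.
by move=> a x y; apply/rowP => r; rewrite !mxE e mevalD mevalZ.
Qed.
HB.instance Definition _ (Y : {set T}) m := GRing.isLinear.Build L (S m) 'rV[L]_#|Y| _
  (@eval_forms_fun Y m) (@evalS_linear Y m).
Definition eval_forms (Y : {set T}) m : 'Hom(S m, 'rV[L]_#|Y|) := linfun (@eval_forms_fun Y m).

Lemma evalS_ker (Y : {set T}) m (A : S m) :
  reflect (forall P, P \in Y -> (val A).@[pv P] = 0) (A \in lker (eval_forms Y m)).
Proof.
rewrite memv_ker lfunE; apply: (iffP eqP) => [h P PY|h].
  have := congr1 (fun M : 'rV_ _ => M 0 (enum_rank_in PY P)) h.
  by rewrite !mxE enum_rankK_in.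
by apply/rowP => r; rewrite !mxE; apply: h; apply: enum_valP.
Qed.

Lemma interpolate m (f : T -> L) : (2 * #|T| <= m)%N ->
  exists2 A, A \is m.-homog & forall P, A.@[pv P] = f P.
Proof.
move=> hm; have /fin_all_exists [A HA] : forall P, exists A : {mpoly L[3]}, A \is m.-homog /\
  forall P', A.@[pv P'] = (P' == P)%:R.
  move=> P; have [A [hA AP Al]] := separating pv_neq0 pv_indep P hm; exists A; split=> // P'.
  by have [->|ne] := eqVneq P' P; [rewrite AP|have [-> _] := Al _ ne].
exists (\sum_P f P *: A P); first by apply: rpred_sum => P _; apply: dhomogZ; have [] := HA P.
move=> P; rewrite raddf_sum (bigD1 P) //= mevalZ (HA P).2 eqxx mulr1 big1 ?addr0 // => P' ne.
by rewrite mevalZ (HA P').2 eq_sym (negbTE ne) mulr0.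
Qed.

Lemma evalS_ker_dim (Y : {set T}) m : (nforms m <= \dim (lker (eval_forms Y m)) + #|Y|)%N.
Proof.
have := limg_ker_dim (eval_forms Y m) fullv; rewrite capfv dimvf dim_S => <-.
rewrite leq_add2l; apply: leq_trans (dimvS (subvf _)) _; rewrite dimvf.
by have -> : dim 'rV[L]_#|Y| = (1 * #|Y|)%N by []; rewrite mul1n.
Qed.

Lemma evalS_ker_dim_full m : (2 * #|T| <= m)%N -> (\dim (lker (eval_forms setT m)) + #|T| =
  nforms m)%N.
Proof.
move=> hm; have := limg_ker_dim (eval_forms setT m) fullv; rewrite capfv dimvf dim_S => <-.
congr addn; have -> : limg (eval_forms [set: T] m) = fullv.
  apply/eqP; rewrite eqEsubv subvf; apply/subvP => M _.
  have rT P : P \in [set: T] by rewrite inE.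
  have [A hA HA] := interpolate (fun P => M 0 (enum_rank_in (rT P) P)) hm.
  have -> : M = eval_forms setT m (to_form m A); last exact: memv_img (memvf _).
  rewrite lfunE; apply/rowP => r; rewrite [RHS]mxE [\val _](val_inS hA) HA.
  by rewrite enum_valK_in.
rewrite dimvf; have -> : dim 'rV[L]_#|[set: T]| = (1 * #|[set: T]|)%N by [].
by rewrite mul1n cardsT.
Qed.

Lemma fermat_eval i P : (fermat i).@[pv P] = 0.
Proof. by rewrite mevalB !mevalM !rmorphXn /= !mevalXU !pv_rational; ring. Qed.

(** The inclusion is an equality by dimensions: the Fermat forms have codimension at most Q^2 + Q +
    1, and the points of [T], at least as many, impose independent conditions. *)
Lemma J_evalS m e : (Q.+1 + e = m)%N -> (2 * #|T| <= m)%N ->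
  fermat_space m e = lker (eval_forms setT m).
Proof.
move=> em hm.
have sub : (fermat_space m e <= lker (eval_forms setT m))%VS.
  apply/subvP => x /memv_imgP [a _ ->]; apply/evalS_ker => P _.
  rewrite (combSE _ fermat_homog em) raddf_sum big1 // => i _.
  by rewrite /= mevalM fermat_eval mul0r.
apply/eqP; rewrite eqEdim sub /=.
have := dim_J_ge em; have := evalS_ker_dim_full hm; lia.
Qed.

(** The last hypothesis expresses that [fermat] is a multiple of [g] on the curve; as an implication
    between relations modulo F it avoids constructing the ratio, of degree e. It bounds the Fermat
    ideal in S_m / (F) by the dimension of S_n / (F). The forms vanishing on [Y] lie in that ideal
    plus (F), and the dimensions of S_m / (F) and S_n / (F) differ by d e. *)
Lemma nonclassical_bound (F : {mpoly L[3]}) (g : 'I_3 -> {mpoly L[3]}) (Y : {set T}) d e :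
  (0 < d)%N -> (d + e = Q + 2)%N -> F != 0 -> F \is d.-homog -> (forall i, g i \is d.-1.-homog)
    ->
  (forall P, (F.@[pv P] == 0) = (P \in Y)) ->
  (forall n (a : 'I_3 -> {mpoly L[3]}), (forall i, a i \is n.+1.-homog) ->
     (exists2 q, q \is n.-homog & \sum_i g i * a i = F * q) ->
     exists2 q, q \is (n + e).-homog & \sum_i fermat i * a i = F * q) ->
  (d * e <= #|Y|)%N.
Proof.
move=> d0 de Fnz hF hg hY Hq; pose n0 := (2 * #|T|)%N.
pose m := (n0 + d + e)%N; pose n := (n0 + d)%N.
have emg : (d.-1 + n0.+1 = n)%N by rewrite /n; lia.
have emf : (Q.+1 + n0.+1 = m)%N by rewrite /m; lia.
have emFn : (d + n0 = n)%N by rewrite /n addnC.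
have emFm : (d + (n0 + e) = m)%N by rewrite /m; lia.
have := @dim_image_quotient L _ _ _ (comb_form n n0.+1 g) (comb_form m n0.+1 fermat)
  (limg (mul_form n n0 F)) (limg (mul_form m (n0 + e) F)).
rewrite !(dim_mulS Fnz hF) // !dim_S -/(fermat_space m n0.+1) => H.
have {}H : (\dim (fermat_space m n0.+1 + limg (mul_form m (n0 + e) F)) + nforms n0 <= nforms n +
  nforms (n0 + e))%N.
  apply: H => a /memv_imgP [q _ eq].
  have := congr1 val eq; rewrite (combSE _ hg emg) (mulSE _ hF emFn) => e1.
  have [||q' hq' e2] := Hq n0 (fun i => val (a i)).
  - by move=> i; apply: dhomog_is_dhomog.
  - by exists (val q) => //; apply: dhomog_is_dhomog.
  by apply: (memv_mulS hF emFm hq'); rewrite (combSE _ fermat_homog emf).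
have kerY : (lker (eval_forms Y m) <= fermat_space m n0.+1 + limg (mul_form m (n0 + e) F))%VS.
  apply/subvP => G /evalS_ker GY.
  have hm : (2 * #|T| <= n0 + e)%N by rewrite leq_addr.
  (* Interpolating the quotient of [G] by F gives a multiple of F with the values of [G] at all of
     [T]; at the points of [Y] both values are 0, whatever the quotient by 0 is. *)
  have [A hA HA] := interpolate (fun P => (val G).@[pv P] / F.@[pv P]) hm.
  have -> : G = (G - mul_form m (n0 + e) F (to_form (n0 + e) A)) + mul_form m (n0 + e) F
    (to_form (n0 + e) A) by rewrite subrK.
  apply: memv_add; last exact: memv_img (memvf _).
  rewrite (J_evalS emf); last by rewrite /m -addnA leq_addr.
  apply/evalS_ker => P _.
  have -> : val (G - mul_form m (n0 + e) F (to_form (n0 + e) A)) = val G - val (mul_form m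
    (n0 + e) F (to_form (n0 + e) A)) by exact: linearB.
  rewrite (mulSE _ hF emFm) (val_inS hA) mevalB mevalM HA.
  have [FP|FP] := eqVneq (F.@[pv P]) 0; last by rewrite mulrC divfK ?subrr.
  by rewrite FP mul0r subr0; apply: GY; rewrite -hY FP.
have := dimvS kerY; have := evalS_ker_dim Y m; have := nforms_second_diff n0 d e.
by rewrite -/m -/n; lia.
Qed.

End RationalIdeal.

(** * Points of plane curves over a finite field *)

Lemma mderiv_map n (R S : nzRingType) (f : {rmorphism R -> S}) i (p : {mpoly R[n]}) :
  mderiv i (map_mpoly f p) = map_mpoly f (mderiv i p).
Proof. by apply/mpolyP => m; rewrite mcoeff_deriv !mcoeff_map_mpoly mcoeff_deriv /= rmorphMn.
  Qed.

Lemma mderiv_homog n (R : nzRingType) d i (p : {mpoly R[n]}) :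
  p \is d.-homog -> mderiv i p \is d.-1.-homog.
Proof.
move=> /dhomogP hp; apply/dhomogP => m; rewrite mcoeff_msupp mcoeff_deriv => h.
have : (m + U_(i))%MM \in msupp p.
  by rewrite mcoeff_msupp; apply: contraNneq h => ->; rewrite mul0rn.
by move=> /hp <-; rewrite /= mdegD mdeg1 addn1.
Qed.

(** Translation by 1 permutes the field and adds #|k| to the sum of its elements. *)
Lemma card_field_natr (k : finFieldType) : (#|k|%:R = 0 :> k)%R.
Proof.
apply: (addrI (\sum_(x : k) x)); rewrite addr0 [RHS](reindex_inj (addIr 1)) big_split /=.
by rewrite sumr_const.
Qed.

Lemma coords_indep (F : fieldType) (P Q : point F 2) : P != Q ->
  independent (coords P) (coords Q).
Proof.
have [/existsP [i /existsP [j h]] _|h /eqP []] :=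
  boolP [exists i, [exists j, coords P i * coords Q j != coords P j * coords Q i]];
    first by exists i, j.
have [|[i [j ij]]|s hs] := @not_indep _ (coords P) (coords Q); first exact: coords_neq0.
  by case/negP: h; apply/existsP; exists i; apply/existsP; exists j.
exact: coords_inj hs.
Qed.

Lemma card_plane (k : finFieldType) : (#|k| ^ 2 + #|k| + 1 <= #|{: point k 2}|)%N.
Proof.
pose T := (k * k + k + unit)%type.
pose f (t : T) : 'rV[k]_3 := match t with
  | inl (inl (y, z)) => \row_i [:: 1; y; z]`_i
  | inl (inr z) => \row_i [:: 0; 1; z]`_i
  | inr _ => \row_i [:: 0; 0; 1]`_i end.
have fn t : normalized (f t).
  case: t => [[[y z]|z]|[]]; apply/existsP.
  - exists 0; rewrite mxE /= eqxx; by apply/forallP.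
  - exists 1; rewrite mxE /= eqxx; apply/forallP => -[[|[|[|j]]] hj] //;
    by rewrite ?mxE /= ?eqxx ?implybT.
  exists 2%:R; rewrite mxE /= eqxx; apply/forallP => -[[|[|[|j]]] hj] //;
    by rewrite ?mxE /= ?eqxx ?implybT.
pose g t : point k 2 := exist _ (f t) (fn t).
have gi : injective g.
  move=> t t' /(congr1 val) /= /rowP e; have := e 0; have := e 1; have := e 2%:R.
  move: t t' {e} => [[[y z]|z]|[]] [[[y' z']|z']|[]]; rewrite !mxE /=.
  - by move=> -> ->.
  - by move=> _ _ /eqP; rewrite oner_eq0.
  - by move=> _ _ /eqP; rewrite oner_eq0.
  - by move=> _ _ /esym/eqP; rewrite oner_eq0.
  - by move=> ->.
  - by move=> _ /eqP; rewrite oner_eq0.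
  - by move=> _ _ /esym/eqP; rewrite oner_eq0.
  - by move=> _ /esym/eqP; rewrite oner_eq0.
  - by [].
have := leq_card g gi; rewrite !card_sum card_prod card_unit mulnn; exact.
Qed.

(** A vector g orthogonal to x and y is parallel to their cross product, so g . a = 0 forces each
    component of g to kill (x cross y) . a. The identities hold in any commutative ring. *)
Lemma cross_kill (R : comNzRingType) (x0 x1 x2 y0 y1 y2 g0 g1 g2 a0 a1 a2 : R) :
  x0 * g0 + (x1 * g1 + x2 * g2) = 0 -> y0 * g0 + (y1 * g1 + y2 * g2) = 0 ->
  g0 * a0 + (g1 * a1 + g2 * a2) = 0 ->
  let c := (x1 * y2 - x2 * y1) * a0 + ((x2 * y0 - x0 * y2) * a1 + (x0 * y1 - x1 * y0) * a2) in
  [/\ g0 * c = 0, g1 * c = 0 & g2 * c = 0].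
Proof.
move=> E1 E2 E3 /=; split.
- transitivity ((x1 * y2 - x2 * y1) * (g0 * a0 + (g1 * a1 + g2 * a2))
    - (y2 * (x0 * g0 + (x1 * g1 + x2 * g2)) - x2 * (y0 * g0 + (y1 * g1 + y2 * g2))) * a1
    + (y1 * (x0 * g0 + (x1 * g1 + x2 * g2)) - x1 * (y0 * g0 + (y1 * g1 + y2 * g2))) * a2);
      first by ring.
  by rewrite E1 E2 E3; ring.
- transitivity ((x2 * y0 - x0 * y2) * (g0 * a0 + (g1 * a1 + g2 * a2))
    + (y2 * (x0 * g0 + (x1 * g1 + x2 * g2)) - x2 * (y0 * g0 + (y1 * g1 + y2 * g2))) * a0
    - (y0 * (x0 * g0 + (x1 * g1 + x2 * g2)) - x0 * (y0 * g0 + (y1 * g1 + y2 * g2))) * a2);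
      first by ring.
  by rewrite E1 E2 E3; ring.
transitivity ((x0 * y1 - x1 * y0) * (g0 * a0 + (g1 * a1 + g2 * a2))
    - (y1 * (x0 * g0 + (x1 * g1 + x2 * g2)) - x1 * (y0 * g0 + (y1 * g1 + y2 * g2))) * a0
    + (y0 * (x0 * g0 + (x1 * g1 + x2 * g2)) - x0 * (y0 * g0 + (y1 * g1 + y2 * g2))) * a1);
      first by ring.
by rewrite E1 E2 E3; ring.
Qed.

Section PlaneCurveCount.
Variables (k : finFieldType) (L : closedFieldType) (iota : {rmorphism k -> L}).
Variables (F0 : {mpoly k[3]}) (d : nat).
Let F : {mpoly L[3]} := map_mpoly iota F0.
Let Q := #|k|.
Hypothesis homF0 : F0 \is d.-homog.
Hypothesis d_gt0 : (0 < d)%N.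
Hypothesis smF : nonsingular F.
Variable X : point L 2 -> Prop.
Hypothesis hX : forall P, X P <-> evalp F P = 0.
Hypothesis X_nonempty : exists P, X P.
Variable K : function_field X.
Local Notation emb := (@ff_emb _ _ _ K).
Local Notation gen := (@ff_gen _ _ _ K).

Definition ratpt_coords (P : point k 2) (i : 'I_3) : L := iota (coords P i).

Lemma homF : F \is d.-homog. Proof. exact: map_mpoly_homog. Qed.

Lemma pvk_neq0 P : exists i, ratpt_coords P i != 0.
Proof. by have [i hi] := coords_neq0 P; exists i; rewrite fmorph_eq0. Qed.

Lemma pvk_indep P P' : P != P' -> independent (ratpt_coords P) (ratpt_coords P').
Proof.
move=> /coords_indep [i [j h]]; exists i, j; apply: contra_neq h => h.
by apply: (fmorph_inj iota); rewrite !rmorphM.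
Qed.

Lemma pvk_rational P i : ratpt_coords P i ^+ Q = ratpt_coords P i.
Proof. by rewrite /ratpt_coords -rmorphXn /= expf_card. Qed.

Lemma F_pvk P : (F.@[ratpt_coords P] == 0) = (evalp F0 P == 0).
Proof.
rewrite /F -[in LHS]/(meval _ _) mmap_meval -(fmorph_eq0 iota) /evalp.
by rewrite -[in RHS]/(mmap idfun (coords P) F0) mmap_comp.
Qed.

Definition curve_ratpts : {set point k 2} := [set P | F.@[ratpt_coords P] == 0].

(* Its value at P is the value at Fr(P) of the equation of the tangent line at P. *)
Definition frobenius_form : {mpoly L[3]} := \sum_i 'X_i ^+ Q * mderiv i F.

Lemma frobF_homog : frobenius_form \is (Q + d.-1).-homog.
Proof.
apply: rpred_sum => i _; apply: dhomogM; last exact: mderiv_homog homF.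
exact: homogX.
Qed.

Lemma natr_Q : Q%:R = 0 :> L.
Proof. by rewrite -(rmorph_nat iota) card_field_natr rmorph0. Qed.

(** At a rational point x_i^Q = x_i, so the value is the left side of Euler's relation. Since Q = 0
    in L only the partial derivatives get differentiated, and Euler's relation for them gives d - 1
    times the derivative of F along t. *)
Lemma frobF_jet P (t : 'I_3 -> L) : F.@[ratpt_coords P] = 0 -> dir_deriv F (ratpt_coords P) t =
  0 ->
  frobenius_form.@[ratpt_coords P] = 0 /\ dir_deriv frobenius_form (ratpt_coords P) t = 0.
Proof.
move=> FP FT; split.
  have := euler (ratpt_coords P) homF; rewrite FP mulr0 => <-.
  rewrite raddf_sum; apply: eq_bigr => i _ /=.
  by rewrite mevalM rmorphXn /= mevalXU pvk_rational.
have dXn (p : {mpoly L[3]}) v n : dir_deriv (p ^+ n) v t = n%:R * p.@[v] ^+ n.-1 * dir_deriv p v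
  t.
  elim: n => [|n IH].
    by rewrite expr0 !mul0r /dir_deriv big1 // => i _; rewrite -mpolyC1 mderivC meval0 mulr0.
  rewrite exprS dirderM IH rmorphXn /=; case: n {IH} => [|n];
    first by rewrite !mul0r mulr0 addr0 expr0 mulr1 !mul1r.
  by rewrite /= -[in RHS]natr1 [in RHS]mulrDl exprS mul1r; ring.
rewrite /frobenius_form dirder_sum.
transitivity (\sum_i \sum_j t j * (ratpt_coords P i * (mderiv i (mderiv j F)).@[ratpt_coords
  P])).
  apply: eq_bigr => i _; rewrite dirderM dXn natr_Q !mul0r add0r rmorphXn /= mevalXU
    pvk_rational.
  rewrite mulr_sumr; apply: eq_bigr => j _; by rewrite mderiv_comm; ring.
rewrite exchange_big /=.
transitivity (\sum_j t j * (d.-1%:R * (mderiv j F).@[ratpt_coords P])).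
  apply: eq_bigr => j _; rewrite -mulr_sumr; congr (_ * _).
  exact: (euler _ (mderiv_homog j homF)).
transitivity (d.-1%:R * dir_deriv F (ratpt_coords P) t); last by rewrite FT mulr0.
by rewrite mulr_sumr; apply: eq_bigr => j _; ring.
Qed.

(** The orthogonal of g has dimension at least 2, so it is not contained in the line of v. *)
Lemma tangent_exists (v g : 'I_3 -> L) : (exists i, v i != 0) -> 
  exists t, independent t v /\ \sum_i t i * g i = 0.
Proof.
move=> vnz; pose G : 'cV[L]_3 := \col_i g i; pose V : 'rV[L]_3 := \row_i v i.
have rk : (2 <= \rank (kermx G))%N.
  by rewrite mxrank_ker; have := rank_leq_col G; lia.
have /row_subPn [r hr] : ~~ (kermx G <= V)%MS.
  apply/negP => /mxrankS h; have := rank_leq_row V; lia.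
pose t i := row r (kermx G) 0 i.
have tg : \sum_i t i * g i = 0.
  have /sub_kermxP : (row r (kermx G) <= kermx G)%MS by apply: row_sub.
  move=> /(congr1 (fun M : 'M_1 => M 0 0)); rewrite [LHS]mxE [RHS]mxE => h; rewrite -[RHS]h.
  by apply: eq_bigr => i _; rewrite [G _ _]mxE.
exists t; split=> //.
have [/existsP [i /existsP [j h]]|h] :=
  boolP [exists i, [exists j, t i * v j != t j * v i]]; first by exists i, j.
have [[i [j ij]]|s hs] := @not_indep _ t v vnz.
  by case/negP: h; apply/existsP; exists i; apply/existsP; exists j.
case/negP: hr; apply/sub_rVP; exists s; apply/rowP => i; rewrite mxE [RHS]mxE [V _ _]mxE -hs.
by rewrite /t [RHS]mxE.
Qed.

Lemma genM p q : mmap emb gen (p * q) = mmap emb gen p * mmap emb gen q.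
Proof. exact: mmapMul. Qed.

Lemma classical_count : mmap emb gen frobenius_form != 0 ->
  (2 * #|curve_ratpts| <= d * (Q + d.-1))%N.
Proof.
move=> Hn.
have Fnz : F != 0.
  by have [v] := nonsingular_nonvanishing smF; apply: contraNneq => ->; rewrite meval0.
have Hnz : frobenius_form != 0 by apply: contraNneq Hn => ->; rewrite raddf0.
have /fin_all_exists [tv Htv] : forall P : {P | P \in curve_ratpts}, exists t,
  independent t (ratpt_coords (val P)) /\ dir_deriv F (ratpt_coords (val P)) t = 0.
  by move=> P; apply: tangent_exists; apply: pvk_neq0.
have F0P (P : {P | P \in curve_ratpts}) : F.@[ratpt_coords (val P)] = 0.
  by apply/eqP; have := valP P; rewrite inE.
have := @jet_bound L {P | P \in curve_ratpts} (fun P => ratpt_coords (val P)) _ _ tv _ F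
  frobenius_form d (Q + d.-1) homF frobF_homog Fnz Hnz.
rewrite card_sig cardsE; apply.
- by move=> P; apply: pvk_neq0.
- by move=> P P' ne; apply: pvk_indep; rewrite (inj_eq val_inj).
- by move=> P; have [] := Htv P.
(* At the generic point the relation reads H B = 0 with H nonzero, so B vanishes on X and is a
   multiple of F. *)
- move=> n A B hA hB e.
  have FB : mmap emb gen B = 0.
    have := congr1 (mmap emb gen) e; rewrite raddfD /= !genM raddf0.
    have -> : mmap emb gen F = 0.
      rewrite -mmap_meval; apply/(@ff_genP _ _ _ K F); last by move=> P /hX.
      by exists d; apply: homF.
    by rewrite mul0r add0r => /eqP; rewrite mulf_eq0 (negbTE Hn) => /eqP.
  have [q hq ->] := form_divides homF d_gt0 smF hX hB FB.
  by exists q => //; move: hq; rewrite addnK.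
- by move=> P; split; [apply: F0P|have [] := Htv P].
by move=> P; apply: frobF_jet; [apply: F0P|have [] := Htv P].
Qed.

Lemma nonclassical_count : mmap emb gen frobenius_form = 0 -> (d <= Q + 1)%N ->
  (d * (Q + 2 - d) <= #|curve_ratpts|)%N.
Proof.
move=> H0 dQ.
have Fnz : F != 0.
  by have [v] := nonsingular_nonvanishing smF; apply: contraNneq => ->; rewrite meval0.
have F_gen : mmap emb gen F = 0.
  rewrite -mmap_meval; apply/(@ff_genP _ _ _ K F); last by move=> P /hX.
  by exists d; apply: homF.
have Q1 : (1 < Q)%N by apply: finNzRing_gt1.
apply: (@nonclassical_bound L Q Q1 _ ratpt_coords pvk_neq0 pvk_indep pvk_rational (card_plane k)
  F (fun i => mderiv i F)) => //.
- lia.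
- exact: homF.
- by move=> i; apply: mderiv_homog homF.
- by move=> P; rewrite inE.
move=> n a ha [q hq eq].
have [||q' hq' e'] := @form_divides L F d X K (Q.+1 + n.+1) (\sum_i fermat L Q i * a i) homF
  d_gt0 smF hX.
- by apply: rpred_sum => i _; apply: dhomogM => //; apply: fermat_homog.
(* [E1] (Euler) and [E2] (vanishing of H) say that the generic point and its Frobenius image are
   orthogonal to the gradient [G]; [E3] is the relation assumed among the partial derivatives. This
   is the situation of [cross_kill]. *)
- pose G i := mmap emb gen (mderiv i F).
  have E1 : \sum_i gen i * G i = 0.
    have := euler gen (map_mpoly_homog emb homF); rewrite mmap_meval F_gen mulr0 => e;
      rewrite -[RHS]e.
    by apply: eq_bigr => i _; rewrite mderiv_map mmap_meval.
  have E2 : \sum_i gen i ^+ Q * G i = 0.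
    rewrite -[RHS]H0 /frobenius_form raddf_sum; apply: eq_bigr => i _ /=.
    by rewrite genM rmorphXn /= mmapX mmap1U.
  (* A gradient vanishing at the generic point would vanish on all of X, against non-singularity. *)
  have [j Gj] : exists j, G j != 0.
    have [/existsP //|/existsPn h] := boolP [exists j, G j != 0]; exfalso.
    have [P XP] := X_nonempty; have /hX FP := XP.
    have [i] := smF FP (coords_neq0 P); apply/negP; rewrite negbK; apply/eqP.
    have hi : mderiv i F \is d.-1.-homog by apply: mderiv_homog homF.
    have ho : homogeneous (mderiv i F) by exists d.-1.
    have := @ff_genP _ _ _ K (mderiv i F) ho; rewrite mmap_meval => hgen.
    by apply: (iffLR hgen _ P XP); apply/eqP; have := h i; rewrite negbK.
  have E3 : \sum_i G i * mmap emb gen (a i) = 0.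
    have := congr1 (mmap emb gen) eq; rewrite genM F_gen mul0r => e; rewrite -[RHS]e raddf_sum.
    by apply: eq_bigr => i _; rewrite /= genM.
  apply: (mulfI Gj); rewrite mulr0 raddf_sum; clear Gj.
  have V i : mmap emb gen (fermat L Q i) = gen (i + 1) * gen (i + 2%:R) ^+ Q - gen (i + 2%:R) *
    gen (i + 1) ^+ Q.
    by rewrite /fermat raddfB /= !genM !rmorphXn /= !mmapX !mmap1U.
  have -> : \sum_i mmap emb gen (fermat L Q i * a i) = \sum_i (gen (i + 1) * gen (i + 2%:R) ^+ Q
    - gen (i + 2%:R) * gen (i + 1) ^+ Q) * mmap emb gen (a i).
    by apply: eq_bigr => i _; rewrite genM V.
  have i21 : (2%:R + 1 = 0 :> 'I_3) by apply: val_inj.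
  have i22 : (2%:R + 2%:R = 1 :> 'I_3) by apply: val_inj.
  have i11 : (1 + 1 = 2%:R :> 'I_3) by apply: val_inj.
  have i12 : (1 + 2%:R = 0 :> 'I_3) by apply: val_inj.
  have o1 : lift ord0 (ord0 : 'I_2) = 1 :> 'I_3 by apply: val_inj.
  have o2 : lift ord0 (lift ord0 (ord0 : 'I_1)) = 2%:R :> 'I_3 by apply: val_inj.
  move: E1 E2 E3; rewrite !big_ord_recl !big_ord0 !o1 !o2 -[ord0]/(0 : 'I_3) !add0r i21 i22 i11
    i12 !addr0 => E1 E2 E3.
  have ej : [\/ j = 0, j = 1 | j = 2%:R].
    by case: j => [[|[|[|//]]] hj]; [apply: Or31|apply: Or32|apply: Or33]; apply: val_inj.
  by have [k0 k1 k2] := cross_kill E1 E2 E3; case: ej => ->.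
exists q' => //; have -> : (n + (Q + 2 - d) = Q.+1 + n.+1 - d)%N by lia.
exact: hq'.
Qed.
End PlaneCurveCount.

(** * Lines through a rational point *)

Lemma third_index (i j : 'I_3) : i != j ->
  exists l, [/\ l != i, l != j & forall x, x != i -> x != j -> x = l].
Proof.
rewrite -val_eqE /= => ij; have := ltn_ord i; have := ltn_ord j => hj hi.
have hl : (3 - i - j < 3)%N by lia.
exists (Ordinal hl); rewrite -!val_eqE /=; split; [lia|lia|].
move=> x; rewrite -!val_eqE /= => xi xj; apply: val_inj => /=; have := ltn_ord x; lia.
Qed.

Lemma sum_pair (R : comNzRingType) (i j l : 'I_3) (f : 'I_3 -> R) : i != j ->
  (forall x, x != i -> x != j -> x = l) -> f l = 0 -> \sum_x f x = f i + f j.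
Proof.
move=> ij hl fl; rewrite (bigD1 i) //= (bigD1 j) //=; last by rewrite eq_sym.
by rewrite big1 ?addr0 // => x /andP [xi xj]; rewrite (hl x).
Qed.

(** Once the third component is 0, the two orthogonality relations form a 2 by 2 system with nonzero
    determinant. *)
Lemma gradient_zero (L : fieldType) (i j l : 'I_3) (R P g : 'I_3 -> L) :
  R i * P j != R j * P i -> (forall x, x != i -> x != j -> x = l) ->
  \sum_x R x * g x = 0 -> \sum_x P x * g x = 0 -> g l = 0 -> forall x, g x = 0.
Proof.
move=> det hl; have ij : i != j by apply: contraNneq det => ->.
move=> eR eP gl; rewrite !(sum_pair (l := l) ij) ?gl ?mulr0 // in eR eP.
have nz : R i * P j - R j * P i != 0 by rewrite subr_eq0.
have gi : g i = 0.
  apply: (mulfI nz); rewrite mulr0.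
  transitivity (P j * (R i * g i + R j * g j) - R j * (P i * g i + P j * g j)); first by ring.
  by rewrite eR eP !mulr0 subr0.
have gj : g j = 0.
  apply: (mulfI nz); rewrite mulr0.
  transitivity (R i * (P i * g i + P j * g j) - P i * (R i * g i + R j * g j)); first by ring.
  by rewrite eR eP !mulr0 subr0.
move=> x; have [->//|xi] := eqVneq x i; have [->//|xj] := eqVneq x j.
by rewrite (hl x).
Qed.

Lemma linp_top (L : comNzRingType) (p : {mpoly L[3]}) d R P : p \is d.-homog ->
  has_top_coef d (line_poly p R P) p.@[P].
Proof. exact: (@top_mmap L 3 L idfun). Qed.

(** Along a line contained in the curve the gradient is orthogonal to R and P, so only its component
    [g l] matters. This is a form of degree d - 1 > 0 on the line and has a zero: at some R + s P
    or, if [g l] is a nonzero constant, at the point at infinity P, where the value is the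
    coefficient of t^(d-1). *)
Lemma line_not_in (L : closedFieldType) (F : {mpoly L[3]}) d R P : F \is d.-homog ->
  (1 < d)%N ->
  nonsingular F -> independent R P -> line_poly F R P != 0.
Proof.
move=> hF d1 smF [i [j det]]; apply/eqP => z.
have ij : i != j by apply: contraNneq det => ->.
have [l [li lj hl]] := third_index ij.
pose g x := line_poly (mderiv x F) R P.
have Fv s : F.@[fun x => R x + s * P x] = 0 by rewrite -linp_horner z horner0.
have eP : \sum_x (P x)%:P * g x = 0 by rewrite -linp_deriv z deriv0.
have eR : \sum_x (R x)%:P * g x = 0.
  have [//|/closed_nonroot [s]] := eqVneq (\sum_x (R x)%:P * g x) 0.
  rewrite -[_.[s]]/(horner_eval s _) raddf_sum; case/eqP.
  have := euler (fun x => R x + s * P x) hF; rewrite Fv mulr0 => e.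
  transitivity (\sum_x (R x + s * P x) * (mderiv x F).@[fun x => R x + s * P x] - s *
    (\sum_x (P x)%:P * g x).[s]).
    rewrite horner_sum mulr_sumr -sumrB; apply: eq_bigr => x _.
    by rewrite /= horner_evalE !hornerM !hornerC /g !linp_horner; ring.
  by rewrite e eP horner0 mulr0 subr0.
have nzv s : exists x, R x + s * P x != 0.
  have [/existsP //|/existsPn h] := boolP [exists x, R x + s * P x != 0].
  case/eqP: det; have e x : R x = - s * P x by apply/eqP; rewrite mulNr -subr_eq0 opprK;
    have := h x; rewrite negbK.
  by rewrite !e; ring.
have [[s /rootP hs]|noroot] : (exists s, root (g l) s) \/ (forall s, ~~ root (g l) s).
- have [s1|s1] := leqP (size (g l)) 1; last by left; apply: closed_root.
  have [gl0|gl0] := eqVneq (g l) 0; first by left; exists 0; rewrite gl0 root0.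
  right => s; have [c cnz ->] : exists2 c, c != 0 & g l = c%:P.
    by apply/size_poly1P; rewrite eqn_leq s1 size_poly_gt0.
  by rewrite rootC.
- have [x /eqP] := smF _ (Fv s) (nzv s); apply.
  apply: (gradient_zero (g := fun x => (mderiv x F).@[fun x => R x + s * P x]) det hl) => /=.
  + have := congr1 (horner^~ s) eR; rewrite /= horner_sum horner0 => e; rewrite -[RHS]e.
    by apply: eq_bigr => y _; rewrite hornerM hornerC linp_horner.
  + have := congr1 (horner^~ s) eP; rewrite /= horner_sum horner0 => e; rewrite -[RHS]e.
    by apply: eq_bigr => y _; rewrite hornerM hornerC linp_horner.
  by rewrite -linp_horner.
have FP : F.@[P] = 0 by have [_ <-] := linp_top R P hF; rewrite z coef0.
have Pnz : exists x, P x != 0.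
  have [Pi|Pi] := eqVneq (P i) 0; last by exists i.
  by exists j; apply: contraNneq det => Pj; rewrite Pi Pj !mulr0.
have tg x := linp_top R P (mderiv_homog x hF).
have gc x : (g x)`_d.-1 = (mderiv x F).@[P] by have [_ <-] := tg x.
have [x /eqP] := smF _ FP Pnz; apply.
apply: (gradient_zero (g := fun x => (mderiv x F).@[P]) det hl) => /=.
- have := congr1 (fun p : {poly L} => p`_d.-1) eR; rewrite /= coef_sum coef0 => e;
  rewrite -[RHS]e.
  by apply: eq_bigr => y _; rewrite coefCM gc.
- have := congr1 (fun p : {poly L} => p`_d.-1) eP; rewrite /= coef_sum coef0 => e;
  rewrite -[RHS]e.
  by apply: eq_bigr => y _; rewrite coefCM gc.
rewrite -gc nth_default //.
have [s1|s1] := leqP (size (g l)) 1; first by apply: leq_trans s1 _; lia.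
by have [s] := closed_root s1; rewrite (negbTE (noroot s)).
Qed.

Section LineCount.
Variables (k : finFieldType) (L : closedFieldType) (iota : {rmorphism k -> L}).
Variables (F0 : {mpoly k[3]}) (d : nat).
Let F : {mpoly L[3]} := map_mpoly iota F0.
Let Q := #|k|.
Hypothesis homF0 : F0 \is d.-homog.
Hypothesis d_gt1 : (1 < d)%N.
Hypothesis smF : nonsingular F.

Let vk (v : 'rV[k]_3) (i : 'I_3) : L := iota (v 0 i).
Let Vv : {set 'rV[k]_3} := [set v | (v != 0) && (F.@[vk v] == 0)].

Lemma card_cone : ((Q - 1) * #|curve_ratpts iota F0| <= #|Vv|)%N.
Proof.
pose A := setX (curve_ratpts iota F0) [set s : k | s != 0].
pose f (x : point k 2 * k) : 'rV[k]_3 := x.2 *: val x.1.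
have cA : #|A| = ((Q - 1) * #|curve_ratpts iota F0|)%N.
  rewrite cardsX mulnC; congr muln; rewrite -[RHS]/(Q - 1)%N.
  have -> : [set s : k | s != 0] = [set~ 0] by apply/setP => s; rewrite !inE.
  by rewrite cardsC1 subn1.
rewrite -cA -(card_in_imset (f := f)).
  apply: subset_leq_card; apply/subsetP => v /imsetP [[P s]];
    rewrite !inE /= => /andP [/eqP FP snz] ->.
  rewrite /f /=; have [i Pi] := coords_neq0 P; apply/andP; split.
    by apply: contraNneq Pi => /rowP /(_ i); rewrite !mxE => /eqP;
      rewrite mulf_eq0 (negbTE snz).
  rewrite -[F.@[_]]/(mmap idfun _ F) (@mmap_ext _ _ _ idfun idfun _ (fun i => iota s *
    ratpt_coords iota P i)) //.
    by rewrite (mmap_scale _ _ _ (homF iota homF0)) [mmap _ _ _]FP mulr0.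
  by move=> x; rewrite /vk mxE rmorphM.
move=> [P s] [P' s']; rewrite !inE /= => /andP [_ snz] /andP [_ s'nz] /rowP e.
have eP : P = P'.
  apply: (@coords_inj _ _ _ _ (s^-1 * s')) => i; have := e i; rewrite !mxE => h.
  by rewrite -mulrA -[s' * _]h mulKf.
subst P'; congr pair; have [i Pi] := coords_neq0 P.
by have := e i; rewrite !mxE => /(mulIf Pi).
Qed.

Lemma card_hyperplane i : (#|[set R : 'rV[k]_3 | (R 0 i == 0)%R]| <= Q ^ 2)%N.
Proof.
have <- : #|{: 'rV[k]_2}| = (Q ^ 2)%N by rewrite card_mx mul1n.
rewrite -(card_in_imset (f := fun R : 'rV[k]_3 => (col' i R : 'rV[k]_2)));
  first exact: max_card.
move=> R R'; rewrite !inE => /eqP Ri /eqP R'i /rowP e; apply/rowP => j.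
case: (unliftP i j) => [x ->|->]; last by rewrite Ri R'i.
by have := e x; rewrite !mxE.
Qed.

(** Counting the nonzero vectors of the cone, Q - 1 for each point, turns the lines through P0 into
    fibres of the linear projection along [p0]. On the fibre over R <> 0 the top coefficient F(P0)
    vanishes, which leaves at most d - 1 zeros; there are at most Q^2 - 1 such R, and dividing by Q
    - 1 leaves Q + 1. *)
Lemma line_count : curve_ratpts iota F0 != set0 -> (#|curve_ratpts iota F0| <= 1 + (Q + 1) *
  (d - 1))%N.
Proof.
case/set0Pn => P0; rewrite inE => /eqP FP0.
have [i [Pi _]] := coords_lead P0; pose p0 : 'rV[k]_3 := val P0.
have p0i : p0 0 i = 1 by exact: Pi.
pose phi (v : 'rV[k]_3) := v - v 0 i *: p0.
pose A := [set R : 'rV[k]_3 | R 0 i == 0].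
have phiA v : phi v \in A by rewrite inE !mxE p0i mulr1 subrr.
have fib R : R \in A -> (#|[set v in Vv | phi v == R]| <= if R == 0%R then Q - 1 else d - 1)%N.
  move=> RA; case: eqVneq => [->|Rnz].
    have <- : #|[set~ (0 : k)]| = (Q - 1)%N by rewrite cardsC1 subn1.
    rewrite -(card_in_imset (f := fun v : 'rV[k]_3 => v 0 i)).
      apply: subset_leq_card; apply/subsetP => s /imsetP [v];
        rewrite !inE => /andP [/andP [vnz _] /eqP pv] ->.
      apply: contraNneq vnz => vi; move: pv; rewrite /phi vi scale0r subr0 => ->; exact: eqxx.
    move=> v v'; rewrite !inE => /andP [_ /eqP pv] /andP [_ /eqP pv'] e.
    by move: pv pv'; rewrite /phi e => /subr0_eq h /subr0_eq h'; rewrite h.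
  have ind : independent (vk R) (ratpt_coords iota P0).
    have [j Rj] : exists j, R 0 j != 0.
      have [/existsP //|/existsPn h] := boolP [exists j, R 0 j != 0].
      by case/eqP: Rnz; apply/rowP => j; rewrite mxE; apply/eqP; have := h j; rewrite negbK.
    exists i, j; move: RA; rewrite inE /vk => /eqP ->; rewrite rmorph0 mul0r eq_sym.
    by apply: mulf_neq0; rewrite /ratpt_coords fmorph_eq0 // Pi oner_eq0.
  have pnz := line_not_in (homF iota homF0) d_gt1 smF ind.
  have [sp ep] := linp_top (vk R) (ratpt_coords iota P0) (homF iota homF0).
  have sp' : (size (line_poly F (vk R) (ratpt_coords iota P0)) <= d)%N.
    rewrite leqNgt; apply/negP => h.
    have sd : size (line_poly F (vk R) (ratpt_coords iota P0)) = d.+1 by apply/eqP;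
      rewrite eqn_leq sp h.
    by move: pnz; rewrite -lead_coef_eq0 lead_coefE sd /= ep FP0 eqxx.
  rewrite -ltnS; apply: leq_trans (_ : d <= (d - 1).+1)%N; last by lia.
  apply: leq_trans sp'; pose rs := [seq vk v i | v <- enum [set v in Vv | phi v == R]].
  have -> : #|[set v in Vv | phi v == R]| = size rs by rewrite size_map cardE.
  apply: max_poly_roots => //.
    apply/allP => s /mapP [v]; rewrite mem_enum !inE => /andP [/andP [_ /eqP Fv] /eqP pv] ->.
    apply/rootP; rewrite linp_horner -Fv; apply: mmap_ext => // j.
    rewrite -pv /vk !mxE rmorphB rmorphM /= addrC; exact: subrKC.
  rewrite map_inj_in_uniq ?enum_uniq // => v v';
    rewrite !mem_enum !inE => /andP [_ /eqP pv] /andP [_ /eqP pv'] /(fmorph_inj iota) e.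
  by move: pv'; rewrite -pv /phi e => /addIr.
have le : (#|Vv| <= \sum_(R in A) if R == 0%R then Q - 1 else d - 1)%N.
  rewrite -sum1_card (partition_big phi (mem A)) //=.
  apply: leq_sum => R RA; apply: leq_trans (fib R RA); rewrite -sum1_card.
  by apply: eq_leq; apply: eq_bigl => v; rewrite !inE.
have A0 : (0 : 'rV[k]_3) \in A by rewrite inE mxE.
have := leq_trans card_cone le; rewrite (bigD1 0) //= eqxx.
rewrite (eq_bigr (fun=> (d - 1)%N)); last by move=> R /andP [_ /negbTE ->].
rewrite sum_nat_const.
have -> : #|[pred R | (R \in A) && (R != 0%R)]| = (#|A| - 1)%N.
  rewrite (cardsD1 0 A) A0 addKn; apply: eq_card => R; by rewrite !inE andbC.
have := card_hyperplane i; rewrite -/A.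
have Q1 : (1 < Q)%N by apply: finNzRing_gt1.
move=> hA H; rewrite -(leq_pmul2l (_ : 0 < Q - 1)%N); last by rewrite subn_gt0.
apply: leq_trans H _; rewrite mulnDr muln1 leq_add2l mulnA leq_mul2r; apply/orP; right.
by apply: leq_trans (leq_sub2r 1 hA) _; rewrite -{2}[1%N](exp1n 2) subn_sqr.
Qed.
End LineCount.

(** * Invariance under isomorphism *)

Section FormComp.
Variables (L : fieldType) (n m : nat).

Definition form_comp (G : 'I_m.+1 -> {mpoly L[n.+1]}) (p : {mpoly L[m.+1]}) : {mpoly L[n.+1]} :=
  mmap (@mpolyC n.+1 L) G p.

Lemma fcomp_homog e f G p : (forall i, G i \is e.-homog) -> p \is f.-homog ->
  form_comp G p \is (e * f).-homog.
Proof.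
move=> hG /dhomogP hp; rewrite /form_comp /mmap big_seq; apply: rpred_sum => mu /hp hmu.
rewrite mul_mpolyC; apply: dhomogZ; rewrite -hmu /= mdegE big_distrr /= /mmap1.
elim: (index_enum _) => [|i r IH]; first by rewrite !big_nil; apply: dhomog1.
by rewrite !big_cons; apply: dhomogM => //; apply: dhomogMn.
Qed.

Lemma fcomp_eval (R : comNzRingType) (f : {rmorphism L -> R}) (v : 'I_n.+1 -> R) G p :
  mmap f v (form_comp G p) = mmap f (fun i => mmap f v (G i)) p.
Proof. by rewrite /form_comp mmap_comp; apply: mmap_ext => i //=; rewrite mmapC. Qed.

Lemma fcomp_evalp P G p : evalp (form_comp G p) P = p.@[fun i => evalp (G i) P].
Proof. exact: (fcomp_eval idfun). Qed.

End FormComp.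

Section LocalMorphism.
Variable L : closedFieldType.

(** Here the coefficients lie in L: the genus is geometric, and rationality of the forms matters
    only for counting points. *)
Definition local_forms n m (X : point L n -> Prop) (phi : point L n -> point L m) P e
    (G : 'I_m.+1 -> {mpoly L[n.+1]}) : Prop :=
  [/\ forall i, G i \is e.-homog, exists i, evalp (G i) P != 0 &
      forall Q, X Q -> (exists i, evalp (G i) Q != 0) ->
        exists c : L, forall i, evalp (G i) Q = c * coords (phi Q) i].

Definition is_morphism n m (X : point L n -> Prop) (Y : point L m -> Prop) phi : Prop :=
  (forall P, X P -> Y (phi P)) /\ (forall P, X P -> exists e G, local_forms X phi P e G).

Lemma local_scale n m (X : point L n -> Prop) (phi : point L n -> point L m) P e G Q :
  local_forms X phi P e G -> X Q -> (exists i, evalp (G i) Q != 0) ->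
  exists c, c != 0 /\ forall i, evalp (G i) Q = c * coords (phi Q) i.
Proof.
move=> [_ _ H] XQ nz; have [c hc] := H Q XQ nz; exists c; split=> //.
by have [i] := nz; rewrite hc; apply: contraNneq => ->; rewrite mul0r.
Qed.

Lemma local_eval n m (X : point L n -> Prop) (phi : point L n -> point L m) P e G Q :
  local_forms X phi P e G -> X Q ->
  (forall i, evalp (G i) Q = 0) \/ exists c, c != 0 /\ forall f p, p \is f.-homog ->
     evalp (form_comp G p) Q = c ^+ f * evalp p (phi Q).
Proof.
move=> hG XQ; have [/existsP nz|/existsPn h] := boolP [exists i, evalp (G i) Q != 0];
  last first.
  by left=> i; apply/eqP; have := h i; rewrite negbK.
right; have [c [cnz hc]] := local_scale hG XQ nz; exists c; split=> // f p hp.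
rewrite fcomp_evalp /evalp -(meval_scale _ _ hp); apply: mmap_ext => // i; exact: hc.
Qed.

Section Transport.
Variables (n m : nat) (X : point L n -> Prop) (Y : point L m -> Prop).
Variables (phi : point L n -> point L m) (psi : point L m -> point L n).
Hypotheses (phiP : is_morphism X Y phi) (psiP : is_morphism Y X psi).
Hypotheses (phiK : forall P, X P -> psi (phi P) = P) (psiK : forall Q, Y Q -> phi (psi Q) = Q).
Variable K : function_field X.
Local Notation emb := (@ff_emb _ _ _ K).
Local Notation gen := (@ff_gen _ _ _ K).

Lemma gen_vanish e (p : {mpoly L[n.+1]}) : p \is e.-homog ->
  (mmap emb gen p = 0 <-> forall P, X P -> evalp p P = 0).
Proof. by move=> hp; rewrite -mmap_meval; apply: (@ff_genP _ _ _ K p); exists e. Qed.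

Lemma gen_neq0 e (p : {mpoly L[n.+1]}) P : p \is e.-homog -> X P -> evalp p P != 0 ->
  mmap emb gen p != 0.
Proof. by move=> hp XP; apply: contraNneq => /(gen_vanish hp)/(_ P XP) ->. Qed.

Lemma genX_neq0 P : X P -> exists i, gen i != 0.
Proof.
move=> XP; have [i Pi] := coords_neq0 P; exists i.
have hX : 'X_i \is [in L[n.+1], 1.-homog] by rewrite dhomogX /= mdeg1.
have := @gen_neq0 1%N 'X_i P hX XP; rewrite mmapX mmap1U; apply.
by rewrite /evalp mevalXU.
Qed.

Variables (P0 : point L n) (e0 : nat) (G0 : 'I_m.+1 -> {mpoly L[n.+1]}).
Hypothesis XP0 : X P0.
Hypothesis loc0 : local_forms X phi P0 e0 G0.

(** The function field is kept; the image of the generic point of X under one fixed local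
    description serves as generic point of Y. *)
Definition gen' (i : 'I_m.+1) : K := mmap emb gen (G0 i).

(** Two local descriptions have proportional values at every point of X, including those where one
    of them vanishes identically, so their cross products vanish at the generic point. *)
Lemma gen'_local P e G : X P -> local_forms X phi P e G ->
  exists mu, mu != 0 /\ forall i, gen' i = mu * mmap emb gen (G i).
Proof.
move=> XP locG; have [hG0 [i0 hi0] _] := loc0; have [hG [i hi] _] := locG.
have Gi := gen_neq0 (hG i) XP hi; have G0i := gen_neq0 (hG0 i0) XP0 hi0.
have cross a b : gen' a * mmap emb gen (G b) = gen' b * mmap emb gen (G a).
  apply/eqP; rewrite -subr_eq0 -!mmapMul -raddfB /=; apply/eqP.
  have hh : G0 a * G b - G0 b * G a \is (e0 + e).-homog.
    by apply: (rpredB (dhomogM (hG0 a) (hG b)) (dhomogM (hG0 b) (hG a))).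
  apply/(gen_vanish hh) => Q XQ; rewrite /evalp mevalB !mevalM -!/(evalp _ _).
  have [/existsP nz|/existsPn h] := boolP [exists i, evalp (G i) Q != 0]; last first.
    have z j : evalp (G j) Q = 0 by apply/eqP; have := h j; rewrite negbK.
    by rewrite !z !mulr0 subrr.
  have [/existsP nz0|/existsPn h0] := boolP [exists i, evalp (G0 i) Q != 0]; last first.
    have z j : evalp (G0 j) Q = 0 by apply/eqP; have := h0 j; rewrite negbK.
    by rewrite !z !mul0r subrr.
  have [c [_ hc]] := local_scale locG XQ nz; have [c0 [_ hc0]] := local_scale loc0 XQ nz0.
  by rewrite !hc !hc0; ring.
exists (gen' i / mmap emb gen (G i)); split.
  rewrite mulf_neq0 ?invr_eq0 //; apply: contraNneq G0i => z.
  by have /eqP := cross i0 i; rewrite z mul0r mulf_eq0 (negbTE Gi) orbF.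
by move=> j; rewrite mulrAC -cross mulfK.
Qed.

(** Up to a scalar, psi sends the new generic point back to the old one, because psi (phi Q) = Q on
    X. *)
Lemma gen_local R e G : Y R -> local_forms Y psi R e G ->
  exists mu, mu != 0 /\ forall i, gen i = mu * mmap emb gen' (G i).
Proof.
move=> YR locG; have [hG0 [l hl] _] := loc0; have [hG [i hi] _] := locG.
have XP : X (psi R) by apply: (proj1 psiP).
have [eP [GP locP]] := proj2 phiP _ XP.
(* The factor G0 l removes the common zeros of G0, where nothing is known. *)
have G0l := gen_neq0 (hG0 l) XP0 hl.
have hc j : form_comp G0 (G j) \is (e0 * e).-homog by apply: fcomp_homog.
have ec j : mmap emb gen' (G j) = mmap emb gen (form_comp G0 (G j)) by rewrite fcomp_eval.
have hXj (j : 'I_n.+1) : 'X_j \is [in L[n.+1], 1.-homog] by rewrite dhomogX /= mdeg1.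
have eX j : mmap emb gen 'X_j = gen j by rewrite mmapX mmap1U.
have cross a b : mmap emb gen' (G a) * gen b = mmap emb gen' (G b) * gen a.
  apply/eqP; rewrite -subr_eq0 !ec -!eX -!mmapMul -raddfB /=.
  have hh : form_comp G0 (G a) * 'X_b - form_comp G0 (G b) * 'X_a \is (e0 * e + 1).-homog.
    by apply: (rpredB (dhomogM (hc a) (hXj b)) (dhomogM (hc b) (hXj a))).
  suff : mmap emb gen ((form_comp G0 (G a) * 'X_b - form_comp G0 (G b) * 'X_a) * G0 l) == 0.
    by rewrite mmapMul mulf_eq0 (negbTE G0l) orbF.
  apply/eqP/(gen_vanish (dhomogM hh (hG0 l))) => Q XQ.
  have [z|[c [cnz hcQ]]] := local_eval loc0 XQ; first by rewrite /evalp mevalM [(G0 l).@[_]]z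
    mulr0.
  rewrite /evalp mevalM mevalB !mevalM !mevalXU -!/(evalp _ _) !(hcQ _ _ (hG _)).
  have YQ : Y (phi Q) by apply: (proj1 phiP).
  have [/existsP nz|/existsPn h] := boolP [exists i, evalp (G i) (phi Q) != 0]; last first.
    have z j : evalp (G j) (phi Q) = 0 by apply/eqP; have := h j; rewrite negbK.
    by rewrite !z !mulr0 !mul0r subrr mul0r.
  have [c' [_ hc']] := local_scale locG YQ nz.
  by rewrite !hc' !phiK //; ring.
have Gi : mmap emb gen' (G i) != 0.
  have [mu [munz hmu]] := gen'_local XP locP.
  rewrite (@mmap_ext _ _ _ _ emb gen' (fun j => mu * mmap emb gen (GP j))) // (mmap_scale _ _ _
    (hG i)).
  rewrite mulf_neq0 ?expf_neq0 // -fcomp_eval.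
  have [hGP nzP _] := locP.
  apply: (gen_neq0 (fcomp_homog hGP (hG i)) XP).
  have [z|[c [cnz hcQ]]] := local_eval locP XP; first by have [j] := nzP; rewrite z eqxx.
  by rewrite (hcQ _ _ (hG i)) psiK // mulf_neq0 // expf_neq0.
have [j gj] := genX_neq0 XP0.
exists (gen i / mmap emb gen' (G i)); split.
  rewrite mulf_neq0 ?invr_eq0 //; apply: contraNneq gj => z.
  by have /eqP := cross i j; rewrite z mulr0 mulf_eq0 (negbTE Gi).
by move=> x; rewrite mulrAC [gen i * _]mulrC -cross mulrAC divff // mul1r.
Qed.

Lemma transport_genP (p : {mpoly L[m.+1]}) : homogeneous p ->
  ((map_mpoly emb p).@[gen'] = 0 <-> forall Q, Y Q -> evalp p Q = 0).
Proof.
move=> [f hp]; rewrite mmap_meval; have [hG0 [l hl] _] := loc0.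
have G0l := gen_neq0 (hG0 l) XP0 hl; split=> [h R YR|h].
  have XP : X (psi R) by apply: (proj1 psiP).
  have [eP [GP locP]] := proj2 phiP _ XP; have [hGP nzP _] := locP.
  have [mu [munz hmu]] := gen'_local XP locP.
  have : mmap emb gen (form_comp GP p) = 0.
    apply/eqP; rewrite fcomp_eval; apply/eqP/(mulfI (expf_neq0 f munz)).
    by rewrite mulr0 -(mmap_scale _ _ _ hp) -[RHS]h; apply: mmap_ext.
  move/(gen_vanish (fcomp_homog hGP hp))/(_ _ XP).
  have [z|[c [cnz hc]]] := local_eval locP XP; first by have [j] := nzP; rewrite z eqxx.
  by rewrite (hc _ _ hp) psiK // => /eqP; rewrite mulf_eq0 expf_eq0 (negbTE cnz) andbF orFb
    => /eqP.
suff : mmap emb gen (form_comp G0 p * G0 l) == 0.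
  by rewrite mmapMul mulf_eq0 (negbTE G0l) orbF fcomp_eval => /eqP.
apply/eqP/(gen_vanish (dhomogM (fcomp_homog hG0 hp) (hG0 l))) => Q XQ;
  rewrite /evalp mevalM -!/(evalp _ _).
have [z|[c [cnz hc]]] := local_eval loc0 XQ; first by rewrite z mulr0.
by rewrite (hc _ _ hp) h ?mulr0 ?mul0r //; apply: (proj1 phiP).
Qed.

Lemma transport_quotient R e G f (A B : {mpoly L[n.+1]}) : Y R -> local_forms Y psi R e G ->
  A \is f.-homog -> B \is f.-homog -> mmap emb gen B != 0 ->
  mmap emb gen' (form_comp G B) != 0 /\
  mmap emb gen A / mmap emb gen B = mmap emb gen' (form_comp G A) / mmap emb gen' (form_comp G
    B).
Proof.
move=> YR locG hA hB; have [mu [munz hmu]] := gen_local YR locG.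
have E p : p \is f.-homog -> mmap emb gen p = mu ^+ f * mmap emb gen' (form_comp G p).
  by move=> hp; rewrite fcomp_eval -(mmap_scale _ _ _ hp); apply: mmap_ext.
rewrite !E // mulf_eq0 negb_or => /andP [mn Bn]; split=> //.
by rewrite -mulf_div divff // mul1r.
Qed.

Lemma transport_fracP (f : K) : exists e (G H : {mpoly L[m.+1]}),
  [/\ G \is e.-homog, H \is e.-homog, (map_mpoly emb H).@[gen'] != 0 &
      f = (map_mpoly emb G).@[gen'] / (map_mpoly emb H).@[gen']].
Proof.
have [e [A [B [hA hB]]]] := @ff_fracP _ _ _ K f; rewrite !mmap_meval => Bn ->.
have YR : Y (phi P0) by apply: (proj1 phiP).
have [e' [G locG]] := proj2 psiP _ YR.
have [Bn' ->] := transport_quotient YR locG hA hB Bn; have [hG _ _] := locG.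
exists (e' * e)%N, (form_comp G A), (form_comp G B); rewrite !mmap_meval.
by split; [exact: fcomp_homog|exact: fcomp_homog|exact: Bn'|].
Qed.

Definition transport_field : function_field Y :=
  FunctionField transport_genP transport_fracP.

Lemma regular_transport P (f : K) : X P ->
  (@regular_at _ _ _ transport_field (phi P) f <-> @regular_at _ _ _ K P f).
Proof.
move=> XP; split=> [[e [A [B [hA hB BP]]]]|[e [A [B [hA hB BP]]]]].
  rewrite !mmap_meval /= => ->; have [eP [GP locP]] := proj2 phiP _ XP.
  have [hGP nzP _] := locP; have [mu [munz hmu]] := gen'_local XP locP.
  exists (eP * e)%N, (form_comp GP A), (form_comp GP B); rewrite !mmap_meval.
  split; [exact: fcomp_homog|exact: fcomp_homog| |].
    have [z|[c [cnz hc]]] := local_eval locP XP; first by have [j] := nzP; rewrite z eqxx.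
    by rewrite (hc _ _ hB) mulf_neq0 // expf_neq0.
  have E p : p \is e.-homog -> mmap emb gen' p = mu ^+ e * mmap emb gen (form_comp GP p).
    by move=> hp; rewrite fcomp_eval -(mmap_scale _ _ _ hp); apply: mmap_ext.
  by rewrite !E // -mulf_div divff ?mul1r // expf_neq0.
rewrite !mmap_meval => ->.
have Bn := gen_neq0 hB XP BP; have YR : Y (phi P) by apply: (proj1 phiP).
have [e' [G locG]] := proj2 psiP _ YR; have [hG nzG _] := locG.
have [Bn' ->] := transport_quotient YR locG hA hB Bn.
exists (e' * e)%N, (form_comp G A), (form_comp G B); rewrite !mmap_meval.
split; [exact: fcomp_homog|exact: fcomp_homog| |by []].
have [z|[c [cnz hc]]] := local_eval locG YR; first by have [j] := nzG; rewrite z eqxx.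
by rewrite (hc _ _ hB) phiK // mulf_neq0 // expf_neq0.
Qed.

End Transport.

Lemma genus_transport n m (X : point L n -> Prop) (Y : point L m -> Prop) phi psi g :
  is_morphism X Y phi -> is_morphism Y X psi ->
  (forall P, X P -> psi (phi P) = P) -> (forall Q, Y Q -> phi (psi Q) = Q) ->
  (exists P, X P) -> has_genus X g -> has_genus Y g.
Proof.
move=> phiP psiP phiK psiK [P0 XP0] [K [b [Hb Hspan Hfree]]].
have [e0 [G0 loc0]] := proj2 phiP _ XP0.
pose K' := transport_field phiP psiP phiK psiK K XP0 loc0.
have hreg P (f : K) : X P -> (@regular_at _ _ _ K' (phi P) f <-> @regular_at _ _ _ K P f).
  exact: regular_transport.
have hreg' Q (f : K) : Y Q -> (@regular_at _ _ _ K' Q f <-> @regular_at _ _ _ K (psi Q) f).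
  by move=> YQ; rewrite -hreg ?psiK //; apply: (proj1 psiP).
have rep r : @repartition _ _ _ K r -> @repartition _ _ _ K' (fun Q => r (psi Q)).
  move=> [s hs]; exists (map phi s) => Q YQ Qs; apply/hreg' => //; apply: hs;
    first exact: (proj1 psiP).
  by apply: contra Qs => h; apply/mapP; exists (psi Q); rewrite ?psiK.
have rep' r : @repartition _ _ _ K' r -> @repartition _ _ _ K (fun P => r (phi P)).
  move=> [s hs]; exists (map psi s) => P XP Ps; apply/hreg => //; apply: hs;
    first exact: (proj1 phiP).
  by apply: contra Ps => h; apply/mapP; exists (phi P); rewrite ?phiK.
exists K', (fun i Q => b i (psi Q)); split.
- by move=> i; apply: rep.
- move=> r /rep' /Hspan [c [f hf]]; exists c, f => Q YQ; apply/hreg' => //.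
  by have := hf (psi Q) (proj1 psiP _ YQ); rewrite psiK.
move=> c [f hf]; apply: Hfree; exists f => P XP; apply/hreg => //.
by have := hf (phi P) (proj1 phiP _ XP); rewrite phiK.
Qed.

End LocalMorphism.

Section RationalTransport.
Variables (k : finFieldType) (L : closedFieldType) (iota : {rmorphism k -> L}).

Lemma embed_normalized n (P : point k n) : normalized (map_mx iota (val P)).
Proof.
case/existsP: (valP P) => i /andP [/eqP h /forallP H]; apply/existsP; exists i.
rewrite mxE h rmorph1 eqxx; apply/forallP => j; apply/implyP => ji.
by have := H j; rewrite ji => /eqP hj; rewrite mxE hj rmorph0.
Qed.

Definition embed n (P : point k n) : point L n :=
  exist (fun x => normalized x) _ (embed_normalized P).

Lemma coords_embed n (P : point k n) i : coords (embed P) i = iota (coords P i).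
Proof. by rewrite /coords mxE. Qed.

Lemma evalp_embed n (P : point k n) p : evalp (map_mpoly iota p) (embed P) = iota (evalp p P).
Proof.
rewrite /evalp [LHS]mmap_meval -[in RHS]/(mmap idfun (coords P) p) mmap_comp.
by apply: mmap_ext => // i; rewrite coords_embed.
Qed.

Lemma embed_inj n : injective (@embed n).
Proof.
move=> P Q e; apply: coords_ext => i; apply: (fmorph_inj iota).
by rewrite -!coords_embed e.
Qed.

Lemma mem_rational n (gens : seq {mpoly k[n.+1]}) P : (P \in rational_points gens) <->
  zeros iota gens (embed P).
Proof.
rewrite inE; split=> [/allP h p hp|h].
  by rewrite evalp_embed (eqP (h p hp)) rmorph0.
apply/allP => p hp; have /eqP := h p hp; rewrite evalp_embed fmorph_eq0 //.
Qed.

Lemma morphism_over_is n m (gX : seq {mpoly k[n.+1]}) (gY : seq {mpoly k[m.+1]}) phi :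
  morphism_over iota gX gY phi -> is_morphism (zeros iota gX) (zeros iota gY) phi.
Proof.
move=> [h1 h2]; split=> // P XP; have [e [G [hG hP hQ]]] := h2 P XP.
by exists e, (fun i => map_mpoly iota (G i)); split=> // i; apply: map_mpoly_homog.
Qed.

(** The local forms have coefficients in k, so rational points have rational images, and [psi] makes
    this injective. The point [D] is a default value outside X. *)
Lemma morphism_rational n m (gX : seq {mpoly k[n.+1]}) (gY : seq {mpoly k[m.+1]}) phi psi :
  morphism_over iota gX gY phi -> (forall P, zeros iota gX P -> psi (phi P) = P) ->
  (#|rational_points gX| <= #|rational_points gY|)%N.
Proof.
move=> [h1 h2] phiK.
have [D _] : exists D : point k m, True.
  by have [|D _] := @point_of k m (fun=> 1); [exists 0; apply: oner_neq0|exists D].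
have /fin_all_exists [f Hf] : forall P, exists Q, P \in rational_points gX ->
    Q \in rational_points gY /\ embed Q = phi (embed P).
  move=> P; have [PX|nPX] := boolP (P \in rational_points gX); last by exists D.
  have XP := iffLR (mem_rational gX P) PX; have [e [G [hG [i hi] hQ]]] := h2 _ XP.
  have [c hc] := hQ _ XP (ex_intro _ i hi).
  have [|Q [s [snz hs]]] := @point_of k m (fun i => evalp (G i) P).
    by exists i; move: hi; rewrite evalp_embed fmorph_eq0.
  exists Q => _; have e1 : embed Q = phi (embed P).
    apply: (@coords_inj _ _ _ _ (c / iota s)) => j; rewrite mulrAC -hc evalp_embed hs rmorphM.
    by rewrite mulrAC divff ?mul1r ?coords_embed // fmorph_eq0.
  by split=> //; apply/mem_rational; rewrite e1; apply: h1.
rewrite -(card_in_imset (f := f)).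
  by apply: subset_leq_card; apply/subsetP => Q /imsetP [P PX ->]; have [] := Hf P PX.
move=> P P' PX P'X e; apply: embed_inj.
rewrite -(phiK _ (iffLR (mem_rational gX P) PX)) -(phiK _ (iffLR (mem_rational gX P') P'X)).
by have [_ <-] := Hf _ PX; have [_ <-] := Hf _ P'X; rewrite e.
Qed.

End RationalTransport.

(** * The degree of a plane maximal curve *)

(** At d = q + 2 the left side exceeds the right by q^2 - q - 1 > 0, and the excess grows with d. *)
Lemma line_arith q d : (1 < q)%N -> (3 <= d)%N ->
  (1 + q ^ 2 + q * ((d - 1) * (d - 2)) <= 1 + (q ^ 2 + 1) * (d - 1))%N -> (d <= q + 1)%N.
Proof.
move=> q1 d3 h; rewrite leqNgt; apply/negP => hd.
have [D eD] : exists D, d = (q + 2 + D)%N by exists (d - (q + 2))%N; lia.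
have e1 : (d - 1 = q + 1 + D)%N by lia.
have e2 : (d - 2 = q + D)%N by lia.
by move: h; rewrite e1 e2 expnS expn1; nia.
Qed.

(** The right side minus the left side factors as (q + 1)(d - 1)(d - q - 1). *)
Lemma nonclassical_arith q d : (3 <= d)%N -> (d <= q + 1)%N ->
  (d * (q ^ 2 + 2 - d) <= 1 + q ^ 2 + q * ((d - 1) * (d - 2)))%N -> d = q.+1.
Proof.
move=> d3 dq h; apply/eqP; rewrite eqn_leq -addn1 dq /= leqNgt; apply/negP => hd.
have [e ee] : exists e, d = (3 + e)%N by exists (d - 3)%N; lia.
have [E eE] : exists E, q = (d + E)%N by exists (q - d)%N; lia.
have e1 : (d - 1 = 2 + e)%N by lia.
have e2 : (d - 2 = 1 + e)%N by lia.
have [X eX] : exists X, (q ^ 2 + 2 = X + d)%N by exists (q ^ 2 + 2 - d)%N;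
  rewrite subnK // expnS expn1; nia.
by move: h; rewrite eX addnK e1 e2; move: eX; rewrite eE ee expnS expn1; nia.
Qed.

(** Both d q^2 - 2 q^2 and d (d - 1) - 2 = (d - 2)(d + 1) are divisible by d - 2; cancelling it
    leaves 2q(d - 1) <= q^2 + d + 1. *)
Lemma classical_arith q d : (1 < q)%N -> (3 <= d)%N ->
  (2 * (1 + q ^ 2 + q * ((d - 1) * (d - 2))) <= d * (q ^ 2 + d.-1))%N ->
  ((2 * q - 1) * d <= (q + 1) ^ 2)%N.
Proof.
move=> q1 d3 h.
have [e ee] : exists e, d = (3 + e)%N by exists (d - 3)%N; lia.
have e1 : (d - 1 = 2 + e)%N by lia.
have e2 : (d - 2 = 1 + e)%N by lia.
have e3 : (d.-1 = 2 + e)%N by lia.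
rewrite -(leq_pmul2l (_ : 0 < d - 2)%N); last by lia.
move: h; rewrite e1 e2 e3 ee -!mulnn.
have [r er] : exists r, q = (1 + r)%N by exists (q - 1)%N; lia.
have -> : (2 * q - 1 = 1 + 2 * r)%N by lia.
by rewrite er; nia.
Qed.

Section PlaneMaximal.
Variables (k : finFieldType) (L : closedFieldType) (iota : {rmorphism k -> L}).
Variables (F0 : {mpoly k[3]}) (d : nat).
Hypothesis homF0 : F0 \is d.-homog.
Hypothesis curve : projective_curve iota [:: F0].
Let F : {mpoly L[3]} := map_mpoly iota F0.

Lemma zerosP P : zeros iota [:: F0] P <-> evalp F P = 0.
Proof.
split=> [h|h p]; first by apply: h; rewrite mem_head.
by rewrite inE => /eqP ->.
Qed.

Lemma zeros_nonempty : exists P, zeros iota [:: F0] P.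
Proof. by have [_ [_ h _] _ _] := curve. Qed.

Lemma plane_nonsingular : nonsingular F.
Proof.
move=> v Fv /point_of [P [s [snz hs]]].
have hF : F \is d.-homog := map_mpoly_homog iota homF0.
have scal e (p : {mpoly L[3]}) : p \is e.-homog -> p.@[v] = s ^+ e * evalp p P.
  by move=> hp; rewrite -(meval_scale _ _ hp); apply: mmap_ext.
have FP : evalp F P = 0.
  by apply/eqP; move/eqP: Fv; rewrite (scal _ _ hF) mulf_eq0 expf_eq0 (negbTE snz) andbF.
have [_ _ _ /(_ P (iffRL (zerosP P) FP)) [rk]] := curve.
have [/existsP [i hi]|/existsPn h] := boolP [exists i, evalp (mderiv i F) P != 0].
  exists i; rewrite (scal d.-1); last exact: mderiv_homog.
  by rewrite mulf_neq0 // expf_neq0.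
have z : jacobian iota [:: F0] P = 0.
  apply/matrixP => j i; have := h i; rewrite negbK => /eqP e.
  by rewrite mxE [RHS]mxE ord1 -[RHS]e.
by move: rk; rewrite z mxrank0.
Qed.

Lemma plane_degree_gt0 : (0 < d)%N.
Proof.
have [P /zerosP FP] := zeros_nonempty; have [i hi] := plane_nonsingular FP (coords_neq0 P).
rewrite lt0n; apply: contraNneq hi => d0.
have /dhomogP h := map_mpoly_homog iota homF0; rewrite d0 in h.
have -> : mderiv i F = 0.
  apply/mpolyP => m; rewrite mcoeff_deriv mcoeff0.
  have [/h|] := boolP ((m + U_(i))%MM \in msupp F); first by rewrite /= mdegD mdeg1 addn1.
  by rewrite mcoeff_msupp negbK => /eqP ->; rewrite mul0rn.
by rewrite meval0.
Qed.

Lemma plane_curve_genus g : has_genus (zeros iota [:: F0]) g -> (2 * g = (d - 1) * (d - 2))%N.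
Proof.
move=> hg; have d0 := plane_degree_gt0.
have -> := plane_genus (map_mpoly_homog iota homF0) d0 plane_nonsingular zerosP hg.
have twice n : (2 * 'C(n, 2) = n * (n - 1))%N.
  by elim: n => [|n IH]; rewrite ?bin0n // binS bin1; nia.
by rewrite twice; congr muln; lia.
Qed.

Lemma rational_ratpts : rational_points [:: F0] = curve_ratpts iota F0.
Proof. by apply/setP => P; rewrite !inE /= andbT F_pvk. Qed.

Lemma plane_maximal_degree q g : #|k| = (q ^ 2)%N -> (3 <= d)%N ->
  has_genus (zeros iota [:: F0]) g ->
  #|rational_points [:: F0]| = (1 + q ^ 2 + 2 * q * g)%N ->
  d = q.+1 \/ ((2 * q - 1) * d <= (q + 1) ^ 2)%N.
Proof.
move=> hk d3 hg hN; have g2 := plane_curve_genus hg; rewrite rational_ratpts in hN.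
have d0 := plane_degree_gt0.
have hN' : #|curve_ratpts iota F0| = (1 + q ^ 2 + q * ((d - 1) * (d - 2)))%N by rewrite hN -g2;
  lia.
have q1 : (1 < q)%N.
  by have := finNzRing_gt1 k; rewrite hk; case: q {hk hN hN'} => [|[|]].
have dq : (d <= q + 1)%N.
  have ne : curve_ratpts iota F0 != set0 by rewrite -card_gt0 hN.
  have := line_count homF0 (ltnW d3) plane_nonsingular ne; rewrite hN' hk.
  exact: line_arith.
(* The function field on which the case distinction is made is the one supplied by the genus
   hypothesis. *)
have [K _] := hg.
have [H0|H0] := eqVneq (mmap (ff_emb K) (@ff_gen _ _ _ K) (frobenius_form iota F0)) 0.
  left.
  have := nonclassical_count homF0 d0 plane_nonsingular zerosP zeros_nonempty H0.
  rewrite hk => /(_ _) h; have {h} : (d * (q ^ 2 + 2 - d) <= #|curve_ratpts iota F0|)%N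
    by apply: h; nia.
  rewrite hN' => h; exact: nonclassical_arith.
right; have := classical_count homF0 d0 plane_nonsingular zerosP H0; rewrite hN' hk => h.
exact: classical_arith.
Qed.

End PlaneMaximal.

Local Close Scope ring_scope.

(** The inequality 2 (q + 1)^2 < (q + 3)(2q - 1) amounts to q > 5 and gives 2d < q + 3. For smaller
    q the integer part of (q + 1)^2 / (2q - 1) is 3 if q = 2, 3, 4 and exactly 4 if q = 5. *)
Lemma degree_bound q d : prime_power q -> (3 <= d)%N ->
  d = q.+1 \/ ((2 * q - 1) * d <= (q + 1) ^ 2)%N ->
  (q = 2 -> d = q.+1) /\ (q <> 2 -> d = q.+1 \/ (d <= d2 q)%N).
Proof.
move=> [p [e [pp e0 eq]]] d3 h.
have q1 : (1 < q)%N by rewrite eq -(exp1n e) ltn_exp2r // prime_gt1.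
have [->|h'] := h; first by split=> _ //; left.
split=> [q2|q2]; first by move: h'; rewrite q2; lia.
right; rewrite /d2; case: eqP => [q3|q3]; first by move: h'; rewrite q3; lia.
case: eqP => [q5|q5]; first by move: h'; rewrite q5; lia.
rewrite leq_divRL //.
have [q4|q4] := eqVneq q 4; first by move: h'; rewrite q4; lia.
have [r er] : exists r, q = (6 + r)%N by exists (q - 6)%N; lia.
rewrite leqNgt; apply/negP => hd; move: h'; rewrite expnS expn1.
have -> : (2 * q - 1 = 11 + 2 * r)%N by lia.
by rewrite er in hd *; nia.
Qed.

(** The left ends of the intervals are the genera in degree (q + 2)/2 for q even and (q + 1)/2 for q
    odd, while degree q + 1 has genus q(q - 1)/2, beyond both right ends. *)
Lemma genus_gap_contra q d g : prime_power q -> (3 <= d)%N -> (2 * g = (d - 1) * (d - 2))%N ->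
  q <> 3 -> q <> 5 -> in_genus_gap q g ->
  (q = 2 -> d = q.+1) /\ (q <> 2 -> d = q.+1 \/ (d <= d2 q)%N) -> False.
Proof.
move=> [p [e [pp e0 eq]]] d3 g2 q3 q5 gap hd.
have q1 : (1 < q)%N by rewrite eq -(exp1n e) ltn_exp2r // prime_gt1.
have {}hd : d = q.+1 \/ (2 * d <= q + 2)%N.
  have [q2|q2] := eqVneq q 2; first by left; apply: (proj1 hd).
  have [|h|h] := proj2 hd; [exact/eqP|by left|right].
  move: h; rewrite /d2; case: eqP => // _; case: eqP => // _.
  by rewrite leq_divRL // mulnC.
have hodd : if odd q then (q ^ 2 + 3 < 8 * g + 4 * q)%N /\ (4 * g + 2 * q <= q ^ 2 + 1)%N
   else (q ^ 2 < 8 * g + 2 * q)%N /\ (4 * g + 2 * q <= q ^ 2)%N.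
  move: gap; rewrite /in_genus_gap; case: (odd q) => /andP [h1 h2].
    split.
      by rewrite -(ltr_nat rat) -mulnn !natrD !natrM; lra.
    by rewrite -(ler_nat rat) -mulnn !natrD !natrM; lra.
  split.
    by rewrite -(ltr_nat rat) -mulnn !natrD !natrM; lra.
  by rewrite -(ler_nat rat) -mulnn !natrD !natrM; lra.
have [D eD] : exists D, d = (3 + D)%N by exists (d - 3)%N; lia.
have e1 : (d - 1 = 2 + D)%N by lia.
have e2 : (d - 2 = 1 + D)%N by lia.
move: g2 hodd; rewrite e1 e2 -!mulnn => g2.
have hq1 : d = q.+1 -> (4 * g + 2 * q <= q * q + 1)%N -> False.
  move=> hd'; have eq' : q = (2 + D)%N by lia.
  by rewrite eq'; nia.
case: ifP => oq [h1 h2].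
  case: hd => hd; first exact: hq1.
  (* For q odd, parity sharpens 2d <= q + 2 to 2d <= q + 1. *)
  have [E eE] : exists E, q = (5 + 2 * D + E)%N.
    exists (q - (5 + 2 * D))%N; have : odd (q + 2) by rewrite oddD oq.
    by move: hd; rewrite eD; lia.
  by move: g2 h1; rewrite eE; nia.
case: hd => hd; first by apply: hq1 => //; apply: leq_trans h2 _; apply: leq_addr.
have [E eE] : exists E, q = (4 + 2 * D + E)%N by exists (q - (4 + 2 * D))%N; lia.
by move: g2 h1; rewrite eE; nia.
Qed.

Theorem corollary2p3 (q : nat) (hq : prime_power q)
    (k : finFieldType) (hk : #|k| = (q ^ 2)%N)
    (L : closedFieldType) (iota : {rmorphism k -> L})
    (hL : forall x : L, algebraicOver iota x) :
  (forall (d : nat) (F : {mpoly k[3]}), (3 <= d)%N ->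
     plane_maximal_curve iota q d F ->
     (q = 2 -> d = q.+1) /\ (q <> 2 -> d = q.+1 \/ (d <= d2 q)%N)) /\
  (q <> 3 -> q <> 5 ->
     forall (n : nat) (gens : seq {mpoly k[n.+1]}) (g : nat),
       maximal_curve iota q gens g -> in_genus_gap q g ->
       ~ has_nonsingular_plane_model iota gens).
Proof.
have main d (F : {mpoly k[3]}) g : (3 <= d)%N -> F \is d.-homog -> maximal_curve iota q [:: F] g ->
    (q = 2 -> d = q.+1) /\ (q <> 2 -> d = q.+1 \/ (d <= d2 q)%N).
  move=> d3 hF [curve hg hN]; apply: degree_bound => //.
  exact: (plane_maximal_degree hF curve hk d3 hg hN).
split=> [d F d3 [hF [g hmax]]|q3 q5 n gens g [[_ [_ [P0 XP0] _] _ _] hg hN] gap [d [F [hF curve]]]].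
  exact: main hmax.
move=> [phi [psi [hphi hpsi phiK psiK]]].
have hgY : has_genus (zeros iota [:: F]) g.
  apply: (genus_transport (morphism_over_is hphi) (morphism_over_is hpsi) phiK psiK _ hg).
  by exists P0.
have hNY : #|rational_points [:: F]| = (1 + q ^ 2 + 2 * q * g)%N.
  rewrite -hN; apply/eqP; rewrite eqn_leq.
  by rewrite (morphism_rational hphi phiK) (morphism_rational hpsi psiK).
have g2 := plane_curve_genus hF curve hgY.
(* A model of degree at most 2 has genus 0, whereas both intervals exclude their left end, which is
   nonnegative. *)
have d3 : (3 <= d)%N.
  rewrite ltnNge; apply/negP => d2'; have g0 : g = 0%N.
    by case: d d2' g2 {hF} => [|[|[|]]] // _; lia.
  have q1 : (1 < q)%N by have := finNzRing_gt1 k; rewrite hk; case: (q) => [|[|]].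
  move: gap; rewrite /in_genus_gap g0; case: ifP => oq /andP [h _].
    have q2 : (2 < q)%N by case: (q) q1 oq => [|[|[|]]].
    have q2' : (3%:R <= q%:R :> rat)%R by rewrite ler_nat.
    by move: h q2'; move: (q%:R : rat)%R => x; clear; nra.
  have q2' : (2%:R <= q%:R :> rat)%R by rewrite ler_nat.
  by move: h q2'; move: (q%:R : rat)%R => x; clear; nra.
exact: (genus_gap_contra hq d3 g2 q3 q5 gap (main d F g d3 hF (And3 curve hgY hNY))).
Qed.
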